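(* Let $(B_t; t\ge 0)$ be standard one-dimensional Brownian motion started at $0$. (1) There is no random time $T$ such that $(B_{T+u}-B_T; 0\le u\le 1)$ has the same distribution as the normalized Brownian excursion $(e_u; 0\le u\le 1)$. (2) There is no random time $T$ such that $(B_{T+u}-B_T; 0\le u\le 1)$ has the same distribution as the reflected Brownian bridge $(|b^0_u|; 0\le u\le 1)$. (3) There is no random time $T$ such that $(B_{T+u}-B_T; 0\le u\le 1)$ has the same distribution as the Vervaat transform of Brownian motion $(V_u; 0\le u\le 1)$. (4) For each fixed $\lambda<0$, there is no random time $T$ such that $(B_{T+u}-B_T; 0\le u\le 1)$ has the same distribution as the first passage bridge $(F^{\lambda,br}_u; 0\le u\le 1)$. (5) For each fixed $\lambda<0$, there is no random time $T$ such that $(B_{T+u}-B_T; 0\le u\le 1)$ has the same distribution as the Vervaat transform of Brownian bridge $(V^\lambda_u; 0\le u\le 1)$.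
   Context: A random time is a nonnegative finite random variable $T$; it need not be a stopping time, and external randomization is allowed. ''Same distribution'' means equality in law on the space $\mathcal{C}[0,1]$ of continuous real-valued paths on $[0,1]$ starting from $0$. For standard Brownian motion $B$ let $g_1:=\sup\{t<1; B_t=0\}$ and $d_1:=\inf\{t>1; B_t=0\}$. Brownian bridge: $b^0_u:=\frac{1}{\sqrt{g_1}}B_{ug_1}$, $0\le u\le 1$. Normalized Brownian excursion: $e_u:=\frac{1}{\sqrt{d_1-g_1}}|B_{g_1+u(d_1-g_1)}|$, $0\le u\le 1$. Vervaat transform of Brownian motion: with $\tau:=\mathrm{argmin}_{0\le t\le 1}B_t$, $V_u:=B_{\tau+u}-B_\tau$ for $0\le u\le 1-\tau$ and $V_u:=B_{\tau-1+u}+B_1-B_\tau$ for $1-\tau\le u\le 1$. First passage bridge through level $\lambda<0$: $(F^{\lambda,br}_u;0\le u\le 1)$ is distributed as $(B_u;0\le u\le 1)$ conditioned on $\tau_\lambda=1$, where $\tau_\lambda:=\inf\{t\ge 0; B_t<\lambda\}$. Vervaat transform of Brownian bridge ending at $\lambda<0$: let $(b^\lambda_u;0\le u\le 1)$ be Brownian bridge from $0$ to $\lambda$ of unit length, and $\tau:=\mathrm{argmin}_{0\le t\le 1}b^\lambda_t$; then $V^\lambda_u:=b^\lambda_{\tau+u}-b^\lambda_\tau$ for $0\le u\le 1-\tau$ and $V^\lambda_u:=b^\lambda_{\tau-1+u}+\lambda-b^\lambda_\tau$ for $1-\tau\le u\le 1$. *)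

(* Defs.v *)
From HB Require Import structures.
From mathcomp Require Import all_boot all_order all_algebra.
From mathcomp Require Import all_classical all_reals all_analysis.
From mathcomp Require Import lra.

Set Implicit Arguments.
Unset Strict Implicit.
Unset Printing Implicit Defensive.

Import Order.TTheory GRing.Theory Num.Theory.
Import numFieldNormedType.Exports.

Local Open Scope classical_set_scope.
Local Open Scope ring_scope.

Section within_continuity.
Variable R : realType.
Implicit Types (A : set R) (f g h : R -> R).

Lemma continuous_comp_within A f h : {within A, continuous f} ->
  continuous h -> (forall x, A (h x)) -> continuous (f \o h).
Proof.
move=> /subspace_continuousP cf ch Ah x U /= fU.
have fhU : nbhs (h x) [set y | A y -> U (f y)] by exact: (cf _ (Ah x) U fU).
have := ch x _ fhU; rewrite !nbhs_simpl/=.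
by apply: filterS => y /= /(_ (Ah y)).
Qed.

Lemma eq_within_continuous A f g : {in A, g =1 f} -> continuous g ->
  {within A, continuous f}.
Proof.
by move=> gf cg; apply: (subspace_eq_continuous gf); exact: continuous_subspaceT.
Qed.

End within_continuity.

Section path_spaces.
Variable R : realType.

(* Continuous paths on [0, +oo[ started at 0; values at negative times play no
   role. *)
Record cpath := CPath {
  cpath_fun :> R -> R ;
  cpath_cont : {within `[0, +oo[, continuous cpath_fun} ;
  cpath0 : cpath_fun 0 = 0 }.

Definition itv01 : set R := `[0, 1].

(* The space C[0,1] of continuous paths on [0,1] started at 0, as a subspace of
   the functions [0,1] -> R with the topology of uniform convergence;
   [valL_ 0 f : R -> R] extends f : [0,1] -> R by 0 outside [0,1]. *)
Definition C01_set : set (arrow_uniform_type itv01 R) :=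
  [set f : itv01 -> R | continuous f /\ valL_ 0 f 0 = 0].

Definition C01 : Type := set_type C01_set.

HB.instance Definition _ := PseudoMetric.on C01.

Definition C01_fun (f : C01) : R -> R := valL_ 0 (set_val f).
Coercion C01_fun : C01 >-> Funclass.

Lemma C01_cont (f : C01) : {within itv01, continuous f}.
Proof. by apply/subspace_valL_continuousP'; have [] := set_valP f. Qed.

Lemma C01_0 (f : C01) : f 0 = 0.
Proof. by have [] := set_valP f. Qed.

Section mkC01.
Variables (f : R -> R) (cf : {within itv01, continuous f}) (f0 : f 0 = 0).

Lemma mkC01_subproof : sigL itv01 f \in C01_set.
Proof.
apply/mem_set; split; first exact/subspace_sigL_continuousP.
have -> : valL_ 0 (sigL itv01 f) = patch (fun=> 0) itv01 f.
  by rewrite -(sigLK 0).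
by rewrite patchE; case: ifPn.
Qed.

Definition mkC01 : C01 := SigSub mkC01_subproof.

Lemma mkC01E : {in itv01, mkC01 =1 f}.
Proof.
move=> x x01; rewrite /C01_fun /=.
have := sigLK (0 : R) (A := itv01); move=> /(congr1 (fun h => h f x)) /=.
by rewrite patchE x01.
Qed.

End mkC01.

Definition C01_zero : C01 :=
  mkC01 (continuous_subspaceT (@cst_continuous R R 0)) erefl.

HB.instance Definition _ := isPointed.Build C01 C01_zero.

Definition clamp (t : R) : R := Num.max 0 (Num.min 1 t).

Lemma clamp_in t : itv01 (clamp t).
Proof.
rewrite /itv01 /clamp /= in_itv /= le_max lexx /=.
by rewrite ge_max ler01 /= ge_min lexx.
Qed.

Lemma clamp_id t : 0 <= t <= 1 -> clamp t = t.
Proof. by move=> /andP[t0 t1]; rewrite /clamp min_r// max_r. Qed.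

Lemma max0_continuous : continuous (Num.max (0 : R)).
Proof.
move=> t; apply: (@continuous_max R R (cst 0) idfun t); last exact: cvg_id.
exact: cst_continuous.
Qed.

Lemma clamp_continuous : continuous clamp.
Proof.
have min1 : continuous (Num.min (1 : R)); last first.
  by move=> t; apply: continuous_comp (min1 t) _; exact: max0_continuous.
move=> t; apply: (@continuous_min R R (cst 1) idfun t); last exact: cvg_id.
exact: cst_continuous.
Qed.

Lemma C01_clamp_continuous (f : C01) : continuous (f \o clamp).
Proof.
by apply: continuous_comp_within (@C01_cont f) clamp_continuous clamp_in.
Qed.

Lemma cpath_max0_continuous (w : cpath) : continuous (w \o Num.max 0).
Proof.
apply: (continuous_comp_within (@cpath_cont w) max0_continuous) => t.
by rewrite /= in_itv /= andbT le_max lexx.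
Qed.

Lemma cpath_comp_continuous (w : cpath) (h : R -> R) : continuous h ->
  (forall u, 0 <= u <= 1 -> 0 <= h u) -> {within itv01, continuous (w \o h)}.
Proof.
move=> ch h0; apply: (@eq_within_continuous _ _ _ (w \o Num.max 0 \o h)).
  move=> u /set_mem; rewrite /itv01 /= in_itv /= => u01.
  by rewrite max_r// h0.
move=> u; apply: continuous_comp; first exact: ch.
exact: cpath_max0_continuous.
Qed.

Definition shift_fun (w : cpath) (t u : R) : R := w (t + u) - w t.

Lemma shift_subproof (w : cpath) (t : {nonneg R}) :
  {within itv01, continuous (shift_fun w t%:num)} /\ shift_fun w t%:num 0 = 0.
Proof.
split; last by rewrite /shift_fun addr0 subrr.
apply: within_continuousB; last first.
  exact/continuous_subspaceT/cst_continuous.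
apply: (@cpath_comp_continuous w (fun u => t%:num + u)).
  by move=> u; apply: cvgD; [exact: cvg_cst|exact: cvg_id].
by move=> u /andP[u0 _]; rewrite addr_ge0.
Qed.

Definition shift01 (w : cpath) (t : {nonneg R}) : C01 :=
  mkC01 (shift_subproof w t).1 (shift_subproof w t).2.

Lemma restrict01_subproof (w : cpath) : {within itv01, continuous w}.
Proof.
by apply: (@cpath_comp_continuous w idfun) => [u|u /andP[]//]; exact: cvg_id.
Qed.

Definition restrict01 (w : cpath) : C01 :=
  mkC01 (@restrict01_subproof w) (cpath0 w).

(* For Brownian paths, g1 = 0 and the absence of a zero after 1 (for which d1 is
   the junk value 0) are null events; the divisions below then give the zero
   path. *)
Definition g1 (w : cpath) : R := sup [set t | 0 <= t < 1 /\ w t = 0].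

Definition d1 (w : cpath) : R := inf [set t | 1 < t /\ w t = 0].

Lemma g1_has_sup (w : cpath) : has_sup [set t | 0 <= t < 1 /\ w t = 0].
Proof.
split; first by exists 0; split; rewrite ?lexx ?ltr01// cpath0.
by exists 1 => t [/andP[_ /ltW]].
Qed.

Lemma g1_ge0 (w : cpath) : 0 <= g1 w.
Proof.
by apply: (sup_upper_bound (g1_has_sup w)); split;
  rewrite ?lexx ?ltr01// cpath0.
Qed.

Lemma cpath_g1 (w : cpath) : w (g1 w) = 0.
Proof.
apply/eqP/negPn/negP => wg0.
have g0 := g1_ge0 w.
have : (w \o Num.max 0) x @[x --> g1 w] --> (w \o Num.max 0) (g1 w).
  exact: cpath_max0_continuous.
rewrite /= (max_r g0) => /cvgrPdist_lt /(_ `|w (g1 w)|).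
rewrite normr_gt0 => /(_ wg0) /nbhs_ballP[e /= e0 He].
have [t [/andP[t0 t1] wt0] gt] := sup_adherent e0 (g1_has_sup w).
have tg : t <= g1 w by apply: (sup_upper_bound (g1_has_sup w)); rewrite /= t0 t1.
suff tge : ball (g1 w) e t.
  by have := He t tge; rewrite /= (max_r t0) wt0 subr0 ltxx.
by rewrite /ball /= ger0_norm ?subr_ge0// ltrBlDr -ltrBlDl.
Qed.

Definition brownian_bridge0_fun (w : cpath) (u : R) : R :=
  (Num.sqrt (g1 w))^-1 * w (u * g1 w).

Definition excursion_fun (w : cpath) (u : R) : R :=
  (Num.sqrt (d1 w - g1 w))^-1 * `|w (g1 w + u * (d1 w - g1 w))|.

Lemma reflected_bridge_subproof (w : cpath) :
  {within itv01, continuous (fun u => `|brownian_bridge0_fun w u|)} /\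
  `|brownian_bridge0_fun w 0| = 0.
Proof.
split; last by rewrite /brownian_bridge0_fun mul0r cpath0 mulr0 normr0.
have cw : {within itv01, continuous (w \o ( *%R^~ (g1 w)))}.
  apply: cpath_comp_continuous => [u|u /andP[u0 _]].
    by apply: cvgMl; exact: cvg_id.
  by rewrite /= mulr_ge0// g1_ge0.
move=> x; apply: cvg_norm; apply: cvgMr; exact: cw.
Qed.

Definition reflected_bridge (w : cpath) : C01 :=
  mkC01 (reflected_bridge_subproof w).1 (reflected_bridge_subproof w).2.

Lemma excursion_subproof (w : cpath) :
  {within itv01, continuous (excursion_fun w)} /\ excursion_fun w 0 = 0.
Proof.
split; last by rewrite /excursion_fun mul0r addr0 cpath_g1 normr0 mulr0.
have [dg|gd] := leP (d1 w) (g1 w).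
  have -> : excursion_fun w = cst 0.
    apply/funext => u.
    by rewrite /excursion_fun ler0_sqrtr ?subr_le0// invr0 mul0r.
  exact/continuous_subspaceT/cst_continuous.
have cw : {within itv01, continuous (w \o (fun u => g1 w + u * (d1 w - g1 w)))}.
  apply: cpath_comp_continuous => [u|u /andP[u0 _]].
    by apply: cvgD; [exact: cvg_cst|apply: cvgMl; exact: cvg_id].
  by rewrite addr_ge0 ?g1_ge0// mulr_ge0// subr_ge0 ltW.
move=> x; apply: cvgMr; apply: cvg_norm; exact: cw.
Qed.

Definition excursion (w : cpath) : C01 :=
  mkC01 (excursion_subproof w).1 (excursion_subproof w).2.

(* The minimum may be attained several times; inf selects the leftmost point. *)
Definition argmin (f : C01) : R :=
  inf [set t | 0 <= t <= 1 /\ forall s, 0 <= s <= 1 -> f t <= f s].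

Lemma argmin_in01 (f : C01) : 0 <= argmin f <= 1.
Proof.
rewrite /argmin; set M := (X in inf X).
have lbM : lbound M 0 by move=> t [/andP[]].
have [->|/set0P[t Mt]] := eqVneq M set0; first by rewrite inf0 lexx ler01.
apply/andP; split; first by apply: lb_le_inf => //; exists t.
apply: (@le_trans _ _ t); last by case: Mt => /andP[].
by apply: ge_inf => //; exists 0.
Qed.

Definition vervaat_fun (f : C01) (u : R) : R :=
  let tau := argmin f in
  if u <= 1 - tau then f (tau + u) - f tau
  else f (tau - 1 + u) + f 1 - f tau.

Lemma vervaat_subproof (f : C01) :
  {within itv01, continuous (vervaat_fun f)} /\ vervaat_fun f 0 = 0.
Proof.
have /andP[t0 t1] := argmin_in01 f.
have cshift a : continuous (fun u => (f \o clamp) (a + u)).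
  have ca : continuous (+%R a).
    by move=> u; apply: cvgD; [exact: cvg_cst|exact: cvg_id].
  by move=> u; apply: continuous_comp (ca u) _; exact: C01_clamp_continuous.
split; last by rewrite /vervaat_fun subr_ge0 t1 addr0 subrr.
apply: (@eq_within_continuous _ _ _ (fun u => (f \o clamp) (argmin f + u) +
    (f \o clamp) (argmin f - 1 + u) - f (argmin f))); last first.
  move=> u; apply: cvgB; last exact: cvg_cst.
  by apply: cvgD; apply: cshift.
move=> u /set_mem; rewrite /itv01 /= in_itv /= => /andP[u0 u1].
rewrite /vervaat_fun; case: ifPn => [ut|]; last rewrite -ltNge => ut.
  rewrite clamp_id; last by lra.
  have -> : clamp (argmin f - 1 + u) = 0.
    by rewrite /clamp max_l// ge_min; apply/orP; right; lra.
  by rewrite C01_0 addr0.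
have -> : clamp (argmin f + u) = 1.
  by rewrite /clamp min_l; [rewrite max_r|lra].
by rewrite clamp_id; [rewrite [f 1 + _]addrC|lra].
Qed.

Definition vervaat (f : C01) : C01 :=
  mkC01 (vervaat_subproof f).1 (vervaat_subproof f).2.

Definition brownian_bridge_fun (w : cpath) (lambda u : R) : R :=
  w u - u * w 1 + lambda * u.

Lemma brownian_bridge_subproof (w : cpath) (lambda : R) :
  {within itv01, continuous (brownian_bridge_fun w lambda)} /\
  brownian_bridge_fun w lambda 0 = 0.
Proof.
split; last by rewrite /brownian_bridge_fun cpath0 mul0r mulr0 subr0 addr0.
apply: within_continuousD; last first.
  by apply: continuous_subspaceT => u; apply: cvgMr; exact: cvg_id.
apply: within_continuousB; first exact: restrict01_subproof.
by apply: continuous_subspaceT => u; apply: cvgMl; exact: cvg_id.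
Qed.

Definition brownian_bridge (w : cpath) (lambda : R) : C01 :=
  mkC01 (brownian_bridge_subproof w lambda).1
        (brownian_bridge_subproof w lambda).2.

Definition passage_time (lambda : R) (w : cpath) : R :=
  inf [set t | 0 <= t /\ w t < lambda].

End path_spaces.

(* Borel sigma-algebra of the topology of uniform convergence *)
HB.instance Definition _ (R : realType) :=
  Measurable.copy (C01 R) (g_sigma_algebraType (@open (C01 R))).

Section laws.
Variable R : realType.

(* The second argument of normal_prob is the standard deviation. *)
Record brownian_motion d (Om : measurableType d) (P : probability Om R)
    (B : Om -> cpath R) : Prop := BrownianMotion {
  bm_measurable : forall t : R, 0 <= t -> measurable_fun setT (fun om => B om t) ;
  bm_normal : forall (s t : R) (A : set R), 0 <= s -> s < t -> measurable A ->
    P [set om | A (B om t - B om s)] = normal_prob 0 (Num.sqrt (t - s)) A ;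
  bm_indep : forall (n : nat) (t : nat -> R) (A : nat -> set R),
    0 <= t 0%N -> {homo t : i j / (i <= j)%N >-> i <= j} ->
    (forall i, measurable (A i)) ->
    P (\bigcap_(i in `I_n) [set om | A i (B om (t i.+1) - B om (t i))]) =
    (\prod_(i < n) P [set om | A i (B om (t i.+1) - B om (t i))%R])%E }.

Definition same_law d (Om : measurableType d) (P : probability Om R)
    d' (Om' : measurableType d') (Q : probability Om' R)
    (X : Om -> C01 R) (Y : Om' -> C01 R) : Prop :=
  forall A : set (C01 R), measurable A -> P (X @^-1` A) = Q (Y @^-1` A).

(* T need not be a stopping time, nor a function of the Brownian motion: the
   probability space may carry additional randomness. *)
Definition random_time d (Om : measurableType d) (T : Om -> {nonneg R}) : Prop :=
  measurable_fun setT (fun om => (T om)%:num).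

Definition regular_conditional_law d (Om : measurableType d)
    (P : probability Om R) (X : Om -> C01 R) (Y : Om -> R)
    (kappa : R.-pker R ~> C01 R) : Prop :=
  forall (A : set (C01 R)) (D : set R), measurable A -> measurable D ->
    (P (X @^-1` A `&` Y @^-1` D) = \int[P]_(om in Y @^-1` D) kappa (Y om) A)%E.

Definition weakly_continuous_at (kappa : R.-pker R ~> C01 R) (y : R) : Prop :=
  forall phi : C01 R -> R, continuous phi ->
    (exists M : R, forall f, `|phi f| <= M) ->
    (\int[kappa t]_f (phi f)%:E)%E @[t --> y] --> (\int[kappa y]_f (phi f)%:E)%E.

(* The law of (W_u; 0 <= u <= 1) conditioned on the null event
   passage_time lambda W = 1 is the value at 1 of a regular conditional law
   given passage_time lambda W that is weakly continuous at 1; since the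
   passage time has a positive density near 1, this determines the law. *)
Definition first_passage_bridge d (Om : measurableType d)
    (P : probability Om R) (W : Om -> cpath R) (lambda : R)
    d' (Om' : measurableType d') (Q : probability Om' R)
    (F : {RV Q >-> C01 R}) : Prop :=
  exists kappa : R.-pker R ~> C01 R,
    [/\ regular_conditional_law P (fun om => restrict01 (W om))
          (fun om => passage_time lambda (W om)) kappa,
        weakly_continuous_at kappa 1 &
        forall A : set (C01 R), measurable A -> Q (F @^-1` A) = kappa 1 A].

End laws.

(* Main.v *)
Require Import Defs.
From HB Require Import structures.
From mathcomp Require Import all_boot all_order all_algebra.
From mathcomp Require Import all_classical all_reals all_analysis.
From mathcomp Require Import measurable_realfun.
From mathcomp Require Import ring lra zify.

Set Implicit Arguments.
Unset Strict Implicit.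
Unset Printing Implicit Defensive.

Import Order.TTheory GRing.Theory Num.Theory.
Import numFieldNormedType.Exports.

Local Open Scope classical_set_scope.
Local Open Scope ring_scope.

(* Almost surely there is no time t at which B_{t+.} - B_t belongs to one of two
   exceptional events of C[0,1], and each of the five laws charges one of them.
   Excluding all times of an interval at once is a first-moment argument.

   (a) "f(1) = lambda is the minimum of f." A discretization of B with mesh v
   turns the existence of such a time t into the existence of j with S_{n+j} -
   S_j within r of lambda and S_{n+j} within r of the minimum of S on
   [n-q, n+j]. Given the first such j and the starting gap S_{n-q} - S_0
   up to r (which costs a factor kap r by independence), a near-hit at j+m
   occurs with probability of order r^2 / (m v), by the reflection principle for
   the past minimum and the Gaussian density for the increment. Summing the
   harmonic series over a range m = m0, ..., m0 2^K forces about K times more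
   near-hits than there are on average, so that the event has probability
   O(1 / K) for every K.

   (b) "f has local minima at 0 and at 1." The same argument applies, a hit
   being a time t that is a future minimum and such that t + 1 is a past minimum.

   The excursion, the reflected bridge and the Vervaat transform of the bridge
   all lie in (a) surely. The Vervaat transform of Brownian motion lies in (b) as
   soon as the argmin is interior, which has positive probability. For the first
   passage bridge, the paths with passage time t < 1 satisfy conditions whose
   limits as t -> 1 under weak continuity give (a) almost surely. *)

(** * Probabilities of events and independence of increments *)

(* [lia] after discarding the hypotheses that are not about natural numbers:
   its preprocessing is exponentially slow on real inequalities. *)
Ltac nlia := repeat match goal with H : ?T |- _ =>
  lazymatch T with
  | nat => fail
  | is_true (leq _ _) => fail
  | is_true (andb _ _) => fail
  | is_true (orb _ _) => fail
  | is_true (negb _) => fail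
  | @eq nat _ _ => fail
  | _ => clear H
  end end; lia.

(** The events are critical. At accuracy [r], each of the [n] grid times is a near-hit with
    probability of order [r^2]; even for [r] of order [n^(-1/2)] the expected number of near-hits is
    of order one, so a union bound proves nothing and only the logarithm in the harmonic sum wins.
    The order of choice matters: [K], then [r], then a mesh so fine that a step larger than [r] has
    probability small compared to [r]. This controls the overshoot in the discrete reflection
    principle. In (a), [S_{n+j} - S_j] involves the increments over [[j, n+j)], on which the returns
    after [j] also depend. Freezing [S_{n-q} - S_0] at a value [g] makes hits depend on [[0, j)] and
    [[n-q, n+j)] only, so that the increments following [j] and [n+j] are fresh. In (b), a hit at
    [j] looks into the future of [j], so a first hit is not independent of what follows. It is
    sandwiched: the failure of all earlier indices is made decidable at time [j], and the future
    condition at [j] becomes a separate independent factor. *)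

Section real_probability.
Context (R : realType) d (Om : measurableType d) (P : probability Om R).
Implicit Types A B C : set Om.

Definition pr A : R := fine (P A).

Lemma prE A : measurable A -> P A = (pr A)%:E.
Proof. by move=> mA; rewrite /pr fineK// fin_num_measure. Qed.

Lemma pr_ge0 A : 0 <= pr A.
Proof. by rewrite /pr fine_ge0. Qed.

Lemma pr_le A B : measurable A -> measurable B -> A `<=` B -> pr A <= pr B.
Proof.
by move=> mA mB AB; rewrite -lee_fin -!prE//; apply: le_measure => //; rewrite inE.
Qed.

Lemma pr0 : pr set0 = 0.
Proof. by rewrite /pr measure0. Qed.

Lemma prU_le A B : measurable A -> measurable B -> pr (A `|` B) <= pr A + pr B.
Proof.
move=> mA mB; rewrite -lee_fin EFinD -!prE//; last exact: measurableU.
exact: measureU2.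
Qed.

Lemma prU A B : measurable A -> measurable B -> A `&` B = set0 ->
  pr (A `|` B) = pr A + pr B.
Proof.
move=> mA mB AB; apply: EFin_inj; rewrite EFinD -!prE//; last exact: measurableU.
by rewrite measureU.
Qed.

Lemma pr_setID A B : measurable A -> measurable B ->
  pr A = pr (A `&` B) + pr (A `&` ~` B).
Proof.
move=> mA mB; rewrite -prU; first by rewrite -setIUr setUv setIT.
- exact: measurableI.
- by apply: measurableI => //; exact: measurableC.
- by rewrite setIACA setICr setI0.
Qed.

Lemma bigcup_ord_measurable n (F : nat -> set Om) :
  (forall i, (i < n)%N -> measurable (F i)) ->
  measurable (\bigcup_(i in `I_n) F i).
Proof. by move=> mF; apply: bigcup_measurable => i; exact: mF. Qed.

Lemma pr_bigcup_le n (F : nat -> set Om) :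
  (forall i, (i < n)%N -> measurable (F i)) ->
  pr (\bigcup_(i in `I_n) F i) <= \sum_(i < n) pr (F i).
Proof.
elim: n => [|n IH] mF; first by rewrite II0 bigcup_set0 pr0 big_ord0.
have mF' i : (i < n)%N -> measurable (F i) by move=> ?; apply: mF; lia.
rewrite IIS bigcup_setU bigcup_set1 big_ord_recr/=.
apply: le_trans (prU_le _ _) _; [exact: bigcup_ord_measurable|exact: mF|].
by rewrite lerD2r IH.
Qed.

Lemma pr_bigcup_disj n (F : nat -> set Om) :
  (forall i, (i < n)%N -> measurable (F i)) ->
  (forall i j, (i < j < n)%N -> F i `&` F j = set0) ->
  pr (\bigcup_(i in `I_n) F i) = \sum_(i < n) pr (F i).
Proof.
elim: n => [|n IH] mF H; first by rewrite II0 bigcup_set0 pr0 big_ord0.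
have mF' i : (i < n)%N -> measurable (F i) by move=> ?; apply: mF; lia.
rewrite IIS bigcup_setU bigcup_set1 big_ord_recr/= prU//.
- by rewrite IH// => i j ij; apply: H; lia.
- exact: bigcup_ord_measurable.
- exact: mF.
- by rewrite setI_bigcupl bigcup0// => i /= iltn; apply: H; lia.
Qed.

Lemma pr_sum_disj_le n (F : nat -> set Om) B :
  (forall i, (i < n)%N -> measurable (F i)) ->
  measurable B -> (forall i, (i < n)%N -> F i `<=` B) ->
  (forall i j, (i < j < n)%N -> F i `&` F j = set0) ->
  \sum_(i < n) pr (F i) <= pr B.
Proof.
move=> mF mB FB disj; rewrite -pr_bigcup_disj//; apply: pr_le => //.
  exact: bigcup_ord_measurable.
by move=> x [i /= iltn]; exact: FB.
Qed.

End real_probability.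

Section independence_criterion.
Context (R : realType) d (Om : measurableType d) (P : probability Om R).
Local Open Scope ereal_scope.
Implicit Types G H : set (set Om).

(** The events independent of [C] form a Dynkin system, so the pi-lambda theorem applies. *)
Lemma indep_gen_l G (C : set Om) : measurable C -> setI_closed G ->
  G `<=` measurable ->
  (forall A, G A -> P (A `&` C) = P A * P C) ->
  forall A, <<s G >> A -> P (A `&` C) = P A * P C.
Proof.
move=> mC GI Gm GC A sA.
have sGm : <<s G >> `<=` measurable.
  by apply: smallest_sub => //; exact: sigma_algebra_measurable.
suff: <<s G >> `<=` [set A | measurable A /\ P (A `&` C) = P A * P C].
  by move=> /(_ _ sA)[].
apply: lambda_system_subset => //.
  apply/dynkin_lambda_system; split.
  - by split=> //; rewrite setTI probability_setT mul1e.
  - move=> B [mB HB]; split; first exact: measurableC.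
    rewrite (setIC _ C) -setDE measureD//; last by rewrite ltey_eq fin_num_measure.
    rewrite [X in _ - P X]setIC HB probability_setC// muleBl ?mul1e// ?fin_num_adde_defl// ?fin_numN fin_num_measure//.
  - move=> F tF HF; split; first by apply: bigcup_measurable => k _; have [] := HF k.
    have mF k : measurable (F k) by have [] := HF k.
    rewrite setI_bigcupl !measure_bigcup//; last 2 first.
    + by move=> k _; exact: measurableI.
    + exact: trivIset_setIr.
    rewrite muleC (prE P mC) -nneseriesZl//.
    apply: eq_eseriesr => k _; have [_ HH] := HF k.
    by apply: (etrans HH); rewrite muleC (prE P mC).
move=> B GB; split; [exact: Gm|exact: GC].
Qed.

Lemma indep_gen G H : setI_closed G -> setI_closed H ->
  G `<=` measurable -> H `<=` measurable ->
  (forall A C, G A -> H C -> P (A `&` C) = P A * P C) ->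
  forall A C, <<s G >> A -> <<s H >> C -> P (A `&` C) = P A * P C.
Proof.
move=> GI HI Gm Hm GH A C sA sC.
have sGm : <<s G >> `<=` measurable.
  by apply: smallest_sub => //; exact: sigma_algebra_measurable.
rewrite setIC muleC; apply: (indep_gen_l _ HI) => // [|D HD]; first exact: sGm.
by rewrite setIC muleC; apply: (indep_gen_l _ GI) => //; [exact: Hm|move=> ? ?; exact: GH].
Qed.

End independence_criterion.

Section comparison_sets.
Context (R : realType) d (T : measurableType d) (f g : T -> R).
Hypotheses (mf : measurable_fun setT f) (mg : measurable_fun setT g).

Lemma measurable_set_ler : measurable [set x | f x <= g x].
Proof.
have := measurable_fun_ler mf mg; move=> /(_ measurableT [set true] Logic.I).
by rewrite setTI.
Qed.

Lemma measurable_set_ltr : measurable [set x | f x < g x].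
Proof.
have := measurable_fun_ltr mf mg; move=> /(_ measurableT [set true] Logic.I).
by rewrite setTI.
Qed.

End comparison_sets.

Section independent_family.
Context (R : realType) d (Om : measurableType d) (P : probability Om R).
Variables (n : nat) (xi : nat -> Om -> R).
Hypothesis mxi : forall i, (i < n)%N -> measurable_fun setT (xi i).
Hypothesis xi_indep : forall A : nat -> set R, (forall i, measurable (A i)) ->
  (P (\bigcap_(i in `I_n) (xi i @^-1` A i)) = \prod_(i < n) P (xi i @^-1` A i))%E.

(** Putting [setT] off [I] keeps one intersection over all of [I_n], the form in which [xi_indep] is
    stated, for every [I]. *)
Definition cylinders (I : pred nat) : set (set Om) :=
  [set C | exists A : nat -> set R, [/\ forall i, measurable (A i),
     forall i, ~~ I i -> A i = setT & C = \bigcap_(i in `I_n) (xi i @^-1` A i)]].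

(** The sigma-algebra of the [xi i] with [i] in [I]. [I] is arbitrary: unions of two separated
    blocks of indices are the main use. *)
Definition past (I : pred nat) (C : set Om) : Prop := <<s cylinders I >> C.

Let mpre i A : (i < n)%N -> measurable A -> measurable (xi i @^-1` A).
Proof. by move=> /mxi mi mA; rewrite -[X in measurable X]setTI; exact: mi. Qed.

Let cylinders_measurable I : cylinders I `<=` measurable.
Proof.
move=> _ [A [mA _ ->]]; apply: bigcap_measurableType => i /= iltn.
exact: mpre.
Qed.

Lemma past_measurable I C : past I C -> measurable C.
Proof.
move: C; apply: smallest_sub; first exact: sigma_algebra_measurable.
exact: cylinders_measurable.
Qed.

Let cylindersI I : setI_closed (cylinders I).
Proof.
move=> _ _ [A [mA AT ->]] [B [mB BT ->]]; exists (fun i => A i `&` B i); split.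
- by move=> i; exact: measurableI.
- by move=> i Ii; rewrite AT// BT// setIT.
- by rewrite -bigcapI.
Qed.

(** On cylinders, at each index one of the two sets is [setT], so the product splits factor by
    factor; [indep_gen] extends this to the generated sigma-algebras. *)
Lemma past_indep (I J : pred nat) A C : (forall i, I i -> J i -> False) ->
  past I A -> past J C -> pr P (A `&` C) = pr P A * pr P C.
Proof.
move=> IJ pA pC; apply: EFin_inj; rewrite EFinM -!prE; last 3 first.
- exact: past_measurable pC.
- exact: past_measurable pA.
- by apply: measurableI; [exact: past_measurable pA|exact: past_measurable pC].
apply: (indep_gen (@cylindersI I) (@cylindersI J)
  (@cylinders_measurable I) (@cylinders_measurable J) _ pA pC) => //.
move=> {pA pC} _ _ [{}A [mA AT ->]] [B [mB BT ->]].
rewrite -bigcapI.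
have /xi_indep : forall i, measurable (A i `&` B i) by move=> i; exact: measurableI.
move=> ->; rewrite (xi_indep mA) (xi_indep mB) -big_split/=.
apply: eq_bigr => i _.
case/boolP: (I i) => [Ii|Ii].
  have [Ji|Ji] := boolP (J i); first by case: (IJ _ Ii Ji).
  by rewrite BT// setIT preimage_setT probability_setT mule1.
by rewrite AT// setTI preimage_setT probability_setT mul1e.
Qed.

Lemma pastS (I J : pred nat) C : (forall i, (i < n)%N -> I i -> J i) ->
  past I C -> past J C.
Proof.
move=> IJ; move: C; apply: smallest_sub; first exact: smallest_sigma_algebra.
move=> _ [A [mA AT ->]]; apply: sub_gen_smallest.
exists (fun i => if (i < n)%N then A i else setT); split.
- by move=> i; case: ifP.
- move=> i Ji; case: ifPn => // iltn; apply: AT; apply: contra Ji; exact: IJ.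
- by apply: eq_bigcapr => i /= ->.
Qed.

Let mT (I : pred nat) := g_sigma_algebraType (cylinders I).

Lemma pastC I C : past I C -> past I (~` C).
Proof. move=> pC; exact: (@measurableC _ (mT I) C pC). Qed.

Lemma pastI I A C : past I A -> past I C -> past I (A `&` C).
Proof. move=> pA pC; exact: (@measurableI _ (mT I) A C pA pC). Qed.

Lemma past_bigcup I (D : set nat) F : (forall i, D i -> past I (F i)) ->
  past I (\bigcup_(i in D) F i).
Proof. by move=> pF; exact: (@bigcup_measurable _ (mT I) F D pF). Qed.

Lemma past_bigcap I (D : set nat) F : (forall i, D i -> past I (F i)) ->
  past I (\bigcap_(i in D) F i).
Proof. by move=> pF; exact: (@bigcap_measurableType _ (mT I) F D pF). Qed.

Definition past_fun (I : pred nat) (f : Om -> R) : Prop :=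
  @measurable_fun _ _ (mT I) R setT f.

Lemma past_preimage I f A : past_fun I f -> measurable A -> past I (f @^-1` A).
Proof. by move=> pf mA; rewrite -[f @^-1` A]setTI; exact: pf. Qed.

Lemma past_fun_measurable I f : past_fun I f -> measurable_fun setT f.
Proof.
move=> pf _ A mA; rewrite setTI; apply: (@past_measurable I).
exact: past_preimage.
Qed.

Lemma past_fun_xi (I : pred nat) i : (i < n)%N -> I i -> past_fun I (xi i).
Proof.
move=> iltn Ii _ A mA; rewrite setTI; apply: sub_gen_smallest.
exists (fun j => if j == i then A else setT); split.
- by move=> j; case: ifP.
- by move=> j; case: eqP => // ->; rewrite Ii.
- apply/seteqP; split=> [x /= Ax j /= _|x /(_ i) /=]; last by rewrite eqxx; exact.
  by case: eqP => // ->.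
Qed.

Lemma past_fun_cst I r : past_fun I (cst r).
Proof. exact: measurable_cst. Qed.

Lemma past_funD I f g : past_fun I f -> past_fun I g -> past_fun I (f \+ g).
Proof. exact: measurable_funD. Qed.

Lemma past_funB I f g : past_fun I f -> past_fun I g -> past_fun I (f \- g).
Proof. exact: measurable_funB. Qed.

Lemma past_fun_comp I f (g : R -> R) : measurable_fun setT g -> past_fun I f ->
  past_fun I (g \o f).
Proof. move=> mg mf; exact: (measurableT_comp mg mf). Qed.

Lemma past_le I f g : past_fun I f -> past_fun I g -> past I [set om | f om <= g om].
Proof. by move=> mf mg; exact: (@measurable_set_ler R _ (mT I) f g mf mg). Qed.

Lemma past_lt I f g : past_fun I f -> past_fun I g -> past I [set om | f om < g om].
Proof. by move=> mf mg; exact: (@measurable_set_ltr R _ (mT I) f g mf mg). Qed.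

End independent_family.

Section restricted_law.
Context (R : realType) d (Om : measurableType d) (P : probability Om R).
Context d' (T : measurableType d').

Definition restricted_law (E : set Om) (f : Om -> T) (mE : measurable E)
  (mf : measurable_fun setT f) (A : set T) : \bar R := P (E `&` f @^-1` A).

Variables (E : set Om) (f : Om -> T) (mE : measurable E).
Hypothesis mf : measurable_fun setT f.
Local Open Scope ereal_scope.

Let mpre A : measurable A -> measurable (f @^-1` A).
Proof. by move=> mA; rewrite -[X in measurable X]setTI; exact: mf. Qed.

Let restricted_law0 : restricted_law mE mf set0 = 0.
Proof. by rewrite /restricted_law preimage_set0 setI0 measure0. Qed.

Let restricted_law_ge0 A : 0 <= restricted_law mE mf A.
Proof. exact: measure_ge0. Qed.

Let restricted_law_sigma_additive : semi_sigma_additive (restricted_law mE mf).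
Proof.
move=> F mF tF mUF; rewrite /restricted_law preimage_bigcup setI_bigcupr.
apply: measure_semi_sigma_additive.
- by move=> n; apply: measurableI => //; exact: mpre.
- apply: trivIset_setIl; apply/trivIsetP => /= i j _ _ ij; rewrite -preimage_setI.
  by move/trivIsetP : tF => /(_ _ _ _ _ ij) ->//; rewrite preimage_set0.
- by apply: bigcupT_measurable => n; apply: measurableI => //; exact: mpre.
Qed.

HB.instance Definition _ := isMeasure.Build _ _ _ (restricted_law mE mf)
  restricted_law0 restricted_law_ge0 restricted_law_sigma_additive.

Let restricted_law_fin : fin_num_fun (restricted_law mE mf).
Proof.
move=> A mA; rewrite /restricted_law fin_num_measure//.
by apply: measurableI => //; exact: mpre.
Qed.

HB.instance Definition _ := @Measure_isFinite.Build _ T _ (restricted_law mE mf)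
  restricted_law_fin.

End restricted_law.

Section independent_pair.
Context (R : realType) d (Om : measurableType d) (P : probability Om R).
Variables (E : set Om) (Z D : Om -> R).
Hypothesis (mE : measurable E) (mZ : measurable_fun setT Z).
Hypothesis mD : measurable_fun setT D.
Hypothesis ind : forall A B, measurable A -> measurable B ->
  pr P ((E `&` Z @^-1` A) `&` D @^-1` B) =
  pr P (E `&` Z @^-1` A) * pr P (D @^-1` B).
Local Open Scope ereal_scope.

Let mpre (f : Om -> R) A : measurable_fun setT f -> measurable A ->
  measurable (f @^-1` A).
Proof. by move=> mf mA; rewrite -[X in measurable X]setTI; exact: mf. Qed.

Local Notation nu := (restricted_law P mE mZ).

(* Fubini: on [E], the pair [(Z, D)] has law [nu] times the law of [D]. *)
Lemma independent_pair_law (M : set (R * R)) : measurable M ->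
  P (E `&` [set om | M (Z om, D om)]) =
  \int[nu]_z P (D @^-1` (xsection M z)).
Proof.
move=> mM.
have mZD : measurable_fun setT (fun om => (Z om, D om)) by exact: measurable_fun_pair.
have H A B : measurable A -> measurable B ->
    restricted_law P mE mZD (A `*` B) =
    nu A * restricted_law P measurableT mD B.
  move=> mA mB; rewrite /restricted_law setTI.
  have -> : E `&` (fun om => (Z om, D om)) @^-1` (A `*` B) =
            (E `&` Z @^-1` A) `&` D @^-1` B.
    by apply/seteqP; split=> x /=; tauto.
  have mEA : measurable (E `&` Z @^-1` A) by apply: measurableI => //; exact: mpre.
  have mDB : measurable (D @^-1` B) by exact: mpre.
  rewrite (prE P mEA) (prE P mDB) -EFinM -ind// prE//.
  exact: measurableI.
rewrite -[LHS](product_measure_unique H)// /product_measure1.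
by apply: eq_integral => z _; rewrite /= /restricted_law setTI.
Qed.

Lemma measurable_pr_xsection (M : set (R * R)) : measurable M ->
  measurable_fun setT (fun z => P (D @^-1` (xsection M z))).
Proof.
move=> mM.
have := measurable_fun_xsection (restricted_law P measurableT mD) mM.
apply: eq_measurable_fun => z _ /=.
by rewrite /restricted_law setTI.
Qed.

Let mxs (M : set (R * R)) z : measurable M -> measurable (D @^-1` (xsection M z)).
Proof. by move=> mM; apply: mpre => //; exact: measurable_xsection. Qed.

Let mM2 (M : set (R * R)) : measurable M -> measurable [set om | M (Z om, D om)].
Proof.
move=> mM; rewrite -[X in measurable X]setTI.
exact: (measurable_fun_pair mZ mD).
Qed.

Let xsE (M : set (R * R)) z : D @^-1` (xsection M z) = [set om | M (z, D om)].
Proof. by apply/seteqP; split=> om /=; rewrite /xsection/= inE. Qed.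

Lemma independent_pair_ub (M : set (R * R)) (c : R) : measurable M ->
  (forall z, (pr P [set om | M (z, D om)] <= c)%R) ->
  (pr P (E `&` [set om | M (Z om, D om)]) <= c * pr P E)%R.
Proof.
move=> mM Mc.
have c0 : (0 <= c)%R by apply: le_trans (Mc 0%R); exact: pr_ge0.
rewrite -lee_fin -prE; last by apply: measurableI => //; exact: mM2.
rewrite independent_pair_law//.
apply: (@le_trans _ _ (\int[nu]_z (cst c%:E z))); last first.
  rewrite integral_cst//= /restricted_law preimage_setT setIT.
  by rewrite prE.
apply: ge0_le_integral => //=.
- exact: measurable_pr_xsection.
- by move=> z _; rewrite prE ?lee_fin ?xsE//; rewrite -xsE; exact: mxs.
Qed.

(** The lower bound need only hold for [z] in [V]: Gaussian densities are bounded below on bounded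
    ranges only. *)
Lemma independent_pair_lb (M : set (R * R)) (V : set R) (c : R) : measurable M ->
  measurable V -> (0 <= c)%R -> E `<=` Z @^-1` V ->
  (forall z, V z -> (c <= pr P [set om | M (z, D om)])%R) ->
  (c * pr P E <= pr P (E `&` [set om | M (Z om, D om)]))%R.
Proof.
move=> mM mV c0 EV Mc.
rewrite -lee_fin -prE; last by apply: measurableI => //; exact: mM2.
rewrite independent_pair_law//.
apply: (@le_trans _ _ (\int[nu]_(z in V) (cst c%:E z))).
  rewrite integral_cst//= /restricted_law setIidl//.
  by rewrite prE.
apply: (@le_trans _ _ (\int[nu]_(z in V) P (D @^-1` (xsection M z)))).
  apply: ge0_le_integral => //=.
    - by apply: measurable_funTS; exact: measurable_pr_xsection.
  - move=> z Vz; rewrite prE ?lee_fin ?xsE ?Mc//; rewrite -xsE; exact: mxs.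
apply: ge0_subset_integral => //; exact: measurable_pr_xsection.
Qed.

(** With [Z] frozen by Fubini, [D] may be replaced by [- D]: this is the reflection after a stopping
    index. *)
Lemma independent_pair_sym (b : R) :
  (forall B, measurable B -> pr P (D @^-1` B) = pr P ((fun om => - D om)%R @^-1` B)) ->
  pr P (E `&` [set om | (b <= Z om + D om)%R]) =
  pr P (E `&` [set om | (b <= Z om - D om)%R]).
Proof.
move=> sym.
pose M := [set x : R * R | (b <= x.1 + x.2)%R].
pose M' := [set x : R * R | (b <= x.1 - x.2)%R].
have mM : measurable M.
  apply: measurable_set_ler => //.
  by apply: measurable_funD; [exact: measurable_fst|exact: measurable_snd].
have mM' : measurable M'.
  apply: measurable_set_ler => //.
  by apply: measurable_funB; [exact: measurable_fst|exact: measurable_snd].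
apply: EFin_inj; rewrite -!prE; last 2 first.
- by apply: measurableI => //; exact: (mM2 mM').
- by apply: measurableI => //; exact: (mM2 mM).
rewrite (independent_pair_law mM) (independent_pair_law mM').
apply: eq_integral => z _.
rewrite !prE; [|exact: mxs..].
congr (_%:E); rewrite sym; last exact: measurable_xsection.
by congr (pr P _); apply/seteqP; split=> om /=; rewrite /xsection/= !inE.
Qed.

End independent_pair.

(** * Gaussian random walks staying above a level *)

Section reflection.
Context (R : realType) d (Om : measurableType d) (P : probability Om R).
Variables (m : nat) (W : nat -> Om -> R).
Local Notation xi := (fun i om => W i.+1 om - W i om).
Hypothesis mxi : forall i, (i < m)%N -> measurable_fun setT (xi i).
Hypothesis xi_indep : forall A : nat -> set R, (forall i, measurable (A i)) ->
  (P (\bigcap_(i in `I_m) (xi i @^-1` A i)) = \prod_(i < m) P (xi i @^-1` A i))%E.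
Hypothesis W_sym : forall i B, (i <= m)%N -> measurable B ->
  pr P ((fun om => W m om - W i om) @^-1` B) =
  pr P ((fun om => - (W m om - W i om)) @^-1` B).

Local Notation S i om := (W i om - W 0%N om).

Lemma past_fun_increment (I : pred nat) a b : (a <= b <= m)%N ->
  (forall i, (a <= i < b)%N -> I i) ->
  past_fun m xi I (fun om => W b om - W a om).
Proof.
move=> /andP[]; elim: b => [|b IH] ab bm aI.
  have -> : a = 0%N by lia.
  have -> : (fun om => W 0%N om - W 0%N om) = cst 0.
    by apply/funext => om; rewrite subrr.
  exact: past_fun_cst.
have [->|ab'] := eqVneq a b.+1.
  have -> : (fun om => W b.+1 om - W b.+1 om) = cst 0.
    by apply/funext => om; rewrite subrr.
  exact: past_fun_cst.
have -> : (fun om => W b.+1 om - W a om) =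
    (fun om => W b om - W a om) \+ xi b.
  by apply/funext => om /=; lra.
apply: past_funD; first by apply: IH => [||i /andP[? ?]]; [lia|lia|apply: aI; lia].
by apply: past_fun_xi => //; apply: aI; lia.
Qed.

(** Indices strictly below [k] are constrained, so a walk of [m] steps stays throughout when
    [k = m.+1]. *)
Definition stay (rho : R) (k : nat) : set Om :=
  \bigcap_(i in `I_k) [set om | - rho <= S i om].

Definition first_exit (rho : R) (i : nat) : set Om :=
  stay rho i `&` [set om | S i om < - rho].

Let before i : pred nat := fun j => (j < i)%N.
Let after i : pred nat := fun j => (i <= j)%N.

Lemma past_stay rho k : (k <= m.+1)%N -> past m xi (before k.-1) (stay rho k).
Proof.
move=> km; apply: past_bigcap => i /= ik.
apply: past_le; first exact: past_fun_cst.
by apply: past_fun_increment => [|j]; rewrite /before; lia.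
Qed.

Let past_first_exit rho i : (i <= m)%N -> past m xi (before i) (first_exit rho i).
Proof.
move=> im; apply: pastI.
  apply: (@pastS _ _ _ _ _ (before i.-1)) => [j _|]; first by rewrite /before; lia.
  by apply: past_stay; lia.
apply: past_lt; last exact: past_fun_cst.
by apply: past_fun_increment => [|j]; rewrite /before; lia.
Qed.

Let mS i : (i <= m)%N -> measurable_fun setT (fun om => S i om).
Proof.
move=> im; apply: (@past_fun_measurable _ _ _ _ _ mxi predT).
by apply: past_fun_increment => //.
Qed.

Lemma measurable_stay rho k : (k <= m.+1)%N -> measurable (stay rho k).
Proof. by move=> km; apply: (past_measurable mxi); exact: past_stay. Qed.

Let mE rho i : (i <= m)%N -> measurable (first_exit rho i).
Proof. by move=> im; apply: (past_measurable mxi); exact: past_first_exit. Qed.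

Let first_exit_disj rho i j : (i < j)%N -> first_exit rho i `&` first_exit rho j = set0.
Proof.
move=> ij; apply/seteqP; split => // om [[_ /= Si] [/(_ i ij) /= Si' _]].
by move: Si; rewrite ltNge Si'.
Qed.

Let stayC rho : ~` stay rho m.+1 = \bigcup_(i in `I_m.+1) first_exit rho i.
Proof.
apply/seteqP; split => om /=; last first.
  by move=> [i /= im [_ /= Si]] /(_ i im) /=; rewrite leNgt Si.
move=> /existsNP[i /not_implyP[/= im /negP]].
rewrite -ltNge => Si.
have ex : exists i, S i om < - rho by exists i.
exists (ex_minn ex); case: ex_minnP => j Sj minj.
  by rewrite /=; have := minj _ Si; lia.
split => // k /= kj; rewrite leNgt; apply/negP => Sk.
by have := minj _ Sk; lia.
Qed.

Let exit_sum rho (B : set Om) : measurable B ->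
  pr P (~` stay rho m.+1 `&` B) = \sum_(i < m.+1) pr P (first_exit rho i `&` B).
Proof.
move=> mB; rewrite stayC setI_bigcupl pr_bigcup_disj//.
- by move=> i im; apply: measurableI => //; exact: mE.
- move=> i j /andP[ij _].
  by rewrite setIACA first_exit_disj// set0I.
Qed.

Let mge (b : R) : measurable [set om | b <= S m om].
Proof. by apply: measurable_set_ler => //; exact: mS. Qed.

Let mle (b : R) : measurable [set om | S m om <= b].
Proof. by apply: measurable_set_ler => //; exact: mS. Qed.

Let mlt (b : R) : measurable [set om | S m om < b].
Proof. by apply: measurable_set_ltr => //; exact: mS. Qed.

Let mrefl i (b : R) : (i <= m)%N ->
  measurable [set om | b <= S i om - (W m om - W i om)].
Proof.
move=> im; apply: measurable_set_ler => //; apply: measurable_funB; first exact: mS.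
apply: (@past_fun_measurable _ _ _ _ _ mxi predT).
by apply: past_fun_increment => //; rewrite im leqnn.
Qed.

(** The exit at [i] is decided by the increments before [i], while the remaining displacement is
    independent of them and symmetric. *)
Let reflect (rho b : R) i : (i <= m)%N ->
  pr P (first_exit rho i `&` [set om | b <= S m om]) =
  pr P (first_exit rho i `&` [set om | b <= S i om - (W m om - W i om)]).
Proof.
move=> im.
have pD : past_fun m xi (after i) (fun om => W m om - W i om).
  by apply: past_fun_increment => [|j]; rewrite /after; lia.
have pZ : past_fun m xi (before i) (fun om => S i om).
  by apply: past_fun_increment => [|j]; rewrite /before; lia.
rewrite -(@independent_pair_sym _ _ _ P (first_exit rho i)
  (fun om => S i om) (fun om => W m om - W i om)).
- by congr (pr P (_ `&` _)); apply/seteqP; split=> om /=; lra.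
- exact: mE.
- exact: mS.
- exact: (past_fun_measurable mxi pD).
- move=> A B mA mB.
  apply: (past_indep mxi xi_indep (I := before i) (J := after i)).
  + by move=> j; rewrite /before /after; lia.
  + by apply: pastI; [exact: past_first_exit|exact: past_preimage].
  + exact: past_preimage.
- by move=> B mB; exact: W_sym.
Qed.

Let sym_le (b : R) : pr P [set om | S m om <= - b] = pr P [set om | b <= S m om].
Proof.
have := @W_sym 0 `]-oo, - b]%classic (leq0n _) (measurable_itv _).
rewrite /preimage/=.
have -> : [set om | S m om \in `]-oo, - b]] = [set om | S m om <= - b].
  by apply/seteqP; split => om /=; rewrite in_itv.
by move=> ->; congr (pr P _); apply/seteqP; split => om /=; rewrite in_itv/= lerN2.
Qed.

Let sym_lt (b : R) : pr P [set om | S m om < - b] = pr P [set om | b < S m om].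
Proof.
have := @W_sym 0 `]-oo, - b[%classic (leq0n _) (measurable_itv _).
rewrite /preimage/=.
have -> : [set om | S m om \in `]-oo, - b[] = [set om | S m om < - b].
  by apply/seteqP; split => om /=; rewrite in_itv.
by move=> ->; congr (pr P _); apply/seteqP; split => om /=; rewrite in_itv/= ltrN2.
Qed.

(** A path that exits at [i] and ends above [b] is reflected to one that ends below [- (b + 2 rho)],
    because [S i < - rho]. The overshoot at the exit only helps, and symmetry turns the reflected
    event into [S m > b + 2 rho]. *)
Lemma pr_stay_ge (rho b : R) : 0 <= rho ->
  pr P [set om | b <= S m om <= b + 2 * rho] <=
  pr P (stay rho m.+1 `&` [set om | b <= S m om]).
Proof.
move=> rho0.
have mst : measurable (stay rho m.+1) by exact: measurable_stay.
have mst' := measurableC mst.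
have H1 : pr P [set om | b <= S m om] =
    pr P [set om | b <= S m om <= b + 2 * rho] + pr P [set om | b + 2 * rho < S m om].
  rewrite (pr_setID P (mge b) (mle (b + 2 * rho))); congr (pr P _ + pr P _).
    by apply/seteqP; split => om /=; lra.
  by apply/seteqP; split => om /=; lra.
have H2 := pr_setID P (mge b) mst.
rewrite setIC [X in _ = _ + pr P X]setIC (exit_sum rho (mge b)) in H2.
have H3 : \sum_(i < m.+1) pr P (first_exit rho i `&` [set om | b <= S m om]) <=
    pr P [set om | S m om < - (b + 2 * rho)].
  apply: (@le_trans _ _ (\sum_(i < m.+1)
    pr P (first_exit rho i `&` [set om | S m om < - (b + 2 * rho)]))).
    apply: ler_sum => -[i im] _ /=; rewrite reflect//.
    apply: pr_le.
    - by apply: measurableI; [exact: mE|exact: mrefl].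
    - by apply: measurableI => //; exact: mE.
    - by move=> om [Ei /= bS]; split => //; case: Ei => _ /= ?; lra.
  rewrite -exit_sum//; apply: pr_le => //.
  exact: measurableI.
by rewrite sym_lt in H3; lra.
Qed.

Definition jump (o : R) : set Om := \bigcup_(i in `I_m) [set om | o < `|xi i om|].

Lemma measurable_jump o : measurable (jump o).
Proof.
apply: bigcup_ord_measurable => i im; apply: measurable_set_ltr => //.
by apply: measurableT_comp; [exact: normr_measurable|exact: mxi].
Qed.

(** In this direction the overshoot below [- rho] is harmful. Off [jump o] it is at most [o], which
    after reflection widens the interval by [2 o]. *)
Lemma pr_stay_le (rho o b : R) : 0 <= rho -> 0 < o -> - rho <= b ->
  pr P (stay rho m.+1 `&` [set om | b <= S m om]) <=
  pr P [set om | b <= S m om <= b + 2 * rho + 2 * o] + pr P (jump o).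
Proof.
move=> rho0 o0 rb.
have mst : measurable (stay rho m.+1) by exact: measurable_stay.
have mst' := measurableC mst.
have mJ := measurable_jump o; have mJ' := measurableC mJ.
set c := b + 2 * rho + 2 * o.
have mbc : measurable [set om | b <= S m om <= c].
  rewrite (_ : [set _ | _] = [set om | b <= S m om] `&` [set om | S m om <= c]).
    exact: measurableI.
  by apply/seteqP; split => om /= => [/andP|] [->].
have H1 : pr P [set om | b <= S m om] <=
    pr P [set om | b <= S m om <= c] + pr P [set om | c <= S m om].
  apply: le_trans (prU_le _ _ _) => //; apply: pr_le => //; first exact: measurableU.
  by move=> om /= -> /=; case: (leP (S m om) c) => [|/ltW]; [left|right].
have H2 := pr_setID P (mge b) mst.
rewrite setIC [X in _ = _ + pr P X]setIC (exit_sum rho (mge b)) in H2.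
have H3 : pr P (~` jump o `&` [set om | S m om <= - c]) <=
    \sum_(i < m.+1) pr P (first_exit rho i `&` [set om | b <= S m om]).
  apply: (@le_trans _ _ (\sum_(i < m.+1) pr P (first_exit rho i `&`
    (~` jump o `&` [set om | S m om <= - c])))).
    rewrite -exit_sum; last exact: measurableI.
    apply: pr_le.
    - exact: measurableI.
    - by apply: measurableI => //; exact: measurableI.
    (* Since [b >= - rho], an end below [- c] is below [- rho]: the walk has exited. *)
    - move=> om [/= nJ Sc]; split => // /(_ m (leqnn _)) /=.
      by move: Sc; rewrite /c; lra.
  apply: ler_sum => -[i im] _ /=; rewrite reflect//.
  apply: pr_le.
  - by apply: measurableI; [exact: mE|exact: measurableI].
  - by apply: measurableI; [exact: mE|exact: mrefl].
  - move=> om [Ei [/= nJ Sc]]; split => //; move: Ei => [/= st Si].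
    (* There is no exit at index [0]; at [i.+1] the walk was still above [- rho] one step
       earlier. *)
    case: i im st Si => [|i] im st Si; first by move: Si; lra.
    have := st i (ltnSn _); rewrite /=.
    have : `|xi i om| <= o.
      by rewrite leNgt; apply/negP => oj; apply: nJ; exists i.
    by rewrite ler_norml => /andP[? ?]; move: Sc; rewrite /c; lra.
have H4 := pr_setID P (mle (- c)) mJ.
have H5 : pr P ([set om | S m om <= - c] `&` jump o) <= pr P (jump o).
  by apply: pr_le => //; exact: measurableI.
rewrite [X in _ = _ + pr P X]setIC sym_le in H4.
by lra.
Qed.

End reflection.

Section gaussian_estimates.
Context (R : realType).
Implicit Types (a b t M : R).

(* [kap / sqrt t] is the maximum of the density of N(0, t). *)
Definition kap : R := (Num.sqrt (pi *+ 2))^-1.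

Lemma kap_gt0 : 0 < kap.
Proof. by rewrite invr_gt0 sqrtr_gt0 mulrn_wgt0// pi_gt0. Qed.

Definition gauss t (A : set R) : R := fine (normal_prob 0 (Num.sqrt t) A).

Let pdfE t x : 0 < t -> normal_pdf 0 (Num.sqrt t) x =
  kap / Num.sqrt t * expR (- (x ^+ 2 / (2 * t))).
Proof.
move=> t0; rewrite normal_pdfE; last by rewrite gt_eqF// sqrtr_gt0.
rewrite /normal_peak /normal_fun sqr_sqrtr ?ltW// subr0 -mulrnAr.
congr (_ * expR _); last by rewrite mulNr mulr_natl.
by rewrite sqrtrM ?ltW// invfM mulrC.
Qed.

Let gaussE t A : measurable A -> (gauss t A)%:E = normal_prob 0 (Num.sqrt t) A.
Proof. by move=> mA; rewrite /gauss fineK// fin_num_measure. Qed.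

Let itv_measure a b : a <= b ->
  lebesgue_measure (`[a, b]%classic : set R) = (b - a)%:E.
Proof.
move=> ab; rewrite lebesgue_measure_itv/= lte_fin.
by move: ab; rewrite le_eqVlt => /predU1P[->|->]; [rewrite ltxx subrr|rewrite EFinB].
Qed.

Let pdf_measurable t (A : set R) :
  measurable_fun A (fun x => (normal_pdf 0 (Num.sqrt t) x)%:E).
Proof.
apply: measurable_funTS; apply/measurable_EFinP; exact: measurable_normal_pdf.
Qed.

Lemma gauss_itv_ub_center t a b M : 0 < t -> a <= b -> 0 <= M -> M <= a ->
  gauss t `[a, b]%classic <= kap / Num.sqrt t * (b - a) * expR (- (M ^+ 2 / (2 * t))).
Proof.
move=> t0 ab M0 Ma; rewrite -lee_fin gaussE// /normal_prob.
rewrite mulrAC EFinM -itv_measure// -integral_cst//.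
apply: ge0_le_integral => //.
- by move=> x _; rewrite lee_fin normal_pdf_ge0.
- exact: pdf_measurable.
- move=> x /=; rewrite in_itv/= => /andP[ax xb].
  rewrite lee_fin pdfE// ler_wpM2l//.
    by rewrite divr_ge0 ?sqrtr_ge0// ltW// kap_gt0.
  rewrite ler_expR lerN2 ler_wpM2r//; first by rewrite invr_ge0; lra.
  by rewrite ler_sqr ?nnegrE; lra.
Qed.

Lemma gauss_itv_ub t a b : 0 < t -> a <= b ->
  gauss t `[a, b]%classic <= kap / Num.sqrt t * (b - a).
Proof.
move=> t0 ab; rewrite -lee_fin gaussE// /normal_prob.
rewrite EFinM -itv_measure// -integral_cst//.
apply: ge0_le_integral => //.
- by move=> x _; rewrite lee_fin normal_pdf_ge0.
- exact: pdf_measurable.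
- move=> x _; rewrite lee_fin pdfE// ler_piMr//.
    by rewrite divr_ge0 ?sqrtr_ge0// ltW// kap_gt0.
  by rewrite expR_le1 oppr_le0 divr_ge0 ?sqr_ge0//; lra.
Qed.

Lemma gauss_itv_lb t a b M : 0 < t -> a <= b -> - M <= a -> b <= M ->
  kap / Num.sqrt t * (b - a) * expR (- (M ^+ 2 / (2 * t))) <= gauss t `[a, b]%classic.
Proof.
move=> t0 ab Ma bM; rewrite -lee_fin gaussE// /normal_prob.
rewrite mulrAC EFinM -itv_measure// -integral_cst//.
apply: ge0_le_integral => //.
- move=> x _; rewrite lee_fin mulr_ge0 ?expR_ge0//.
  by rewrite divr_ge0 ?sqrtr_ge0// ltW// kap_gt0.
- exact: pdf_measurable.
- move=> x /=; rewrite in_itv/= => /andP[ax xb].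
  rewrite lee_fin pdfE// ler_wpM2l//.
    by rewrite divr_ge0 ?sqrtr_ge0// ltW// kap_gt0.
  rewrite ler_expR lerN2 ler_wpM2r//; first by rewrite invr_ge0; lra.
  rewrite -[x ^+ 2]real_normK ?num_real// ler_sqr ?nnegrE//; last by lra.
  by rewrite ler_norml; lra.
Qed.

(** Within one standard deviation the density is at least [exp(-1/2) >= 1/2] times its maximum. *)
Lemma gauss_itv_lb_half t a b : 0 < t -> a <= b ->
  - Num.sqrt t <= a -> b <= Num.sqrt t ->
  kap / Num.sqrt t * ((b - a) / 2) <= gauss t `[a, b]%classic.
Proof.
move=> t0 ab ta bt; apply: le_trans (gauss_itv_lb t0 ab ta bt).
rewrite mulrA ler_wpM2l//.
  by rewrite mulr_ge0 ?subr_ge0// divr_ge0 ?sqrtr_ge0// ltW// kap_gt0.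
rewrite sqr_sqrtr ?(ltW t0)//.
have -> : t / (2 * t) = 2^-1 by field; rewrite gt_eqF.
by apply: le_trans (expR_ge1Dx _); lra.
Qed.

Lemma gauss_sym t A : 0 < t -> measurable A ->
  gauss t A = gauss t (-%R @^-1` A).
Proof.
move=> t0 mA.
have mNA : measurable ((-%R : R -> R) @^-1` A).
  by rewrite -[X in measurable X]setTI; exact: oppr_measurable.
apply: EFin_inj; rewrite !gaussE// /normal_prob.
pose f (x : R) := (normal_pdf 0 (Num.sqrt t) x)%:E.
transitivity (\int[pushforward lebesgue_measure (-%R : _ -> measurableTypeR R)]_(x in A) f x)%E.
  by apply: eq_measure_integral => //= B mB BA; exact/esym/lebesgue_measureN.
rewrite ge0_integral_pushforward//=.
- by apply: eq_integral => x _; rewrite /f/= !pdfE// sqrrN.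
- exact: pdf_measurable.
- by move=> x _; rewrite lee_fin normal_pdf_ge0.
Qed.

End gaussian_estimates.

Section gaussian_walk.
Context (R : realType) d (Om : measurableType d) (P : probability Om R).

Record gaussian_walk (m : nat) (W : nat -> Om -> R) (v : R) : Prop := GaussianWalk {
  gw_measurable : forall i, (i < m)%N -> measurable_fun setT (fun om => W i.+1 om - W i om) ;
  gw_indep : forall A : nat -> set R, (forall i, measurable (A i)) ->
    (P (\bigcap_(i in `I_m) [set om | A i (W i.+1 om - W i om)%R]) =
     \prod_(i < m) P [set om | A i (W i.+1 om - W i om)%R])%E ;
  gw_law : forall i j A, (i < j <= m)%N -> measurable A ->
    pr P [set om | A (W j om - W i om)] = gauss ((j - i)%:R * v) A }.

Variables (m : nat) (W : nat -> Om -> R) (v : R).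
Hypotheses (gW : gaussian_walk m W v) (m0 : (0 < m)%N) (v0 : 0 < v).
Local Notation S om := (W m om - W 0%N om).
Local Notation t := (m%:R * v).

Let t0 : 0 < t. Proof. by rewrite mulr_gt0// ltr0n. Qed.
Let st0 : 0 < Num.sqrt t. Proof. by rewrite sqrtr_gt0. Qed.
Let kst0 : 0 < @kap R / Num.sqrt t.
Proof. by rewrite divr_gt0// kap_gt0. Qed.

Let W_sym i B : (i <= m)%N -> measurable B ->
  pr P ((fun om => W m om - W i om) @^-1` B) =
  pr P ((fun om => - (W m om - W i om)) @^-1` B).
Proof.
move=> im mB.
have mNB : measurable ((-%R : R -> R) @^-1` B).
  by rewrite -[X in measurable X]setTI; exact: oppr_measurable.
have [->|im'] := eqVneq i m.
  by congr (pr P _); apply/funext => om; rewrite /preimage/= subrr oppr0.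
have im2 : (i < m <= m)%N by rewrite ltn_neqAle im' im leqnn.
rewrite [LHS](gw_law gW im2 mB) gauss_sym//; last first.
  by rewrite mulr_gt0// ltr0n subn_gt0; case/andP: im2.
by rewrite -(gw_law gW im2 mNB).
Qed.

Let mS : measurable_fun setT (fun om => S om).
Proof.
apply: (past_fun_measurable (gw_measurable gW) (I := predT)).
by apply: past_fun_increment => //; rewrite leqnn.
Qed.

Lemma pr_walk_itv a b : pr P [set om | a <= S om <= b] = gauss t `[a, b]%classic.
Proof.
have := @gw_law _ _ _ gW 0 m `[a, b]%classic.
by rewrite m0 leqnn subn0 => <-.
Qed.

Lemma pr_stay_ge_gauss rho b : 0 <= rho -> - Num.sqrt t <= b ->
  b + 2 * rho <= Num.sqrt t ->
  @kap R / Num.sqrt t * rho <= pr P (stay W rho m.+1 `&` [set om | b <= S om]).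
Proof.
move=> rho0 tb bt.
apply: le_trans (pr_stay_ge (gw_measurable gW) (gw_indep gW) W_sym b rho0).
have bb : b <= b + 2 * rho by lra.
rewrite pr_walk_itv; apply: le_trans (gauss_itv_lb_half t0 bb tb bt).
by rewrite ler_wpM2l ?(ltW kst0)//; lra.
Qed.

Let mstay rho : measurable (stay W rho m.+1).
Proof. exact: (measurable_stay (gw_measurable gW)). Qed.

Let mge b : measurable [set om | b <= S om].
Proof. exact: measurable_set_ler. Qed.

Lemma pr_stay_lb rho : 0 <= rho -> rho <= Num.sqrt t ->
  @kap R / Num.sqrt t * rho <= pr P (stay W rho m.+1).
Proof.
move=> rho0 rt.
have rt1 : - Num.sqrt t <= - rho by lra.
have rt2 : - rho + 2 * rho <= Num.sqrt t by lra.
apply: le_trans (pr_stay_ge_gauss rho0 rt1 rt2) _.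
by apply: pr_le => //; exact: measurableI.
Qed.

Lemma pr_stay_ub rho o : 0 <= rho -> 0 < o ->
  pr P (stay W rho m.+1) <=
  @kap R / Num.sqrt t * (2 * rho + 2 * o) + pr P (jump m W o).
Proof.
move=> rho0 o0.
have -> : stay W rho m.+1 = stay W rho m.+1 `&` [set om | - rho <= S om].
  by apply/seteqP; split => om //=; [move=> st; split => //; exact: (st m (ltnSn m))|case].
apply: le_trans (pr_stay_le (gw_measurable gW) (gw_indep gW) W_sym rho0 o0 (lexx _)) _.
rewrite lerD2r pr_walk_itv.
have rr : - rho <= - rho + 2 * rho + 2 * o by lra.
apply: le_trans (gauss_itv_ub t0 rr) _.
by rewrite ler_wpM2l ?(ltW kst0)//; lra.
Qed.

(** Staying has probability at least [kap rho / sqrt t]. Ending beyond [4 sqrt t] while staying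
    takes away at most [4 exp(-8) + 1/18] of that, by [pr_stay_le] with overshoot [rho]; with
    [exp(-8) <= 1/9] this is [4/9 + 1/18 = 1/2], which is where [18] comes from. *)
Lemma pr_stay_lt_lb rho : 0 < rho -> rho <= Num.sqrt t ->
  pr P (jump m W rho) <= @kap R / Num.sqrt t * (rho / 18) ->
  @kap R / Num.sqrt t * (rho / 2) <=
  pr P (stay W rho m.+1 `&` [set om | S om < 4 * Num.sqrt t]).
Proof.
move=> rho0 rt J.
have H1 := pr_stay_lb (ltW rho0) rt.
have H2 := pr_setID P (mstay rho) (mge (4 * Num.sqrt t)).
have b0 : - rho <= 4 * Num.sqrt t by lra.
have := pr_stay_le (gw_measurable gW) (gw_indep gW) W_sym (ltW rho0) rho0 b0.
rewrite pr_walk_itv.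
set b := 4 * Num.sqrt t => H3.
have := @gauss_itv_ub_center R t b (b + 2 * rho + 2 * rho) b t0.
move=> /(_ ltac:(lra) ltac:(rewrite /b; lra) (lexx _)) H4.
have He : expR (- (b ^+ 2 / (2 * t))) <= 9^-1.
  rewrite /b exprMn sqr_sqrtr ?(ltW t0)//.
  have -> : 4 ^+ 2 * t / (2 * t) = 8 :> R.
    by move: t0; move: t => x x0; field; rewrite gt_eqF.
  rewrite expRN lef_pV2 ?posrE ?expR_gt0//.
  by apply: le_trans (expR_ge1Dx _); lra.
have H5 : @kap R / Num.sqrt t * (b + 2 * rho + 2 * rho - b) * expR (- (b ^+ 2 / (2 * t)))
    <= @kap R / Num.sqrt t * (4 * rho) * 9^-1.
  have h1 : 0 <= @kap R / Num.sqrt t * (b + 2 * rho + 2 * rho - b).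
    by apply: mulr_ge0; [exact: ltW|lra].
  apply: ler_pM => //.
  by rewrite ler_wpM2l ?(ltW kst0)//; lra.
have -> : [set om | S om < b] = ~` [set om | b <= S om].
  by apply/seteqP; split => om /=; rewrite ltNge => /negP.
nra.
Qed.

End gaussian_walk.

Section subwalks.
Context (R : realType) d (Om : measurableType d) (P : probability Om R).
Variables (N : nat) (S : nat -> Om -> R) (v : R).
Hypotheses (gS : gaussian_walk P N S v) (v0 : 0 < v).

(** The increments of [W] are distinct increments of [S], transformed by [g] (the identity or a sign
    change). Full independence is applied to sets [A'] that are [setT] at the indices missed by
    [pi], whose factors are [1]. *)
Let indep_reindex (m : nat) (pi : nat -> nat) (g : R -> R) (W : nat -> Om -> R) :
  measurable_fun setT g ->
  (forall i, (i < m)%N -> (pi i < N)%N) ->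
  (forall i j, (i < j < m)%N -> pi i != pi j) ->
  (forall i om, (i < m)%N -> W i.+1 om - W i om = g (S (pi i).+1 om - S (pi i) om)) ->
  forall A : nat -> set R, (forall i, measurable (A i)) ->
    (P (\bigcap_(i in `I_m) [set om | A i (W i.+1 om - W i om)%R]) =
     \prod_(i < m) P [set om | A i (W i.+1 om - W i om)%R])%E.
Proof.
move=> mg piN piinj WE A mA.
pose s := map pi (iota 0 m).
have us : uniq s.
  rewrite map_inj_in_uniq ?iota_uniq// => i j; rewrite !mem_iota !add0n /= => im jm e.
  case: (ltngtP i j) => // ij.
  - by have := piinj i j; rewrite ij jm e eqxx => /(_ isT).
  - by have := piinj j i; rewrite ij im e eqxx => /(_ isT).
pose A' j := if j \in s then g @^-1` (A (index j s)) else setT.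
have mA' j : measurable (A' j).
  rewrite /A'; case: ifP => // _.
  by rewrite -[X in measurable X]setTI; exact: mg.
have idx i : (i < m)%N -> index (pi i) s = i.
  move=> im; have -> : pi i = nth 0%N s i.
    by rewrite (nth_map 0%N) ?size_iota// nth_iota.
  by rewrite index_uniq// size_map size_iota.
have pis i : (i < m)%N -> pi i \in s.
  by move=> im; apply: map_f; rewrite mem_iota add0n.
have A'pi i om : (i < m)%N ->
    A' (pi i) (S (pi i).+1 om - S (pi i) om) = A i (W i.+1 om - W i om).
  by move=> im; rewrite /A' pis// idx// WE.
have := gw_indep gS mA'.
have -> : \bigcap_(i in `I_N) [set om | A' i (S i.+1 om - S i om)] =
    \bigcap_(i in `I_m) [set om | A i (W i.+1 om - W i om)].
  apply/seteqP; split => om /= H i /= im.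
    by rewrite -A'pi//; apply: H; exact: piN.
  rewrite /A'; case: ifPn => // /mapP[j]; rewrite mem_iota add0n /= => jm ->.
  by rewrite idx// /preimage/= -WE//; exact: H.
move=> ->.
rewrite -(big_mkord xpredT (fun i => P [set om | A' i (S i.+1 om - S i om)])).
rewrite (bigID (mem s))/= [X in (_ * X)%E]big1 ?mule1; last first.
  move=> j js; rewrite /A' (negbTE js).
  by rewrite (_ : [set _ | _] = setT) ?probability_setT//; apply/seteqP; split.
rewrite -big_filter (perm_big s)/=; last first.
  apply: uniq_perm => //; first by rewrite filter_uniq// iota_uniq.
  move=> j; rewrite mem_filter mem_index_iota /=.
  apply/andP/idP => [[]//|js]; split => //.
  by move: js => /mapP[i]; rewrite mem_iota add0n => /andP[_ im] ->; exact: piN.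
rewrite big_map.
have -> : iota 0 m = index_iota 0 m by rewrite /index_iota subn0.
rewrite big_mkord; apply: eq_bigr => i _.
by congr (P _); apply/seteqP; split => om /=; rewrite A'pi.
Qed.

Lemma gaussian_walk_forward k m : (k + m <= N)%N ->
  gaussian_walk P m (fun i => S (k + i)%N) v.
Proof.
move=> kmN; split.
- by move=> i im; rewrite addnS; apply: (gw_measurable gS); lia.
- apply: (@indep_reindex m (fun i => (k + i)%N) id) => //.
  + by move=> i im; lia.
  + by move=> i j ij; apply/eqP; lia.
  + by move=> i om _; rewrite addnS.
- move=> i j A ijm mA.
  have kij : (k + i < k + j <= N)%N by lia.
  by rewrite (gw_law gS kij mA) subnDl.
Qed.

(** Time reversal lists the increments in reverse order with opposite sign, and centred Gaussian
    laws are symmetric. *)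
Lemma gaussian_walk_backward k m : (m <= k <= N)%N ->
  gaussian_walk P m (fun i => S (k - i)%N) v.
Proof.
move=> mkN.
have E i om : (i < m)%N -> S (k - i.+1)%N om - S (k - i)%N om =
    - (S (k - i.+1).+1%N om - S (k - i.+1)%N om).
  by move=> im; rewrite (_ : (k - i.+1).+1 = (k - i)%N) ?opprB//; lia.
split.
- move=> i im.
  rewrite (_ : (fun _ => _) = (fun om => - (S (k - i.+1).+1%N om - S (k - i.+1)%N om))).
    by apply: measurableT_comp => //; apply: (gw_measurable gS); lia.
  by apply/funext => om; rewrite E.
- apply: (@indep_reindex m (fun i => (k - i.+1)%N) -%R (fun i => S (k - i)%N)) => //.
  + by move=> i im; lia.
  + by move=> i j ij; apply/eqP; lia.
- move=> i j A ijm mA.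
  have mNA : measurable ((-%R : R -> R) @^-1` A).
    by rewrite -[X in measurable X]setTI; exact: oppr_measurable.
  have ij0 : 0 < (j - i)%:R * v by rewrite mulr_gt0// ltr0n; lia.
  rewrite gauss_sym// (_ : (j - i)%N = ((k - i) - (k - j))%N); last by lia.
  have kij : (k - j < k - i <= N)%N by lia.
  rewrite -(gw_law gS kij mNA).
  by congr (pr P _); apply/seteqP; split => om /=; rewrite opprB.
Qed.

End subwalks.

Section brownian_walk.
Context (R : realType) d (Om : measurableType d) (P : probability Om R).
Variables (B : Om -> cpath R) (hB : brownian_motion P B).

Lemma brownian_walk N a v : 0 <= a -> 0 < v ->
  gaussian_walk P N (fun i om => B om (a + i%:R * v)) v.
Proof.
move=> a0 v0.
have t0 i : 0 <= a + i%:R * v by rewrite addr_ge0// mulr_ge0// ltW.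
split.
- by move=> i _; apply: measurable_funB; exact: (bm_measurable hB).
- move=> A mA; apply: (bm_indep hB) => //.
  by move=> i j ij; rewrite lerD2l ler_pM2r// ler_nat.
- move=> i j A /andP[ij _] mA.
  have tij : a + i%:R * v < a + j%:R * v by rewrite ltrD2l ltr_pM2r// ltr_nat.
  have tE : a + j%:R * v - (a + i%:R * v) = (j - i)%:R * v.
    by rewrite natrB ?(ltnW ij)//; ring.
  by rewrite /pr (bm_normal hB (t0 i) tij mA) /gauss tE.
Qed.

End brownian_walk.

(** * First hits and near-hits *)

Section first_hit.
Context (R : realType) d (Om : measurableType d) (P : probability Om R).

Definition first_hit (H : nat -> set Om) (j : nat) : set Om :=
  H j `&` \bigcap_(i in `I_j) ~` H i.

(* If a hit at [j] forces an expected number at least [L] of later near-hits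
   [G k], then the probability of a hit is at most [E(number of near-hits) / L]. *)
Lemma first_hit_le (J K : nat) (H G : nat -> set Om) (L : R) :
  (forall j, (j < J)%N -> measurable (H j)) ->
  (forall k, (k < K)%N -> measurable (G k)) ->
  (forall j, (j < J)%N ->
    L * pr P (first_hit H j) <= \sum_(k < K) pr P (first_hit H j `&` G k)) ->
  L * pr P (\bigcup_(j in `I_J) H j) <= \sum_(k < K) pr P (G k).
Proof.
move=> mH mG HL.
have mF j : (j < J)%N -> measurable (first_hit H j).
  move=> jJ; apply: measurableI; first exact: mH.
  by apply: bigcap_measurableType => i /= ij; apply: measurableC; apply: mH; lia.
have disj i j : (i < j)%N -> first_hit H i `&` first_hit H j = set0.
  move=> ij; apply/seteqP; split => // om [[Hi _] [_ /(_ i ij)]].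
  exact.
have -> : \bigcup_(j in `I_J) H j = \bigcup_(j in `I_J) first_hit H j.
  apply/seteqP; split => [om [j /= jJ Hj]|om [j /= jJ [Hj _]]]; last by exists j.
  have ex : exists j, `[< H j om >] by exists j; exact/asboolP.
  exists (ex_minn ex); case: ex_minnP => i /asboolP Hi mini.
    by have := mini j; move/asboolP in Hj => /(_ Hj) /=; lia.
  split => // l /= li Hl; have := mini l; move/asboolP in Hl => /(_ Hl); lia.
rewrite pr_bigcup_disj//; last by move=> i j /andP[ij _]; exact: disj.
rewrite mulr_sumr; apply: (@le_trans _ _
  (\sum_(j < J) \sum_(k < K) pr P (first_hit H j `&` G k))).
  by apply: ler_sum => -[j jJ] _; exact: HL.
rewrite exchange_big/=; apply: ler_sum => -[k kK] _ /=.
apply: (@pr_sum_disj_le _ _ _ P J (fun j => first_hit H j `&` G k)).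
- by move=> j jJ; apply: measurableI; [exact: mF|exact: mG].
- exact: mG.
- by move=> j jJ om [].
- by move=> i j /andP[ij _]; rewrite setIACA disj// set0I.
Qed.

End first_hit.

Section harmonic_sum.
Context (R : realType).

(** Each of the [K] blocks from [a] to [2 a] contributes at least [a / (2 a) = 1/2]. *)
Lemma harmonic_dyadic_lb (m0 K : nat) : (0 < m0)%N ->
  K%:R / 2 <= \sum_(m0 <= m < m0 * 2 ^ K) (m%:R^-1 : R).
Proof.
move=> m00; elim: K => [|K IH]; first by rewrite expn0 muln1 big_geq// mul0r.
rewrite (@big_cat_nat _ _ _ (m0 * 2 ^ K))/=; [|by rewrite leq_pmulr ?expn_gt0|
  by rewrite leq_mul2l leq_exp2l// leqnSn orbT].
rewrite -natr1 mulrDl; apply: lerD => //.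
set a := (m0 * 2 ^ K)%N; have a0 : (0 < a)%N by rewrite muln_gt0 m00 expn_gt0.
rewrite expnS mulnCA -/a.
apply: (@le_trans _ _ (\sum_(a <= m < 2 * a) ((2 * a)%:R^-1 : R))).
  rewrite sumr_const_nat (_ : (2 * a - a)%N = a); last by lia.
  rewrite -[X in _ <= X]mulr_natr natrM invfM -mulrA mulVf ?pnatr_eq0 -?lt0n//.
  by rewrite mulr1 mul1r.
apply: ler_sum_nat => m /andP[am ma].
by rewrite lef_pV2 ?posrE ?ltr0n ?ler_nat; lia.
Qed.

Lemma sum_shift_le (a : nat -> R) (j m0 q L : nat) : (forall k, 0 <= a k) ->
  (j + q <= L)%N -> \sum_(m0 <= m < q) a (j + m)%N <= \sum_(k < L) a k.
Proof.
move=> a0 jqL.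
have sum0 s t : 0 <= \sum_(s <= k < t) a k by apply: sumr_ge0.
have [qm|mq] := leqP q m0; first by rewrite big_geq// -(big_mkord xpredT) sum0.
rewrite -(big_mkord xpredT a).
rewrite (_ : \sum_(m0 <= m < q) _ = \sum_(m0 + j <= k < q + j) a k).
  rewrite (@big_cat_nat _ _ _ (m0 + j) 0%N L)/=; [|nlia|nlia].
  rewrite (@big_cat_nat _ _ _ (q + j) (m0 + j)%N L)/=; [|nlia|nlia].
  by rewrite -[leLHS]add0r; apply: lerD; rewrite ?lerDl.
by rewrite big_addn addnK; apply: eq_bigr => m _; rewrite addnC.
Qed.

End harmonic_sum.

Section near_extrema_sets.
Context (R : realType) d (Om : measurableType d).
Variables (N : nat) (S : nat -> Om -> R).
Local Notation xi := (fun i om => S i.+1 om - S i om).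

Definition near_past_min (r : R) (i k : nat) : set Om :=
  [set om | forall l, (i <= l <= k)%N -> S k om <= S l om + r].

Definition near_future_min (r : R) (k j : nat) : set Om :=
  [set om | forall l, (k <= l <= j)%N -> S k om <= S l om + r].

(** Read backwards from [k], a near-minimum of the past is a walk staying above [- r]; this brings
    in the reflection bounds. *)
Lemma near_past_min_stay r i k : (i <= k)%N ->
  near_past_min r i k = stay (fun l => S (k - l)%N) r (k - i).+1.
Proof.
move=> ik; apply/seteqP; split => om /= H l /= Hl.
  by have := H (k - l)%N ltac:(lia); rewrite subn0; lra.
have := H (k - l)%N; rewrite /= subn0 subKn; last by lia.
by move=> /(_ ltac:(lia)); lra.
Qed.

Lemma near_future_min_stay r k j : (k <= j)%N ->
  near_future_min r k j = stay (fun l => S (k + l)%N) r (j - k).+1.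
Proof.
move=> ik; apply/seteqP; split => om /= H l /= Hl.
  by have := H (k + l)%N ltac:(lia); rewrite addn0; lra.
have := H (l - k)%N; rewrite /= addn0 subnKC; last by lia.
by move=> /(_ ltac:(lia)); lra.
Qed.

Lemma past_near_past_min r i k (I : pred nat) : (k <= N)%N ->
  (forall l, (i <= l < k)%N -> I l) -> past N xi I (near_past_min r i k).
Proof.
move=> kN II.
have -> : near_past_min r i k = \bigcap_(l in [set l | (i <= l <= k)%N])
    [set om | S k om - S l om <= r].
  by apply/seteqP; split => om /= H l /= /H; rewrite /=; lra.
apply: past_bigcap => l /= ilk; apply: past_le; last exact: past_fun_cst.
by apply: past_fun_increment => [|j jl]; [|apply: II]; lia.
Qed.

Lemma past_near_future_min r k j (I : pred nat) : (j <= N)%N ->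
  (forall l, (k <= l < j)%N -> I l) -> past N xi I (near_future_min r k j).
Proof.
move=> kN II.
have -> : near_future_min r k j = \bigcap_(l in [set l | (k <= l <= j)%N])
    [set om | - r <= S l om - S k om].
  by apply/seteqP; split => om /= H l /= /H; rewrite /=; lra.
apply: past_bigcap => l /= ilk; apply: past_le; first exact: past_fun_cst.
by apply: past_fun_increment => [|i il]; [|apply: II]; lia.
Qed.

End near_extrema_sets.

Section near_extrema.
Context (R : realType) d (Om : measurableType d) (P : probability Om R).
Variables (N : nat) (S : nat -> Om -> R) (v : R).
Hypotheses (gS : gaussian_walk P N S v) (v0 : 0 < v).
Local Notation xi := (fun i om => S i.+1 om - S i om).
Local Notation mxi := (gw_measurable gS).

Lemma measurable_near_past_min r i k : (k <= N)%N -> measurable (near_past_min S r i k).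
Proof.
move=> kN; apply: (@past_measurable _ _ _ N xi mxi predT).
exact: past_near_past_min.
Qed.

Lemma measurable_near_future_min r k j : (j <= N)%N -> measurable (near_future_min S r k j).
Proof.
move=> kN; apply: (@past_measurable _ _ _ N xi mxi predT).
exact: past_near_future_min.
Qed.

Let jumpS (W : nat -> Om -> R) m o :
  (forall i om, (i < m)%N -> exists2 l, (l < N)%N &
    `|W i.+1 om - W i om| = `|S l.+1 om - S l om|) ->
  measurable (jump m W o) -> pr P (jump m W o) <= pr P (jump N S o).
Proof.
move=> WS mW; apply: pr_le => //; first exact: (measurable_jump mxi).
by move=> om [i /= im]; have [l lN ->] := WS i om im; exists l.
Qed.

Lemma pr_jump_backward k m o : (m <= k <= N)%N ->
  pr P (jump m (fun l => S (k - l)%N) o) <= pr P (jump N S o).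
Proof.
move=> mkN; apply: jumpS; last first.
  exact: (measurable_jump (gw_measurable (gaussian_walk_backward gS v0 mkN))).
move=> i om im; exists (k - i.+1)%N; first by lia.
by rewrite distrC (_ : (k - i.+1).+1 = (k - i)%N)//; lia.
Qed.

Lemma pr_jump_forward k m o : (k + m <= N)%N ->
  pr P (jump m (fun l => S (k + l)%N) o) <= pr P (jump N S o).
Proof.
move=> kmN; apply: jumpS; last first.
  have gF := gaussian_walk_forward gS v0 kmN.
  exact: (@measurable_jump _ _ _ m (fun l => S (k + l)%N) (gw_measurable gF)).
by move=> i om im; exists (k + i)%N; [lia|rewrite addnS].
Qed.

Lemma pr_near_past_min_lb r i k : (i < k <= N)%N -> 0 <= r ->
  r <= Num.sqrt ((k - i)%:R * v) ->
  kap R / Num.sqrt ((k - i)%:R * v) * r <= pr P (near_past_min S r i k).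
Proof.
move=> ik r0 rt; rewrite near_past_min_stay; last by lia.
have kN : ((k - i)%N <= k <= N)%N by lia.
by apply: (pr_stay_lb (gaussian_walk_backward gS v0 kN)) => //; lia.
Qed.

Lemma pr_near_past_min_ub r o i k : (i < k <= N)%N -> 0 <= r -> 0 < o ->
  pr P (near_past_min S r i k) <=
  kap R / Num.sqrt ((k - i)%:R * v) * (2 * r + 2 * o) + pr P (jump N S o).
Proof.
move=> ik r0 o0; rewrite near_past_min_stay; last by lia.
have kN : ((k - i)%N <= k <= N)%N by lia.
have ik0 : (0 < k - i)%N by lia.
apply: le_trans (pr_stay_ub (gaussian_walk_backward gS v0 kN) ik0 v0 r0 o0) _.
by rewrite lerD2l; exact: pr_jump_backward.
Qed.

Lemma pr_near_past_min_lt_lb r i k : (i < k <= N)%N -> 0 < r ->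
  r <= Num.sqrt ((k - i)%:R * v) ->
  pr P (jump N S r) <= kap R / Num.sqrt ((k - i)%:R * v) * (r / 18) ->
  kap R / Num.sqrt ((k - i)%:R * v) * (r / 2) <=
  pr P (near_past_min S r i k `&`
        [set om | S i om - S k om < 4 * Num.sqrt ((k - i)%:R * v)]).
Proof.
move=> ik r0 rt J; rewrite near_past_min_stay; last by lia.
have kN : ((k - i)%N <= k <= N)%N by lia.
have ik0 : (0 < k - i)%N by lia.
have := pr_stay_lt_lb (gaussian_walk_backward gS v0 kN) ik0 v0 r0 rt.
rewrite subn0 subKn; last by lia.
by apply; apply: le_trans J; exact: pr_jump_backward.
Qed.

Lemma pr_near_future_min_lb r k j : (k < j <= N)%N -> 0 <= r ->
  r <= Num.sqrt ((j - k)%:R * v) ->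
  kap R / Num.sqrt ((j - k)%:R * v) * r <= pr P (near_future_min S r k j).
Proof.
move=> ik r0 rt; rewrite near_future_min_stay; last by lia.
have kN : (k + (j - k) <= N)%N by lia.
by apply: (pr_stay_lb (gaussian_walk_forward gS v0 kN)) => //; lia.
Qed.

Lemma pr_near_future_min_ub r o k j : (k < j <= N)%N -> 0 <= r -> 0 < o ->
  pr P (near_future_min S r k j) <=
  kap R / Num.sqrt ((j - k)%:R * v) * (2 * r + 2 * o) + pr P (jump N S o).
Proof.
move=> ik r0 o0; rewrite near_future_min_stay; last by lia.
have kN : (k + (j - k) <= N)%N by lia.
have ik0 : (0 < j - k)%N by lia.
apply: le_trans (pr_stay_ub (gaussian_walk_forward gS v0 kN) ik0 v0 r0 o0) _.
by rewrite lerD2l; exact: pr_jump_forward.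
Qed.

Lemma pr_near_future_min_ge_lb r b k j : (k < j <= N)%N -> 0 <= r -> 0 <= b ->
  b + 2 * r <= Num.sqrt ((j - k)%:R * v) ->
  kap R / Num.sqrt ((j - k)%:R * v) * r <=
  pr P (near_future_min S r k j `&` [set om | b <= S j om - S k om]).
Proof.
move=> ik r0 b0 rt; rewrite near_future_min_stay; last by lia.
have kN : (k + (j - k) <= N)%N by lia.
have ik0 : (0 < j - k)%N by lia.
have tb : - Num.sqrt ((j - k)%:R * v) <= b.
  by apply: le_trans b0; rewrite oppr_le0 sqrtr_ge0.
have := pr_stay_ge_gauss (gaussian_walk_forward gS v0 kN) ik0 v0 r0 tb rt.
by rewrite addn0 subnKC//; lia.
Qed.

Lemma pr_increment_itv i k a b : (i < k <= N)%N ->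
  pr P [set om | a <= S k om - S i om <= b] =
  gauss ((k - i)%:R * v) `[a, b]%classic.
Proof.
move=> ik; have := @gw_law _ _ _ _ _ _ _ gS i k `[a, b]%classic ik.
by move=> <-.
Qed.

End near_extrema.

(** * Grid estimate for an increment close to [lambda] that ends at a near-minimum *)

Section bridge_minimum.
Context (R : realType) d (Om : measurableType d) (P : probability Om R).
Variables (m0 K q n : nat).
Hypotheses (nE : n = (8 * q)%N) (q0 : (0 < q)%N).
Hypothesis harmonic_lb : K%:R / 2 <= \sum_(m0 <= m < q) (m%:R^-1 : R).
Local Notation N := (n + 2 * q)%N.
Local Notation v := (n%:R^-1 : R).
Variables (S : nat -> Om -> R) (r : R).
Hypotheses (gS : gaussian_walk P N S v) (m00 : (0 < m0)%N) (r0 : 0 < r).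
Hypothesis r_small : 3 * r <= Num.sqrt (m0%:R * v).
Hypothesis jump_small : pr P (jump N S r) <= kap R * (r / 18).
Local Notation xi := (fun i om => S i.+1 om - S i om).
Local Notation mxi := (gw_measurable gS).

Let n0 : 0 < n%:R :> R. Proof. by rewrite ltr0n nE muln_gt0. Qed.
Let v0 : 0 < v. Proof. by rewrite invr_gt0. Qed.
Let kap0 : 0 < kap R. Proof. exact: kap_gt0. Qed.

Let sqrt_gt0 m : (0 < m)%N -> 0 < Num.sqrt (m%:R * v).
Proof. by move=> m_gt0; rewrite sqrtr_gt0 mulr_gt0// ltr0n. Qed.

Let sqrt_le1 m : (m <= n)%N -> Num.sqrt (m%:R * v) <= 1.
Proof.
move=> mn; rewrite -[leRHS]sqrtr1 ler_wsqrtr//.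
by rewrite ler_pdivrMr// mul1r ler_nat.
Qed.

Let sqrt_ge m : (m0 <= m)%N -> 3 * r <= Num.sqrt (m%:R * v).
Proof.
move=> m0m; apply: le_trans r_small _; rewrite ler_wsqrtr//.
by rewrite ler_pM2r// ler_nat.
Qed.

Let past_inc (I : pred nat) a b : (a <= b <= N)%N ->
  (forall i, (a <= i < b)%N -> I i) ->
  past_fun N xi I (fun om => S b om - S a om).
Proof. exact: past_fun_increment. Qed.

Let minc a b : (a <= b <= N)%N -> measurable_fun setT (fun om => S b om - S a om).
Proof.
move=> ab; apply: (@past_fun_measurable _ _ _ N xi mxi predT).
exact: past_inc.
Qed.

(* The cut-off constant comes from evaluating the Gaussian density at [5 sqrt t]. *)
Let c : R := kap R ^+ 2 * expR (- (25 / 2)).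

Let c_gt0 : 0 < c. Proof. by rewrite mulr_gt0 ?expR_gt0// exprn_gt0. Qed.

(** The second condition says that the gap changes by at most [r] between [j] and [k]. Only the
    increments over [[j, k)] and [[n+j, n+k)] enter, none of which a first hit at [j] involves. *)
Let revisit j k : set Om := near_past_min S r (n + j) (n + k) `&`
  [set om | `|(S k om - S j om) - (S (n + k)%N om - S (n + j)%N om)| <= r].

Let past_revisit j k (I : pred nat) : (j <= k <= 2 * q)%N ->
  (forall i, (j <= i < k)%N || (n + j <= i < n + k)%N -> I i) ->
  past N xi I (revisit j k).
Proof.
move=> jk II; apply: pastI.
  by apply: past_near_past_min => [|i ij]; [|apply: II]; nlia.
apply: past_le; last exact: past_fun_cst.
apply: (past_fun_comp (g := fun x => `|x|)); first exact: normr_measurable.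
by apply: past_funB; apply: past_inc => [|i ij]; [|apply: II| |apply: II]; nlia.
Qed.

(** Two independent requirements each cost a factor of order [r / s]: the near-minimum, by
    reflection, and the increment [D] falling within [r] of [Z]. The cut-off at [4 s] and [3 r <= s]
    keep the target interval of [D] inside [[- 5 s, 5 s]]. *)
Let pr_revisit j m : (j <= q)%N -> (m0 <= m < q)%N ->
  c * (r ^+ 2 / (m%:R * v)) <= pr P (revisit j (j + m)).
Proof.
move=> jq mq; set k := (j + m)%N.
set s := Num.sqrt (m%:R * v).
have m_gt0 : (0 < m)%N by nlia.
have mv0 : 0 < m%:R * v by rewrite mulr_gt0// ltr0n.
have s0 : 0 < s by exact: sqrt_gt0.
have s1 : s <= 1 by apply: sqrt_le1; nlia.
have rs : 3 * r <= s by apply: sqrt_ge; nlia.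
have s2 : s ^+ 2 = m%:R * v by rewrite sqr_sqrtr// ltW.
have km : ((n + k) - (n + j) = m)%N by rewrite /k; nlia.
have jk : (n + j < n + k <= N)%N by rewrite /k; nlia.
pose E := near_past_min S r (n + j) (n + k) `&`
  [set om | S (n + j)%N om - S (n + k)%N om < 4 * s].
pose Z om := S (n + k)%N om - S (n + j)%N om.
pose D om := S k om - S j om.
have EP : kap R / s * (r / 2) <= pr P E.
  have := pr_near_past_min_lt_lb gS v0 jk r0; rewrite km -/s; apply; first by lra.
  apply: le_trans jump_small _; rewrite ler_pM2r ?divr_gt0//.
  by rewrite ler_pdivlMr// ler_piMr// ltW.
pose I : pred nat := fun i => (n + j <= i < n + k)%N.
pose J : pred nat := fun i => (j <= i < k)%N.
have pZ : past_fun N xi I Z.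
  by apply: (@past_inc I (n + j) (n + k)) => [|i]; rewrite /I; nlia.
have pD : past_fun N xi J D.
  by apply: (@past_inc J j k) => [|i]; rewrite /J /k; nlia.
have pE : past N xi I E.
  apply: pastI; first by apply: past_near_past_min => [|i]; rewrite /I; nlia.
  apply: past_lt; last exact: past_fun_cst.
  rewrite (_ : (fun _ => _) = (fun om => - Z om)).
    by apply: (past_fun_comp (g := -%R)) => //; exact: oppr_measurable.
  by apply/funext => om; rewrite /Z opprB.
have mE := past_measurable mxi pE.
have ind A B : measurable A -> measurable B ->
    pr P ((E `&` Z @^-1` A) `&` D @^-1` B) =
    pr P (E `&` Z @^-1` A) * pr P (D @^-1` B).
  move=> mA mB; apply: (past_indep mxi (gw_indep gS) (I := I) (J := J)).
  - by move=> i; rewrite /I /J /k; nlia.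
  - by apply: pastI => //; exact: past_preimage.
  - exact: past_preimage.
pose M := [set x : R * R | `|x.2 - x.1| <= r].
have mM : measurable M.
  apply: measurable_set_ler => //; apply: measurableT_comp => //.
  by apply: measurable_funB; [exact: measurable_snd|exact: measurable_fst].
pose e := kap R / s * (2 * r) * expR (- (25 / 2)).
have e0 : 0 <= e.
  apply: mulr_ge0; last exact: expR_ge0.
  apply: mulr_ge0; first by apply: divr_ge0; exact: ltW.
  by move: (ltW r0) => ?; lra.
have EV : E `<=` Z @^-1` `[- (4 * s), r]%classic.
  move=> om [/= /(_ (n + j)%N) H1 H2]; rewrite in_itv/= /Z.
  have := H1 ltac:(nlia); lra.
have Mlb (z : R) : `[- (4 * s), r]%classic z -> e <= pr P [set om | M (z, D om)].
  rewrite /= in_itv/= => /andP[z1 z2].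
  have -> : [set om | M (z, D om)] = [set om | z - r <= S k om - S j om <= z + r].
    by apply/seteqP; split => om; rewrite /M/= ler_distl.
  rewrite (pr_increment_itv gS); last by rewrite /k; nlia.
  rewrite (_ : (k - j)%N = m); last by rewrite /k; nlia.
  have [r0' rs' s0'] : [/\ 0 < r, 3 * r <= s & 0 < s] by [].
  have zz : z - r <= z + r by lra.
  have z3 : - (5 * s) <= z - r by lra.
  have z4 : z + r <= 5 * s by lra.
  apply: le_trans (gauss_itv_lb mv0 zz z3 z4).
  rewrite -/s exprMn s2 (_ : 5 ^+ 2 * _ / _ = 25 / 2).
    by rewrite (_ : z + r - (z - r) = 2 * r)//; lra.
  by move: mv0; move: (m%:R * v) => x x0; field; rewrite gt_eqF.
have := independent_pair_lb mE (past_fun_measurable mxi pZ)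
  (past_fun_measurable mxi pD) ind mM (measurable_itv _) e0 EV Mlb.
move=> H; apply: (@le_trans _ _ (e * pr P E)); last first.
  apply: le_trans H _; apply: pr_le.
  - apply: measurableI => //.
    rewrite -[X in measurable X]setTI.
    apply: (measurable_fun_pair (past_fun_measurable mxi pZ) (past_fun_measurable mxi pD)) => //.
  - by apply: (past_measurable mxi (I := predT)); apply: past_revisit => //; rewrite /k; nlia.
  - by move=> om [[near_om _] MZD].
apply: (@le_trans _ _ (e * (kap R / s * (r / 2)))); last by rewrite ler_wpM2l.
rewrite -s2 /e /c le_eqVlt; apply/orP; left; apply/eqP.
by move: (gt_eqF s0) => sn0; field; rewrite sn0.
Qed.

Variables (lambda A : R).

(** For [g = S_{n-q} - S_0] this is [S_{n+k} - S_k - lambda]. With [g] a constant, the increments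
    over [[q, n-q)] disappear from it. *)
Let gap g k om := g + (S (n + k)%N om - S (n - q)%N om) - (S k om - S 0%N om) - lambda.

Let hit g j : set Om := near_past_min S r (n - q) (n + j) `&`
  [set om | `|gap g j om| <= 2 * r].

(** A revisit adds [r] to both tolerances of [hit]. The [2 r] in [hit] itself is [r] for the
    discretization and [r] for rounding the starting gap to a level [g]. *)
Let near_hit g k : set Om := near_past_min S (2 * r) (n - q) (n + k) `&`
  [set om | `|gap g k om| <= 3 * r].

Let past_gap (I : pred nat) g k : (k <= 2 * q)%N ->
  (forall i, (i < k)%N || (n - q <= i < n + k)%N -> I i) ->
  past_fun N xi I (gap g k).
Proof.
move=> kq II; apply: past_funB; last exact: past_fun_cst.
apply: past_funB; last by apply: past_inc => [|i ij]; [|apply: II]; nlia.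
apply: past_funD; first exact: past_fun_cst.
by apply: past_inc => [|i ij]; [|apply: II]; nlia.
Qed.

Let past_hit (I : pred nat) g k : (k <= 2 * q)%N ->
  (forall i, (i < k)%N || (n - q <= i < n + k)%N -> I i) ->
  past N xi I (hit g k).
Proof.
move=> kq II; apply: pastI.
  by apply: past_near_past_min => [|i ij]; [|apply: II]; nlia.
apply: past_le; last exact: past_fun_cst.
apply: (past_fun_comp (g := fun x => `|x|)); first exact: normr_measurable.
exact: past_gap.
Qed.

Let measurable_near_hit g k : (k <= 2 * q)%N -> measurable (near_hit g k).
Proof.
move=> kq; apply: measurableI.
  by apply: (measurable_near_past_min gS); nlia.
apply: measurable_set_ler => //; apply: measurableT_comp => //.
apply: (@past_fun_measurable _ _ _ N xi mxi predT).
exact: past_gap.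
Qed.

Let measurable_hit g k : (k <= 2 * q)%N -> measurable (hit g k).
Proof. by move=> kq; apply: (past_measurable mxi (I := predT)); exact: past_hit. Qed.

Let hit_near_hit g : c * r ^+ 2 * n%:R * (K%:R / 2) *
    pr P (\bigcup_(j in `I_q.+1) hit g j) <=
  \sum_(k < (2 * q)%N) pr P (near_hit g k).
Proof.
apply: first_hit_le => [j jq|k kq|j jq].
- by apply: measurable_hit; nlia.
- by apply: measurable_near_hit; nlia.
set F := first_hit _ _.
pose I : pred nat := fun i => (i < j)%N || (n - q <= i < n + j)%N.
have pF : past N xi I F.
  apply: pastI; first by apply: past_hit => //; nlia.
  apply: past_bigcap => i /= ij; apply: pastC; apply: past_hit; first by nlia.
  by move=> l; rewrite /I; nlia.
have mF := past_measurable mxi pF.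
have H m : (m0 <= m < q)%N -> c * (r ^+ 2 / (m%:R * v)) * pr P F <=
    pr P (F `&` near_hit g (j + m)).
  move=> mq.
  pose J : pred nat := fun i => (j <= i < j + m)%N || (n + j <= i < n + (j + m))%N.
  have pJ : past N xi J (revisit j (j + m)) by apply: past_revisit => //; nlia.
  apply: (@le_trans _ _ (pr P (F `&` revisit j (j + m)))).
    rewrite (past_indep mxi (gw_indep gS) _ pF pJ); last first.
      by move=> i; rewrite /I /J; nlia.
    by rewrite mulrC ler_wpM2l ?pr_ge0// pr_revisit//; nlia.
  apply: pr_le.
  - by apply: measurableI => //; exact: (past_measurable mxi pJ).
  - by apply: measurableI => //; apply: measurable_near_hit; nlia.
  move=> om [Fom [/= nr]]; rewrite ler_norml => /andP[d1 d2]; split => //.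
  have [[/= nj]] := Fom; rewrite ler_norml => /andP[g1 g2] _.
  split => [l /= lq|/=]; last by rewrite ler_norml /gap; move: g1 g2; rewrite /gap; lra.
  have [lj|lj] := leqP l (n + j)%N.
    by have := nj l ltac:(nlia); have := nr (n + j)%N ltac:(nlia); lra.
  by have := nr l ltac:(nlia); lra.
apply: (@le_trans _ _ (\sum_(m0 <= m < q) pr P (F `&` near_hit g (j + m)))).
  have Hs : \sum_(m0 <= m < q) c * (r ^+ 2 / (m%:R * v)) * pr P F <=
      \sum_(m0 <= m < q) pr P (F `&` near_hit g (j + m)).
    by apply: ler_sum_nat => m mq; exact: H.
  apply: le_trans Hs; rewrite -mulr_suml ler_wpM2r ?pr_ge0//.
  have -> : \sum_(m0 <= m < q) c * (r ^+ 2 / (m%:R * v)) =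
      c * r ^+ 2 * n%:R * \sum_(m0 <= m < q) (m%:R^-1 : R).
    rewrite mulr_sumr; apply: eq_bigr => m _.
    by rewrite invfM invrK; ring.
  rewrite ler_wpM2l//.
  by rewrite mulr_ge0 ?ler0n// mulr_ge0 ?sqr_ge0// (ltW c_gt0).
apply: (@sum_shift_le _ (fun k => pr P (F `&` near_hit g k))); last by nlia.
by move=> k; exact: pr_ge0.
Qed.

(** The past window lasts at least [q v = 1/8 > 1/9], so [s >= 1/3] and the bound is [3 * 6 kap r]
    plus the small jump term. *)
Let pr_near_ub k : (k <= 2 * q)%N ->
  pr P (near_past_min S (2 * r) (n - q) (n + k)) <= 20 * (kap R * r).
Proof.
move=> kq.
have ik : (n - q < n + k <= N)%N by nlia.
have r20 : 0 <= 2 * r by have := r0; lra.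
apply: le_trans (pr_near_past_min_ub gS v0 ik r20 r0) _.
set s := Num.sqrt _.
have s_ge : 3^-1 <= s.
  rewrite -[leLHS]ger0_norm// -sqrtr_sqr ler_wsqrtr//.
  apply: (@le_trans _ _ (q%:R * v)).
    rewrite nE natrM invfM mulrCA mulfV ?pnatr_eq0 -?lt0n// mulr1.
    by lra.
  by rewrite ler_pM2r// ler_nat; nlia.
have sp : 0 < s by apply: lt_le_trans s_ge; rewrite invr_gt0.
have h : kap R / s * (2 * (2 * r) + 2 * r) <= kap R * 3 * (2 * (2 * r) + 2 * r).
  rewrite ler_wpM2r//; first by have := r0; lra.
  rewrite ler_wpM2l ?(ltW kap0)// -[leRHS]invrK.
  by rewrite lef_pV2// posrE ?invr_gt0.
have := jump_small; have kr : 0 < kap R * r by rewrite mulr_gt0.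
lra.
Qed.

Let cells (g0 : R) (k : nat) (w : Om -> R) (G : nat) :
  measurable_fun setT w -> (k <= 2 * q)%N ->
  \sum_(i < G) pr P (near_past_min S (2 * r) (n - q) (n + k) `&`
     [set om | g0 + i%:R * r - r / 2 <= w om < g0 + i%:R * r + r / 2]) <=
  pr P (near_past_min S (2 * r) (n - q) (n + k)).
Proof.
move=> mw kq.
have mN : measurable (near_past_min S (2 * r) (n - q) (n + k)).
  by apply: (measurable_near_past_min gS); nlia.
apply: (@pr_sum_disj_le _ _ _ P G (fun i => near_past_min S (2 * r) (n - q) (n + k) `&`
     [set om | g0 + i%:R * r - r / 2 <= w om < g0 + i%:R * r + r / 2])) => //.
- move=> i _; apply: measurableI => //.
  rewrite (_ : [set _ | _] = [set om | g0 + i%:R * r - r / 2 <= w om] `&`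
     [set om | w om < g0 + i%:R * r + r / 2]).
    by apply: measurableI; [exact: measurable_set_ler|exact: measurable_set_ltr].
  by apply/seteqP; split => om /= => [/andP|] [->].
- move=> i j /andP[ij _]; rewrite setIACA setIid.
  apply/seteqP; split => // om [_ [/= /andP[_ h1] /andP[h2 _]]].
  have : i.+1%:R * r <= j%:R * r by rewrite ler_pM2r// ler_nat.
  rewrite -natr1 mulrDl mul1r.
  by move: h1 h2; have := r0; lra.
Qed.

(* Each path is within [3 r] of at most seven of the [g0 + i r]. *)
Let pr_near_hit_sum g0 G k : (k <= 2 * q)%N ->
  \sum_(i < G) pr P (near_hit (g0 + i%:R * r) k) <=
  7 * (20 * (kap R * r)).
Proof.
move=> kq.
pose w om := - gap 0 k om.
have mw : measurable_fun setT w.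
  apply: measurableT_comp => //.
  apply: (@past_fun_measurable _ _ _ N xi mxi predT).
  exact: past_gap.
have mN : measurable (near_past_min S (2 * r) (n - q) (n + k)).
  by apply: (measurable_near_past_min gS); nlia.
pose cell (e i : nat) := near_past_min S (2 * r) (n - q) (n + k) `&`
     [set om | (g0 + (e%:R - 3) * r) + i%:R * r - r / 2 <= w om <
               (g0 + (e%:R - 3) * r) + i%:R * r + r / 2].
have mcell e i : measurable (cell e i).
  apply: measurableI => //.
  rewrite (_ : [set _ | _] = [set om | (g0 + (e%:R - 3) * r) + i%:R * r - r / 2 <= w om] `&`
     [set om | w om < (g0 + (e%:R - 3) * r) + i%:R * r + r / 2]).
    by apply: measurableI; [exact: measurable_set_ler|exact: measurable_set_ltr].
  by apply/seteqP; split => om /= => [/andP|] [->].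
apply: (@le_trans _ _ (\sum_(i < G) \sum_(e < 7) pr P (cell e i))).
  apply: ler_sum => i _; apply: (@le_trans _ _ (pr P (\bigcup_(e in `I_7) cell e i))).
    apply: pr_le; [exact: measurable_near_hit|exact: bigcup_ord_measurable|].
    move=> om [near_om /=]; rewrite /gap ler_norml => /andP[h1 h2].
    have [h3 h4 h5] : [/\ w om <= g0 + i%:R * r + 3 * r,
        g0 + i%:R * r - 3 * r <= w om & 0 < r].
      by split => //; rewrite /w /gap; lra.
    have pick e : (e < 7)%N -> g0 + (e%:R - 3) * r + i%:R * r - r / 2 <= w om ->
       w om < g0 + (e%:R - 3) * r + i%:R * r + r / 2 ->
       (\bigcup_(e in `I_7) cell e i) om.
      by move=> e7 l1 l2; exists e => //; split => //=; rewrite l1 l2.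
    set x := g0 + i%:R * r in h3 h4.
    have E (e : R) : g0 + (e - 3) * r + i%:R * r = x + e * r - 3 * r.
      by rewrite /x; ring.
    have [c1|c1] := ltP (w om) (x - 5 / 2 * r).
      by apply: (pick 0%N) => //; rewrite E; lra.
    have [c2|c2] := ltP (w om) (x - 3 / 2 * r).
      by apply: (pick 1%N) => //; rewrite E; lra.
    have [c3|c3] := ltP (w om) (x - 1 / 2 * r).
      by apply: (pick 2%N) => //; rewrite E; lra.
    have [c4|c4] := ltP (w om) (x + 1 / 2 * r).
      by apply: (pick 3%N) => //; rewrite E; lra.
    have [c5|c5] := ltP (w om) (x + 3 / 2 * r).
      by apply: (pick 4%N) => //; rewrite E; lra.
    have [c6|c6] := ltP (w om) (x + 5 / 2 * r).
      by apply: (pick 5%N) => //; rewrite E; lra.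
    by apply: (pick 6%N) => //; rewrite E; lra.
  exact: pr_bigcup_le.
rewrite exchange_big/=.
apply: (@le_trans _ _ (\sum_(e < 7) 20 * (kap R * r))).
  apply: ler_sum => e _; apply: le_trans (pr_near_ub kq).
  exact: cells.
by rewrite sumr_const card_ord -[leLHS]mulr_natl.
Qed.

(** Summing over the levels before bounding lets [pr_near_hit_sum] absorb them, so [G] does not
    appear on the right. The factor [q] cancels with [n = 8 q]: [2 * 140 / 4 = 70]. *)
Let hits_ub g0 G : c * r * K%:R *
    \sum_(i < G) pr P (\bigcup_(j in `I_q.+1) hit (g0 + i%:R * r) j) <=
  70 * kap R.
Proof.
have : \sum_(i < G) (c * r ^+ 2 * n%:R * (K%:R / 2) *
     pr P (\bigcup_(j in `I_q.+1) hit (g0 + i%:R * r) j)) <=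
    (2 * q)%:R * (7 * (20 * (kap R * r))).
  apply: (@le_trans _ _ (\sum_(i < G) \sum_(k < (2 * q)%N)
    pr P (near_hit (g0 + i%:R * r) k))).
    by apply: ler_sum => i _; exact: hit_near_hit.
  rewrite exchange_big/=.
  apply: (@le_trans _ _ (\sum_(k < (2 * q)%N) 7 * (20 * (kap R * r)))).
    by apply: ler_sum => k _; apply: pr_near_hit_sum; exact: ltnW.
  by rewrite sumr_const card_ord -[leLHS]mulr_natl.
rewrite -mulr_sumr; set X := \sum_(i < G) _.
rewrite nE !natrM => H.
have q_gt0 : 0 < q%:R :> R by rewrite ltr0n.
have {}H : (4 * q%:R * r) * (c * r * K%:R * X) <= (4 * q%:R * r) * (70 * kap R).
  by rewrite [leLHS](_ : _ = c * r ^+ 2 * (8 * q%:R) * (K%:R / 2) * X); [lra|field].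
have p : 0 < 4 * q%:R * r by rewrite mulr_gt0// mulr_gt0.
by rewrite ler_pM2l in H.
Qed.

(** The increment over [[q, n-q)] is independent of the hits and of [S_q - S_0]. Its variance is
    [3/4 >= 1/4], so its density is at most [2 kap], on an interval of length [2 r]. *)
Let pr_hits_gap g :
  pr P ((\bigcup_(j in `I_q.+1) hit g j) `&`
    [set om | `|S (n - q)%N om - S 0%N om - g| <= r]) <=
  4 * (kap R * r) * pr P (\bigcup_(j in `I_q.+1) hit g j).
Proof.
pose I : pred nat := fun i => (i < q)%N || (n - q <= i < n + q)%N.
pose J : pred nat := fun i => (q <= i < n - q)%N.
pose Z om := S q om - S 0%N om.
pose D om := S (n - q)%N om - S q om.
set E := \bigcup_(j in _) _.
have pE : past N xi I E.
  apply: past_bigcup => j /= jq; apply: past_hit; first by nlia.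
  by move=> i; rewrite /I; nlia.
have pZ : past_fun N xi I Z.
  by apply: (@past_inc I 0 q) => [|i]; rewrite /I; nlia.
have pD : past_fun N xi J D.
  by apply: (@past_inc J q (n - q)) => [|i]; rewrite /J; nlia.
have ind B C : measurable B -> measurable C ->
    pr P ((E `&` Z @^-1` B) `&` D @^-1` C) =
    pr P (E `&` Z @^-1` B) * pr P (D @^-1` C).
  move=> mB mC; apply: (past_indep mxi (gw_indep gS) (I := I) (J := J)).
  - by move=> i; rewrite /I /J; nlia.
  - by apply: pastI => //; exact: past_preimage.
  - exact: past_preimage.
pose M := [set x : R * R | `|x.1 + x.2 - g| <= r].
have mM : measurable M.
  apply: measurable_set_ler => //; apply: measurableT_comp => //.
  apply: measurable_funB => //.
  by apply: measurable_funD; [exact: measurable_fst|exact: measurable_snd].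
have Mub (z : R) : pr P [set om | M (z, D om)] <= 4 * (kap R * r).
  have -> : [set om | M (z, D om)] =
      [set om | g - z - r <= S (n - q)%N om - S q om <= g - z + r].
    by apply/seteqP; split => om; rewrite /M/D/= ler_norml; lra.
  rewrite (pr_increment_itv gS); last by nlia.
  set t := _%:R * _.
  have t14 : 4^-1 <= t.
    rewrite /t (_ : (n - q - q)%N = (6 * q)%N); last by nlia.
    rewrite nE !natrM invfM mulrACA mulfV ?pnatr_eq0 -?lt0n// mulr1.
    lra.
  have t0 : 0 < t by apply: lt_le_trans t14; rewrite invr_gt0.
  have zz : g - z - r <= g - z + r by have := r0; lra.
  apply: le_trans (gauss_itv_ub t0 zz) _.
  rewrite (_ : g - z + r - (g - z - r) = 2 * r); last by ring.
  have st : 2^-1 <= Num.sqrt t.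
    rewrite -[leLHS]ger0_norm// -sqrtr_sqr ler_wsqrtr//.
    by apply: le_trans t14; lra.
  have sp : 0 < Num.sqrt t by apply: lt_le_trans st; rewrite invr_gt0.
  have h : (Num.sqrt t)^-1 <= 2.
    by rewrite -[leRHS]invrK lef_pV2// posrE ?invr_gt0.
  have kr : 0 < kap R * r by rewrite mulr_gt0.
  rewrite (_ : kap R / Num.sqrt t * (2 * r) = 2 * (kap R * r) * (Num.sqrt t)^-1); last by ring.
  rewrite (_ : 4 * (kap R * r) = 2 * (kap R * r) * 2); last by ring.
  by rewrite ler_wpM2l// mulr_ge0// ltW.
have := independent_pair_ub (past_measurable mxi pE) (past_fun_measurable mxi pZ)
  (past_fun_measurable mxi pD) ind mM Mub.
congr (pr P (_ `&` _) <= _); apply/seteqP; split => om; rewrite /M /Z /D /=.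
  by rewrite (_ : S q om - S 0%N om + _ - g = S (n - q)%N om - S 0%N om - g)//; ring.
by rewrite (_ : S q om - S 0%N om + _ - g = S (n - q)%N om - S 0%N om - g)//; ring.
Qed.

Lemma pr_bridge_minimum_le :
  K%:R * pr P ([set om | `|S (n - q)%N om - S 0%N om| <= A] `&`
    \bigcup_(j in `I_q.+1) (near_past_min S r (n - q) (n + j) `&`
      [set om | `|S (n + j)%N om - S j om - lambda| <= r])) <=
  280 * kap R ^+ 2 / (kap R ^+ 2 * expR (- (25 / 2))).
Proof.
rewrite -/c; have [A0|A0] := ltP A 0.
  rewrite (_ : _ `&` _ = set0) ?pr0 ?mulr0.
    by apply: divr_ge0; [apply: mulr_ge0; [exact: ler0n|exact: sqr_ge0]|exact: ltW].
  apply/seteqP; split => // om [/= h _].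
  by have := le_lt_trans h A0; rewrite ltNge normr_ge0.
set G := (Num.truncn (2 * A / r)).+1.
pose U i := (\bigcup_(j in `I_q.+1) hit (- A + i%:R * r) j) `&`
    [set om | `|S (n - q)%N om - S 0%N om - (- A + i%:R * r)| <= r].
have mUh g : measurable (\bigcup_(j in `I_q.+1) hit g j).
  by apply: bigcup_ord_measurable => j jq; apply: measurable_hit; nlia.
have mU i : measurable (U i).
  apply: measurableI => //; apply: measurable_set_ler => //.
  apply: measurableT_comp => //; apply: measurable_funB => //.
  by apply: minc; nlia.
apply: (@le_trans _ _ (K%:R * pr P (\bigcup_(i in `I_G) U i))).
  rewrite ler_wpM2l// ?ler0n//; apply: pr_le.
  - apply: measurableI.
      apply: measurable_set_ler => //; apply: measurableT_comp => //.
      by apply: minc; nlia.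
    apply: bigcup_ord_measurable => j jq; apply: measurableI.
      by apply: (measurable_near_past_min gS); nlia.
    apply: measurable_set_ler => //; apply: measurableT_comp => //.
    by apply: measurable_funB => //; apply: minc; nlia.
  - exact: bigcup_ord_measurable.
  move=> om [/= GA [j /= jq [near_om /= hj]]].
  set Gam := S (n - q)%N om - S 0%N om in GA *.
  have [GA1 GA2] : - A <= Gam /\ Gam <= A by move: GA; rewrite ler_norml => /andP[].
  have x0 : 0 <= (Gam + A) / r by rewrite divr_ge0 ?(ltW r0)//; lra.
  have /andP[l1 l2] := truncn_itv x0.
  set i := Num.truncn _ in l1 l2.
  have iG : (i < G)%N.
    rewrite /G ltnS; apply: le_truncn; rewrite ler_pM2r ?invr_gt0//; lra.
  have l1' : i%:R * r <= Gam + A by rewrite -ler_pdivlMr.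
  have l2' : Gam + A < i%:R * r + r by move: l2; rewrite ltr_pdivrMr// -natr1 mulrDl mul1r.
  have hG : `|Gam - (- A + i%:R * r)| <= r by rewrite ler_norml; lra.
  exists i => //; split => //=; exists j => //; split => //=.
  move: hj hG; rewrite /gap !ler_norml /Gam; lra.
apply: (@le_trans _ _ (K%:R * \sum_(i < G) (4 * (kap R * r) *
     pr P (\bigcup_(j in `I_q.+1) hit (- A + i%:R * r) j)))).
  rewrite ler_wpM2l ?ler0n//; apply: (@le_trans _ _ (\sum_(i < G) pr P (U i))).
    by apply: pr_bigcup_le => i _; exact: mU.
  by apply: ler_sum => i _; exact: pr_hits_gap.
rewrite -mulr_sumr; have := hits_ub (- A) G; set X := \sum_(i < G) _ => H.
have {}H : (4 * kap R / c) * (c * r * K%:R * X) <= (4 * kap R / c) * (70 * kap R).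
  by rewrite ler_wpM2l// divr_ge0 ?(ltW c_gt0)// mulr_ge0// ltW.
have cn0 := gt_eqF c_gt0.
rewrite [leLHS](_ : _ = (4 * kap R / c) * (c * r * K%:R * X)); last first.
  by move: cn0; move: (c) => c' c'0; field; rewrite c'0.
apply: le_trans H _; rewrite le_eqVlt; apply/orP; left; apply/eqP.
by move: cn0; move: (c) => c' c'0; field; rewrite c'0.
Qed.

End bridge_minimum.

(** * Grid estimate for a near-minimum of the future followed by a near-minimum of the past *)

Section two_sided_minimum.
Context (R : realType) d (Om : measurableType d) (P : probability Om R).
Variables (m0 K q n : nat).
Hypotheses (nE : (4 * q <= n)%N) (q0 : (0 < q)%N).
Hypothesis harmonic_lb : K%:R / 2 <= \sum_(m0 <= m < q) (m%:R^-1 : R).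
Local Notation N := (n + 2 * q)%N.
Local Notation v := (n%:R^-1 : R).
Variables (S : nat -> Om -> R) (r : R).
Hypotheses (gS : gaussian_walk P N S v) (m00 : (0 < m0)%N) (m0q : (m0 <= q)%N).
Hypothesis r0 : 0 < r.
Hypothesis r_small : 3 * r <= Num.sqrt (m0%:R * v).
Hypothesis jump_small : pr P (jump N S r) <= kap R * r.
Local Notation xi := (fun i om => S i.+1 om - S i om).
Local Notation mxi := (gw_measurable gS).

Let n0 : 0 < n%:R :> R. Proof. by rewrite ltr0n; nlia. Qed.
Let v0 : 0 < v. Proof. by rewrite invr_gt0. Qed.
Let kap0 : 0 < kap R. Proof. exact: kap_gt0. Qed.

Let sqrt_gt0 m : (0 < m)%N -> 0 < Num.sqrt (m%:R * v).
Proof. by move=> m_gt0; rewrite sqrtr_gt0 mulr_gt0// ltr0n. Qed.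

Let sqrt_le1 m : (m <= n)%N -> Num.sqrt (m%:R * v) <= 1.
Proof.
move=> mn; rewrite -[leRHS]sqrtr1 ler_wsqrtr//.
by rewrite ler_pdivrMr// mul1r ler_nat.
Qed.

Let sqrt_le a b : (a <= b)%N -> Num.sqrt (a%:R * v) <= Num.sqrt (b%:R * v).
Proof. by move=> ab; rewrite ler_wsqrtr// ler_pM2r// ler_nat. Qed.

Let sqrt_ge m : (m0 <= m)%N -> 3 * r <= Num.sqrt (m%:R * v).
Proof. by move=> m0m; apply: le_trans r_small _; exact: sqrt_le. Qed.

Let past_inc (I : pred nat) a b : (a <= b <= N)%N ->
  (forall i, (a <= i < b)%N -> I i) ->
  past_fun N xi I (fun om => S b om - S a om).
Proof. exact: past_fun_increment. Qed.

Local Notation sh := (Num.sqrt (q%:R * v)).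

Let sh0 : 0 < sh. Proof. exact: sqrt_gt0. Qed.

Let sh1 : sh <= 1. Proof. by apply: sqrt_le1; nlia. Qed.

Let kr0 : 0 < kap R * r. Proof. by rewrite mulr_gt0. Qed.

Let kr_sh : kap R * r <= kap R * r / sh.
Proof. by rewrite ler_pdivlMr// ler_piMr// ltW. Qed.

Let inv_le a b : (0 < a <= b)%N -> (Num.sqrt (b%:R * v))^-1 <= (Num.sqrt (a%:R * v))^-1.
Proof.
move=> /andP[a0 ab]; rewrite lef_pV2 ?posrE ?sqrt_gt0//; first exact: sqrt_le.
exact: leq_trans ab.
Qed.

Let past_min_ub k : (k <= 2 * q)%N ->
  pr P (near_past_min S (2 * r) (n - q) (n + k)) <= 7 * (kap R * r / sh).
Proof.
move=> kq.
have ik : (n - q < n + k <= N)%N by nlia.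
have r20 : 0 <= 2 * r by have := r0; lra.
apply: le_trans (pr_near_past_min_ub gS v0 ik r20 r0) _.
have h : kap R * r * 6 * (Num.sqrt ((n + k - (n - q))%:R * v))^-1 <= kap R * r * 6 * sh^-1.
  rewrite ler_wpM2l//; first by have := kr0; lra.
  by apply: inv_le; nlia.
have := kr_sh; have := jump_small.
rewrite (_ : kap R / _ * _ = kap R * r * 6 * (Num.sqrt ((n + k - (n - q))%:R * v))^-1).
  by lra.
by ring.
Qed.

Let future_min_ub a k : (k <= 2 * q)%N -> 0 <= a -> a <= 2 * r ->
  pr P (near_future_min S a k (3 * q)) <= (2 * a + 3 * r) * kap R / sh.
Proof.
move=> kq a0 ar.
have ik : (k < 3 * q <= N)%N by nlia.
apply: le_trans (pr_near_future_min_ub gS v0 ik a0 r0) _.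
have h : kap R * (2 * a + 2 * r) * (Num.sqrt ((3 * q - k)%:R * v))^-1 <=
    kap R * (2 * a + 2 * r) * sh^-1.
  rewrite ler_wpM2l//; first by rewrite mulr_ge0// ?(ltW kap0)//; have := r0; lra.
  by apply: inv_le; nlia.
have := kr_sh; have := jump_small.
rewrite (_ : kap R / _ * _ = kap R * (2 * a + 2 * r) * (Num.sqrt ((3 * q - k)%:R * v))^-1); last by ring.
rewrite (_ : (2 * a + 3 * r) * kap R / sh = kap R * (2 * a + 2 * r) * sh^-1 + kap R * r / sh); last by ring.
by lra.
Qed.

Let future_min_lb k : (k <= 2 * q)%N ->
  kap R * r / sh <= pr P (near_future_min S (2 * r) k (3 * q)).
Proof.
move=> kq.
have ik : (k < 3 * q <= N)%N by nlia.
have r20 : 0 <= 2 * r by have := r0; lra.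
have rs : 2 * r <= Num.sqrt ((3 * q - k)%:R * v).
  have : 3 * r <= Num.sqrt ((3 * q - k)%:R * v) by apply: sqrt_ge; nlia.
  by have := r0; lra.
apply: le_trans (pr_near_future_min_lb gS v0 ik r20 rs).
set s := Num.sqrt ((3 * q - k)%:R * v).
have s0 : 0 < s by apply: sqrt_gt0; nlia.
have s4 : s <= 2 * sh.
  have s2E : Num.sqrt (4%:R : R) = 2.
    have -> : 4%:R = 2 ^+ 2 :> R by ring.
    by rewrite sqrtr_sqr ger0_norm.
  rewrite -s2E -sqrtrM ?ler0n// mulrA -natrM.
  by apply: sqrt_le; nlia.
rewrite ler_pdivrMr// (_ : kap R / s * (2 * r) * sh = (kap R * r) * (2 * sh / s)); last by ring.
by rewrite ler_pMr// ler_pdivlMr// mul1r.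
Qed.

(** The walk stays above [S_j - r/8] up to [k], and the rise by [2 r] compensates the tolerance
    [2 r] after [k]. So a revisit secures the future condition of [j] up to [3 q] and at the same
    time makes [k] a near future minimum. *)
Let revisit j k : set Om :=
  (near_past_min S r (n + j) (n + k) `&`
   (near_future_min S (r / 8) j k `&` [set om | 2 * r <= S k om - S j om])) `&`
  near_future_min S (2 * r) k (3 * q).

Let past_revisit j k (I : pred nat) : (j <= k <= 2 * q)%N ->
  (forall i, (j <= i < 3 * q)%N || (n + j <= i < n + k)%N -> I i) ->
  past N xi I (revisit j k).
Proof.
move=> jk II; apply: pastI; last first.
  by apply: past_near_future_min => [|i ij]; [|apply: II]; nlia.
apply: pastI.
  by apply: past_near_past_min => [|i ij]; [|apply: II]; nlia.
apply: pastI.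
  by apply: past_near_future_min => [|i ij]; [|apply: II]; nlia.
apply: past_le; first exact: past_fun_cst.
by apply: past_inc => [|i ij]; [|apply: II]; nlia.
Qed.

(** [40 = 8 * 5]: the tolerance [r / 8] in [E2], and the loss [5] in comparing the future minima at
    [j] and at [k]. *)
Let c : R := kap R ^+ 2 / 40.

Let c_gt0 : 0 < c. Proof. by rewrite divr_gt0// exprn_gt0. Qed.

(** The probability of a future minimum at [j] stays as a factor because it also bounds the first
    hit at [j], with which it will cancel. It is at most [5 kap r / sh], while [E3] has probability
    at least [kap r / sh]. *)
Let pr_revisit j m : (j <= q)%N -> (m0 <= m < q)%N ->
  c * (r ^+ 2 / (m%:R * v)) * pr P (near_future_min S r j (3 * q)) <=
  pr P (revisit j (j + m)).
Proof.
move=> jq mq; set k := (j + m)%N.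
set s := Num.sqrt (m%:R * v).
have m_gt0 : (0 < m)%N by nlia.
have mv0 : 0 < m%:R * v by rewrite mulr_gt0// ltr0n.
have s0 : 0 < s by exact: sqrt_gt0.
have rs : 3 * r <= s by apply: sqrt_ge; nlia.
have s2 : s ^+ 2 = m%:R * v by rewrite sqr_sqrtr// ltW.
have km : ((n + k) - (n + j) = m)%N by rewrite /k; nlia.
have km' : (k - j = m)%N by rewrite /k; nlia.
have jk : (n + j < n + k <= N)%N by rewrite /k; nlia.
have jk' : (j < k <= N)%N by rewrite /k; nlia.
pose E1 := near_past_min S r (n + j) (n + k).
pose E2 := near_future_min S (r / 8) j k `&` [set om | 2 * r <= S k om - S j om].
pose E3 := near_future_min S (2 * r) k (3 * q).
pose I1 : pred nat := fun i => (n + j <= i < n + k)%N.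
pose I2 : pred nat := fun i => (j <= i < k)%N.
pose I12 : pred nat := fun i => (n + j <= i < n + k)%N || (j <= i < k)%N.
pose I3 : pred nat := fun i => (k <= i < 3 * q)%N.
have p1 : past N xi I1 E1 by apply: past_near_past_min => [|i]; rewrite /I1; nlia.
have p2 : past N xi I2 E2.
  apply: pastI; first by apply: past_near_future_min => [|i]; rewrite /I2; nlia.
  apply: past_le; first exact: past_fun_cst.
  by apply: past_inc => [|i]; rewrite /I2; nlia.
have p12 : past N xi I12 (E1 `&` E2).
  apply: pastI.
  - by apply: pastS p1 => i _; rewrite /I1 /I12; nlia.
  - by apply: pastS p2 => i _; rewrite /I2 /I12; nlia.
have p3 : past N xi I3 E3.
  by apply: past_near_future_min => [|i]; rewrite /I3 /k; nlia.
have -> : pr P (revisit j k) = pr P E1 * pr P E2 * pr P E3.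
  rewrite /revisit -/E1 -/E2 -/E3 (past_indep mxi (gw_indep gS) _ p12 p3).
    rewrite (past_indep mxi (gw_indep gS) _ p1 p2)//.
    by move=> i; rewrite /I1 /I2 /k; nlia.
  by move=> i; rewrite /I12 /I3 /k; nlia.
have r_pos := r0.
have b1 : kap R / s * r <= pr P E1.
  by have := pr_near_past_min_lb gS v0 jk (ltW r0); rewrite km -/s; apply; lra.
have b2 : kap R / s * (r / 8) <= pr P E2.
  have r80 : 0 <= r / 8 by lra.
  have r20 : 0 <= 2 * r by lra.
  by have := pr_near_future_min_ge_lb gS v0 jk' r80 r20; rewrite km' -/s; apply; lra.
have b3 : pr P (near_future_min S r j (3 * q)) / 5 <= pr P E3.
  apply: (@le_trans _ _ (kap R * r / sh)); last by apply: future_min_lb; rewrite /k; nlia.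
  have jq2 : (j <= 2 * q)%N by nlia.
  have rr : r <= 2 * r by lra.
  have := future_min_ub jq2 (ltW r0) rr.
  rewrite (_ : (2 * r + 3 * r) * kap R / sh = 5 * (kap R * r / sh)); last by ring.
  by lra.
have ks0 : 0 <= kap R / s * r by rewrite mulr_ge0 ?divr_ge0 ?(ltW s0) ?(ltW kap0) ?(ltW r0).
have b12 : (kap R / s * r) * (kap R / s * (r / 8)) <= pr P E1 * pr P E2.
  by apply: ler_pM => //; have := ks0; lra.
have b0 : 0 <= (kap R / s * r) * (kap R / s * (r / 8)).
  by apply: mulr_ge0 => //; have := ks0; lra.
apply: (@le_trans _ _ ((kap R / s * r) * (kap R / s * (r / 8)) *
   (pr P (near_future_min S r j (3 * q)) / 5))); last first.
  by apply: ler_pM => //; rewrite divr_ge0// pr_ge0.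
rewrite -s2 /c le_eqVlt; apply/orP; left; apply/eqP.
by move: (gt_eqF s0) => sn0; field; rewrite sn0.
Qed.

Variable o : R.

(* The largest point of the grid [o + r Z] below [x]. Replacing levels by grid
   levels makes "being a future minimum" transitive along the discrete walk. *)
Let level (x : R) := o + r * (Num.floor ((x - o) / r))%:~R.

Let level_le x : level x <= x.
Proof.
rewrite /level -lerBrDl mulrC -ler_pdivlMr//; exact: floor_le.
Qed.

Let level_gt x : x - r < level x.
Proof.
have : (x - o) / r < (Num.floor ((x - o) / r) + 1)%:~R by exact: floorD1_gt.
rewrite ltr_pdivrMr// intrD mulrDl mul1r /level mulrC; lra.
Qed.

Let level_mono x y : level x <= y -> level x <= level y.
Proof.
rewrite {1}/level -lerBrDl mulrC -ler_pdivlMr// -floor_ge_int => xy.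
by rewrite /level lerD2l ler_pM2l// ler_int.
Qed.

Let measurable_level : measurable_fun setT level.
Proof.
apply: nondecreasing_measurable => // x y xy.
by apply: level_mono; apply: le_trans xy; exact: level_le.
Qed.

Local Notation x_ j om := (S j om - S 0%N om).

(** [k] is the horizon up to which the future condition is checked: [3 q] for a genuine hit, the
    present index for an event of the past. The margin [r / 8] above the level matches the tolerance
    in [revisit]. *)
Let local_hit j k : set Om := near_past_min S r (n - q) (n + j) `&`
  ([set om | level (x_ j om) + r / 8 <= x_ j om] `&`
   [set om | forall l, (j <= l <= k)%N -> level (x_ j om) <= x_ l om]).

Let hit j := local_hit j (3 * q).

Let near_hit k := near_past_min S (2 * r) (n - q) (n + k) `&`
  near_future_min S (2 * r) k (3 * q).

Let past_local_hit (I : pred nat) j k : (j <= q)%N -> (j <= k <= 3 * q)%N ->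
  (forall i, (i < k)%N || (n - q <= i < n + j)%N -> I i) ->
  past N xi I (local_hit j k).
Proof.
move=> jq jk II; apply: pastI.
  by apply: past_near_past_min => [|i ij]; [|apply: II]; nlia.
have px l : (l <= k)%N -> past_fun N xi I (fun om => x_ l om).
  by move=> lk; apply: past_inc => [|i ij]; [|apply: II]; nlia.
have pl : past_fun N xi I (fun om => level (x_ j om)).
  by apply: (past_fun_comp measurable_level); apply: px; nlia.
apply: pastI.
  apply: past_le; last by apply: px; nlia.
  by apply: past_funD => //; exact: past_fun_cst.
have -> : [set om | forall l, (j <= l <= k)%N -> level (x_ j om) <= x_ l om] =
   \bigcap_(l in [set l | (j <= l <= k)%N]) [set om | level (x_ j om) <= x_ l om].
  by apply/seteqP; split.
apply: past_bigcap => l /= /andP[_ lk]; apply: past_le => //; exact: px.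
Qed.

Let measurable_hit j : (j <= q)%N -> measurable (hit j).
Proof.
move=> jq; apply: (@past_measurable _ _ _ N xi mxi predT).
by apply: past_local_hit => //; nlia.
Qed.

Let measurable_near_hit k : (k <= 2 * q)%N -> measurable (near_hit k).
Proof.
move=> kq; apply: measurableI.
  by apply: (measurable_near_past_min gS); nlia.
by apply: (measurable_near_future_min gS); nlia.
Qed.

(** The part of a first hit at [j] that is decided without the increments over [[j, 3 q)]. *)
Let fresh j := local_hit j j `&` \bigcap_(i in `I_j) ~` local_hit i j.

(** If an earlier [i] were still a local hit at horizon [j], then for [l >= j] the level of [i]
    would be below that of [j], hence below [x_l], and [i] would be a hit before the first one. The
    comparison of the two levels is [level_mono]. *)
Let first_hit_fresh j : (j <= q)%N ->
  first_hit hit j `<=` fresh j `&` near_future_min S r j (3 * q).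
Proof.
move=> jq om [[/= nj [lj fj]] Hlt]; split; last first.
  move=> l jl; have := fj l jl; have := level_gt (x_ j om); rewrite /=; lra.
split.
  split => //; split => // l /= jl; have -> : l = j by nlia.
  exact: level_le.
move=> i /= ij [ni [li fi]]; apply: (Hlt i ij); split => //; split => // l /= il.
have [lj'|lj'] := leqP l j; first by apply: fi; nlia.
apply: (@le_trans _ _ (level (x_ j om))).
  by apply: level_mono; apply: fi; nlia.
by apply: fj; nlia.
Qed.

(** The revisit keeps the walk above the level of [j] until [3 q], so [j] is a hit; an earlier hit
    would be a local hit at horizon [j], which [fresh] excludes. *)
Let fresh_revisit j k : (j <= q)%N -> (j <= k <= 2 * q)%N ->
  fresh j `&` revisit j k `<=` first_hit hit j `&` near_hit k.
Proof.
move=> jq jk om [[[/= nj [lj _]] Hlt] [[/= nk [fjk /= up]] fk]].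
have r_pos := r0.
have above l : (j <= l <= 3 * q)%N -> S j om <= S l om + r / 8.
  move=> jl; have [lk|lk] := leqP l k; first by apply: fjk; nlia.
  have := fk l ltac:(nlia); move: up; lra.
split; last first.
  split => //= l kl; have [lj'|lj'] := leqP l (n + j)%N.
    by have := nj l ltac:(nlia); have := nk (n + j)%N ltac:(nlia); lra.
  by have := nk l ltac:(nlia); lra.
split.
  split => //; split => //= l jl; have := above l jl; move: lj => /=; lra.
move=> i /= ij [ni [li fi]]; apply: (Hlt i ij); split => //; split => // l /= il.
by apply: fi; nlia.
Qed.

(** Since [sh^2 = q / n], the expected number of near-hits is at most
    [2 q (7 kap r / sh)^2 = 98 kap^2 r^2 n], against at least [kap^2 r^2 n K / 80] for a hit;
    [98 * 80 = 7840]. *)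
Lemma pr_two_sided_minimum_le : K%:R * pr P (\bigcup_(j in `I_q.+1)
   (near_past_min S r (n - q) (n + j) `&`
   ([set om | o + r * (Num.floor ((S j om - S 0%N om - o) / r))%:~R + r / 8 <=
              S j om - S 0%N om] `&`
    [set om | forall l, (j <= l <= 3 * q)%N ->
       o + r * (Num.floor ((S j om - S 0%N om - o) / r))%:~R <= S l om - S 0%N om]))) <=
  7840.
Proof.
rewrite -[X in pr P X]/(\bigcup_(j in `I_q.+1) hit j).
have H : c * r ^+ 2 * n%:R * (K%:R / 2) * pr P (\bigcup_(j in `I_q.+1) hit j) <=
    \sum_(k < (2 * q)%N) pr P (near_hit k).
  apply: first_hit_le => [j jq|k kq|j jq].
  - by apply: measurable_hit; nlia.
  - by apply: measurable_near_hit; nlia.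
  set F := first_hit _ _.
  have mF : measurable F.
    apply: measurableI; first by apply: measurable_hit; nlia.
    apply: bigcap_measurableType => i /= ij.
    by apply: measurableC; apply: measurable_hit; nlia.
  pose I : pred nat := fun i => (i < j)%N || (n - q <= i < n + j)%N.
  pose J1 : pred nat := fun i => (j <= i < 3 * q)%N.
  have pF : past N xi I (fresh j).
    apply: pastI; first by apply: past_local_hit => //; nlia.
    apply: past_bigcap => i /= ij; apply: pastC; apply: past_local_hit; [nlia|nlia|].
    by move=> l; rewrite /I; nlia.
  have pJ1 : past N xi J1 (near_future_min S r j (3 * q)).
    by apply: past_near_future_min => //; nlia.
  have F_le : pr P F <= pr P (fresh j) * pr P (near_future_min S r j (3 * q)).
    rewrite -(past_indep mxi (gw_indep gS) _ pF pJ1); last first.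
      by move=> i; rewrite /I /J1; nlia.
    apply: pr_le => //; last by apply: first_hit_fresh; nlia.
    by apply: measurableI; [exact: (past_measurable mxi pF)|exact: (past_measurable mxi pJ1)].
  have H m : (m0 <= m < q)%N -> c * (r ^+ 2 / (m%:R * v)) * pr P F <=
      pr P (F `&` near_hit (j + m)).
    move=> mq.
    pose J : pred nat := fun i => (j <= i < 3 * q)%N || (n + j <= i < n + (j + m))%N.
    have pJ : past N xi J (revisit j (j + m)) by apply: past_revisit => //; nlia.
    apply: (@le_trans _ _ (pr P (fresh j `&` revisit j (j + m)))); last first.
      apply: pr_le.
      - by apply: measurableI; [exact: (past_measurable mxi pF)|exact: (past_measurable mxi pJ)].
      - by apply: measurableI => //; apply: measurable_near_hit; nlia.
      - by apply: fresh_revisit; nlia.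
    rewrite (past_indep mxi (gw_indep gS) _ pF pJ); last first.
      by move=> i; rewrite /I /J; nlia.
    apply: (@le_trans _ _ (c * (r ^+ 2 / (m%:R * v)) *
        (pr P (fresh j) * pr P (near_future_min S r j (3 * q))))).
      apply: ler_wpM2l => //; apply: mulr_ge0; first exact: ltW.
      apply: divr_ge0; first exact: sqr_ge0.
      by apply: mulr_ge0; [exact: ler0n|exact: ltW].
    rewrite mulrCA ler_wpM2l ?pr_ge0// pr_revisit//; nlia.
  apply: (@le_trans _ _ (\sum_(m0 <= m < q) pr P (F `&` near_hit (j + m)))).
    have Hs : \sum_(m0 <= m < q) c * (r ^+ 2 / (m%:R * v)) * pr P F <=
        \sum_(m0 <= m < q) pr P (F `&` near_hit (j + m)).
      by apply: ler_sum_nat => m mq; exact: H.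
    apply: le_trans Hs; rewrite -mulr_suml ler_wpM2r ?pr_ge0//.
    have -> : \sum_(m0 <= m < q) c * (r ^+ 2 / (m%:R * v)) =
        c * r ^+ 2 * n%:R * \sum_(m0 <= m < q) (m%:R^-1 : R).
      rewrite mulr_sumr; apply: eq_bigr => m _.
      by rewrite invfM invrK; ring.
    rewrite ler_wpM2l//.
    by rewrite mulr_ge0 ?ler0n// mulr_ge0 ?sqr_ge0// (ltW c_gt0).
  apply: (@sum_shift_le _ (fun k => pr P (F `&` near_hit k))); last by nlia.
  by move=> k; exact: pr_ge0.
have H2 : \sum_(k < (2 * q)%N) pr P (near_hit k) <=
    (2 * q)%:R * ((7 * (kap R * r / sh)) * (7 * (kap R * r / sh))).
  apply: (@le_trans _ _ (\sum_(k < (2 * q)%N)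
      (7 * (kap R * r / sh)) * (7 * (kap R * r / sh)))); last first.
    by rewrite sumr_const card_ord -[leLHS]mulr_natl.
  apply: ler_sum => -[k kq] _ /=.
  (* The two windows are disjoint because [4 q <= n]. *)
  pose I : pred nat := fun i => (n - q <= i < n + k)%N.
  pose J : pred nat := fun i => (k <= i < 3 * q)%N.
  rewrite (past_indep mxi (gw_indep gS) (I := I) (J := J)).
  - apply: ler_pM; rewrite ?pr_ge0//; first by apply: past_min_ub; nlia.
    have k2q : (k <= 2 * q)%N by nlia.
    have r20 : 0 <= 2 * r by have := r0; lra.
    have := future_min_ub k2q r20 (lexx _).
    by rewrite (_ : (2 * (2 * r) + 3 * r) * kap R / sh = 7 * (kap R * r / sh)); last by ring.
  - by move=> i; rewrite /I /J; nlia.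
  - by apply: past_near_past_min => //; nlia.
  - by apply: past_near_future_min => //; nlia.
set X := pr P _ in H *.
have {H2}H := le_trans H H2.
have sh2 : sh ^+ 2 = q%:R / n%:R by rewrite sqr_sqrtr// mulr_ge0 ?ler0n// ltW.
have q_gt0 : 0 < q%:R :> R by rewrite ltr0n.
pose a := kap R ^+ 2 * r ^+ 2 * n%:R / 80.
have a0 : 0 < a by rewrite divr_gt0// mulr_gt0// mulr_gt0 ?exprn_gt0.
have {}H : a * (K%:R * X) <= a * 7840.
  rewrite [leLHS](_ : _ = c * r ^+ 2 * n%:R * (K%:R / 2) * X); last first.
    by rewrite /a /c; field.
  apply: le_trans H _; rewrite le_eqVlt; apply/orP; left; apply/eqP.
  rewrite (_ : 7 * (kap R * r / sh) * (7 * (kap R * r / sh)) =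
      49 * kap R ^+ 2 * r ^+ 2 / sh ^+ 2); last by rewrite -exprVn; ring.
  rewrite sh2 natrM /a.
  move: q_gt0 n0; move: (q%:R : R) (n%:R : R) => y z y0 z0.
  by field; rewrite (gt_eqF y0) (gt_eqF z0).
by rewrite ler_pM2l in H.
Qed.

End two_sided_minimum.

(** * From the grid to continuous paths *)

Section dyadic_approximation.
Context (R : realType).

Definition dyadic (k i : nat) : R := i%:R / 2 ^+ k.

Definition dyadic_floor (k : nat) (s : R) : R := dyadic k (Num.truncn (s * 2 ^+ k)).

Lemma dyadic_ge0 k i : 0 <= dyadic k i.
Proof. by rewrite divr_ge0 ?ler0n// ltW. Qed.

Lemma dyadic_floor_itv k s : 0 <= s ->
  dyadic_floor k s <= s < dyadic_floor k s + (2 ^+ k)^-1.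
Proof.
move=> s0; have /andP[l u] : (Num.truncn (s * 2 ^+ k))%:R <= s * 2 ^+ k <
    (Num.truncn (s * 2 ^+ k)).+1%:R by apply: truncn_itv; rewrite mulr_ge0// ltW.
rewrite /dyadic_floor /dyadic ler_pdivrMr// l/=.
by rewrite -[X in _ + X]mul1r -mulrDl ltr_pdivlMr// natr1.
Qed.

Lemma cvg_expV2 : (2 ^+ k)^-1 @[k --> \oo] --> (0 : R).
Proof.
have -> : (fun k : nat => (2 ^+ k)^-1 : R) = (fun k => 2^-1 ^+ k).
  by apply/funext => k; rewrite exprVn.
by apply: cvg_expr; rewrite ger0_norm//; lra.
Qed.

Lemma expV2_lt (e : R) : 0 < e -> exists k0, forall k, (k0 <= k)%N -> (2 ^+ k)^-1 < e.
Proof.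
move=> e0; have /cvgrPdist_lt /(_ e e0) [k0 _ H] := cvg_expV2.
exists k0 => k kk0; have := H k kk0.
by rewrite sub0r normrN ger0_norm// invr_ge0 ltW.
Qed.

Lemma cvg_dyadic_floor s : 0 <= s -> dyadic_floor k s @[k --> \oo] --> s.
Proof.
move=> s0; apply/cvgrPdist_lt => e e0.
have [k0 Hk0] := expV2_lt e0; exists k0 => // k /= /Hk0 ke.
have /andP[l u] := dyadic_floor_itv k s0.
by rewrite ger0_norm ?subr_ge0//; lra.
Qed.

Lemma cpath_cvg_dyadic (w : cpath R) s : 0 <= s ->
  w (dyadic_floor k s) @[k --> \oo] --> w s.
Proof.
move=> s0.
have H : (w \o Num.max 0) (dyadic_floor k s) @[k --> \oo] --> (w \o Num.max 0) s.
  apply: (cvg_comp _ _ (cvg_dyadic_floor s0)).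
  exact: cpath_max0_continuous.
move: H; rewrite /= max_r//; under eq_fun do rewrite max_r ?dyadic_ge0//.
by [].
Qed.

End dyadic_approximation.

Section path_events.
Context (R : realType) d (Om : measurableType d).
Variables (B : Om -> cpath R).
Hypothesis mB : forall t : R, 0 <= t -> measurable_fun setT (fun om => B om t).

(** A dyadic rounding of [T] takes countably many values; continuity of the paths passes to the
    limit. *)
Lemma measurable_at_random_time (T : Om -> R) : measurable_fun setT T ->
  (forall om, 0 <= T om) -> measurable_fun setT (fun om => B om (T om)).
Proof.
move=> mT T0.
apply: (@measurable_fun_cvg _ _ _ _ (fun k om => B om (dyadic_floor k (T om)))); last first.
  by move=> om _; exact: cpath_cvg_dyadic.
move=> k _ A mA; rewrite setTI.
pose C i := [set om | (Num.truncn (T om * 2 ^+ k)) = i].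
have -> : (fun om => B om (dyadic_floor k (T om))) @^-1` A =
    \bigcup_i (C i `&` (fun om => B om (dyadic R k i)) @^-1` A).
  apply/seteqP; split => [om /= Aom|om [i _ [/= <-]]] //.
  by exists (Num.truncn (T om * 2 ^+ k)).
apply: bigcupT_measurable => i; apply: measurableI; last first.
  rewrite -[X in measurable X]setTI; apply: mB => //; exact: dyadic_ge0.
have T2 om : 0 <= T om * 2 ^+ k by rewrite mulr_ge0// exprn_ge0.
have -> : C i = [set om | i%:R <= T om * 2 ^+ k] `&` [set om | T om * 2 ^+ k < i.+1%:R].
  apply/seteqP; split => om; rewrite /C /=.
    by move=> <-; have /andP[] := truncn_itv (T2 om).
  by move=> [h1 h2]; apply: truncn_def; rewrite h1 h2.
have mT2 : measurable_fun setT (fun om => T om * 2 ^+ k).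
  by apply: measurable_funM => //.
by apply: measurableI; [exact: measurable_set_ler|exact: measurable_set_ltr].
Qed.

(* By continuity, comparing dyadic times bounds the oscillation on [0, L]. *)
Definition wobble (L o dl : R) : set Om :=
  \bigcup_(x in [set x : nat * nat * nat |
      dyadic R x.1.1 x.1.2 <= L /\ dyadic R x.1.1 x.2 <= L /\
      `|dyadic R x.1.1 x.1.2 - dyadic R x.1.1 x.2| <= dl])
    [set om | o < `|B om (dyadic R x.1.1 x.1.2) - B om (dyadic R x.1.1 x.2)|].

Lemma measurable_wobble L o dl : measurable (wobble L o dl).
Proof.
rewrite /wobble bigcup_mkcond; apply: countable_bigcupT_measurable => // x.
case: ifP => // _; apply: measurable_set_ltr => //.
by apply: measurableT_comp => //; apply: measurable_funB; apply: mB; exact: dyadic_ge0.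
Qed.

(** The bound by [dl] is strict so that dyadic approximations of [s] and [t] still differ by at most
    [dl]. *)
Lemma not_wobble L o dl om s t : ~ wobble L o dl om ->
  0 <= s <= L -> 0 <= t <= L -> `|s - t| < dl -> `|B om s - B om t| <= o.
Proof.
move=> nw /andP[s0 sL] /andP[t0 tL] st; rewrite leNgt; apply/negP => ost.
have cBs := @cpath_cvg_dyadic _ (B om) s s0.
have cBt := @cpath_cvg_dyadic _ (B om) t t0.
have cs := cvg_dyadic_floor s0; have ct := cvg_dyadic_floor t0.
have c1 : `|B om (dyadic_floor k s) - B om (dyadic_floor k t)| @[k --> \oo] -->
    `|B om s - B om t| by apply: cvg_norm; exact: cvgB.
have c2 : `|dyadic_floor k s - dyadic_floor k t| @[k --> \oo] --> `|s - t|.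
  by apply: cvg_norm; exact: cvgB.
have /cvgrPdist_lt /(_ (`|B om s - B om t| - o)) := c1.
rewrite subr_gt0 => /(_ ost) [k1 _ H1].
have /cvgrPdist_lt /(_ (dl - `|s - t|)) := c2.
rewrite subr_gt0 => /(_ st) [k2 _ H2].
pose k := maxn k1 k2.
have h1 := H1 k (leq_maxl _ _); have h2 := H2 k (leq_maxr _ _).
apply: nw; exists (k, Num.truncn (s * 2 ^+ k), Num.truncn (t * 2 ^+ k)) => /=.
  have /andP[ls _] := dyadic_floor_itv k s0; have /andP[lt _] := dyadic_floor_itv k t0.
  split; first exact: le_trans sL; split; first exact: le_trans tL.
  move: h2; rewrite /= -/(dyadic_floor k s) -/(dyadic_floor k t) ltr_norml => /andP[h _].
  by lra.
by move: h1; rewrite /= -/(dyadic_floor k s) -/(dyadic_floor k t) ltr_norml => /andP[_ h]; lra.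
Qed.

(** Uniform continuity on [[0, L]]: a cluster point of ever closer pairs with oscillation above [o]
    would be a discontinuity. *)
Lemma wobble_vanish L o : 0 < o -> \bigcap_N wobble L o (2 ^+ N)^-1 = set0.
Proof.
move=> o0; apply/seteqP; split => // om H.
have ex N : exists st : R * R, [/\ 0 <= st.1 <= L, 0 <= st.2 <= L,
    `|st.1 - st.2| <= (2 ^+ N)^-1 & o < `|B om st.1 - B om st.2|].
  have [[[k i] j] /= [iL [jL ij]] oB] := H N Logic.I.
  by exists (dyadic R k i, dyadic R k j); split => //=; rewrite dyadic_ge0.
have [st Hst] := choice ex.
pose s N := (st N).1; pose t N := (st N).2.
have cpt := @segment_compact R 0 L.
have Fs : (s @ \oo) `[0, L]%classic.
  by exists 0%N => // N _ /=; rewrite in_itv/=; have [] := Hst N.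
have [x [_ clx]] := cpt (s @ \oo) _ Fs.
pose f := B om \o Num.max 0.
have fE y : 0 <= y -> f y = B om y by move=> y0; rewrite /f/= max_r.
have /cvgrPdist_lt /(_ (o / 2)) : f y @[y --> x] --> f x.
  exact: cpath_max0_continuous.
move=> /(_ ltac:(lra)) /nbhs_ballP[e /= e0 He].
have [N0 HN0] := @expV2_lt R (e / 2) ltac:(lra).
have A1 : (s @ \oo) [set y | exists2 N, (N0 <= N)%N & y = s N].
  by exists N0 => // N /= NN0; exists N.
have e20 : 0 < e / 2 by lra.
have [_ [[N NN0 ->] sx]] := clx _ _ A1 (nbhsx_ballx x (e / 2) e20).
have [/andP[s0 _] /andP[t0 _] stN osB] := Hst N.
have l2 := HN0 N NN0.
rewrite /ball/= in sx.
have b1 : `|f x - f (s N)| < o / 2.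
  by apply: He; rewrite /ball/=; apply: lt_le_trans sx _; lra.
have b2 : `|f x - f (t N)| < o / 2.
  apply: He; rewrite /ball/=.
  have : `|x - t N| <= `|x - s N| + `|s N - t N|.
    by rewrite -[x - t N](subrKA (s N)) ler_normD.
  rewrite /s /t in sx *; lra.
have : `|f (s N) - f (t N)| <= `|f x - f (s N)| + `|f x - f (t N)|.
  rewrite [`|f x - f (s N)|]distrC -[f (s N) - f (t N)](subrKA (f x)).
  exact: ler_normD.
rewrite -(fE (s N) s0) -(fE (t N) t0) in osB.
lra.
Qed.

Lemma pr_wobble_small (P : probability Om R) L o eta : 0 < o -> 0 < eta ->
  exists N0, forall N, (N0 <= N)%N -> pr P (wobble L o (2 ^+ N)^-1) <= eta.
Proof.
move=> o0 eta0.
have mw N : measurable (wobble L o (2 ^+ N)^-1) by exact: measurable_wobble.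
have := @nonincreasing_cvg_mu _ _ _ P (fun N => wobble L o (2 ^+ N)^-1).
rewrite wobble_vanish// measure0 => H.
have {}H : P \o (fun N => wobble L o (2 ^+ N)^-1) @ \oo --> 0%E.
  apply: H => //; first by rewrite ltey_eq fin_num_measure.
  move=> i j ij; apply/subsetPset => om [x [h1 [h2 h3]] h4]; exists x => //.
  split => //; split => //; apply: le_trans h3 _.
  by rewrite lef_pV2 ?posrE ?exprn_gt0// ler_weXn2l//; lra.
have : (pr P (wobble L o (2 ^+ N)^-1))%:E @[N --> \oo] --> 0%:E.
  rewrite (_ : (fun N => _) = P \o (fun N => wobble L o (2 ^+ N)^-1))//.
  by apply/funext => N /=; rewrite -prE.
move=> /fine_cvgP[_] /cvgrPdist_lt /(_ eta eta0) [N0 _ HN].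
exists N0 => N NN0; have := HN N NN0.
by rewrite sub0r normrN/= => /ltW; apply: le_trans; exact: ler_norm.
Qed.

End path_events.

(** * Null events of Brownian motion over a short time interval *)

Section null_events.
Context (R : realType) d (Om : measurableType d) (P : probability Om R).
Variables (B : Om -> cpath R) (hB : brownian_motion P B).

Lemma pr_tail_small (X : Om -> R) eta : measurable_fun setT X -> 0 < eta ->
  exists A, pr P [set om | A < `|X om|] <= eta.
Proof.
move=> mX eta0.
pose F (N : nat) := [set om | N%:R < `|X om|].
have mF N : measurable (F N).
  by apply: measurable_set_ltr => //; exact: measurableT_comp.
have F0 : \bigcap_N F N = set0.
  apply/seteqP; split => // om H.
  have := H (Num.truncn `|X om|).+1 Logic.I; rewrite /F/= => /ltW.
  by rewrite leNgt; have /andP[_ ->] := truncn_itv (normr_ge0 (X om)).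
have := @nonincreasing_cvg_mu _ _ _ P F.
rewrite F0 measure0 => H.
have {}H : P \o F @ \oo --> 0%E.
  apply: H => //; first by rewrite ltey_eq fin_num_measure.
  move=> i j ij; apply/subsetPset => om; rewrite /F/=; apply: le_lt_trans.
  by rewrite ler_nat.
have : (pr P (F N))%:E @[N --> \oo] --> 0%:E.
  rewrite (_ : (fun N => _) = P \o F)//.
  by apply/funext => N /=; rewrite -prE.
move=> /fine_cvgP[_] /cvgrPdist_lt /(_ eta eta0) [N0 _ HN].
exists N0%:R; have := HN N0 (leqnn _).
by rewrite sub0r normrN/= => /ltW; apply: le_trans; exact: ler_norm.
Qed.

Section scales.
Variables (e K M : nat).
Hypothesis KM : (K <= M)%N.

Let m0 := (2 ^ (M - K))%N.
Let q := (2 ^ M)%N.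
Let n := (2 ^ e * q)%N.
(** [m0 / n = 2^-(K + e)] is free of [M], so [3 r = sqrt (m0 / n)] depends on [K] and [e] alone, and
    increasing [M] refines the mesh at constant [r]. *)
Let r : R := Num.sqrt ((2 ^+ (K + e))^-1) / 3.

Lemma scale_r_gt0 : 0 < r.
Proof. by rewrite divr_gt0// sqrtr_gt0 invr_gt0 exprn_gt0. Qed.

Lemma scale_r_small : 3 * r <= Num.sqrt (m0%:R * (n%:R^-1 : R)).
Proof.
rewrite /r mulrCA mulfV// mulr1 ler_wsqrtr//.
rewrite /n /q /m0 -{2}(subnK KM) expnD !natrM !natrX exprD !invfM.
have x0 : (2 ^+ (M - K) : R) != 0 by rewrite expf_neq0.
rewrite le_eqVlt; apply/orP; left; apply/eqP.
by rewrite mulrCA [X in _ = _ * X]mulrA mulfV// mul1r mulrC.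
Qed.

Lemma scale_harmonic : K%:R / 2 <= \sum_(m0 <= m < q) (m%:R^-1 : R).
Proof.
rewrite /q -(subnK KM) expnD; apply: harmonic_dyadic_lb.
by rewrite expn_gt0.
Qed.

Lemma scale_inv : (n%:R^-1 : R) = (2 ^+ (e + M))^-1.
Proof. by rewrite /n /q natrM !natrX exprD. Qed.

End scales.

Section discretization.
Variables (a v : R) (N : nat).
Hypotheses (a0 : 0 <= a) (v0 : 0 < v).
Local Notation S i om := (B om (a + i%:R * v)).

Lemma jump_wobble L o dl : a + N%:R * v <= L -> v < dl ->
  jump N (fun i om => S i om) o `<=` wobble B L o dl.
Proof.
move=> aL vd om [i /= iN oB]; apply: contrapT => nw.
have iv k : 0 <= k%:R * v by rewrite mulr_ge0 ?ler0n// ltW.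
have kv k : (k <= N)%N -> 0 <= a + k%:R * v <= L.
  move=> kN; rewrite addr_ge0//=; apply: le_trans aL.
  by rewrite lerD2l ler_pM2r// ler_nat.
have := not_wobble nw (kv _ iN) (kv _ (ltnW iN)).
rewrite (_ : _ - _ = v); last by rewrite -natr1; ring.
by rewrite gtr0_norm// => /(_ vd); rewrite leNgt oB.
Qed.

(** Rounding strictly upwards puts the smaller grid times at or before [t] and all others after [t].
    The same index thus serves a window starting at [t] and, shifted by [1], one ending at
    [t + 1]. *)
Definition next_index (t : R) : nat := (Num.truncn ((t - a) / v)).+1.

Lemma next_index_itv t : a <= t ->
  t < a + (next_index t)%:R * v <= t + v.
Proof.
move=> at_; have x0 : 0 <= (t - a) / v by rewrite divr_ge0 ?subr_ge0// ltW.
have /andP[l u] := truncn_itv x0; rewrite /next_index.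
rewrite ltr_pdivrMr// in u; rewrite ler_pdivlMr// in l.
by apply/andP; split; [lra|rewrite -natr1; lra].
Qed.

Lemma next_index_le t q : a <= t < a + q%:R * v -> (next_index t <= q)%N.
Proof.
move=> /andP[at_ tq]; rewrite /next_index truncn_lt_nat.
  by rewrite ltr_pdivrMr//; lra.
by rewrite divr_ge0 ?subr_ge0// ltW.
Qed.

Lemma lt_next_index t l : a <= t -> (l < next_index t)%N -> a + l%:R * v <= t.
Proof.
move=> at_; rewrite /next_index ltnS => lt_.
have x0 : 0 <= (t - a) / v by rewrite divr_ge0 ?subr_ge0// ltW.
have /andP[h _] := truncn_itv x0; rewrite ler_pdivlMr// in h.
have : l%:R * v <= (Num.truncn ((t - a) / v))%:R * v by rewrite ler_pM2r// ler_nat.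
by lra.
Qed.

End discretization.

Lemma null_of_small E (C : R) : measurable E -> 0 <= C ->
  (forall K : nat, (0 < K)%N -> forall eta, 0 < eta -> pr P E <= eta + C / K%:R) ->
  P E = 0%E.
Proof.
move=> mE C0 H; rewrite prE//; congr (_%:E); apply/eqP.
rewrite eq_le pr_ge0 andbT leNgt; apply/negP => p0.
pose K := (Num.truncn (2 * C / pr P E)).+1.
have K0 : 0 < K%:R :> R by rewrite ltr0n.
have := H K isT (pr P E / 4) ltac:(lra).
have /andP[_] : (Num.truncn (2 * C / pr P E))%:R <= 2 * C / pr P E < K%:R.
  by apply: truncn_itv; rewrite divr_ge0// ?(ltW p0)// mulr_ge0.
rewrite ltr_pdivrMr// => KC.
have : C / K%:R <= pr P E / 2 by rewrite ler_pdivrMr//; lra.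
lra.
Qed.

Lemma bridge_minimum_null a lambda E : 0 <= a -> measurable E ->
  (forall om, E om -> exists t, [/\ a <= t < a + 8^-1,
     B om (t + 1) - B om t = lambda &
     forall u, 0 <= u <= 1 -> lambda <= B om (t + u) - B om t]) ->
  P E = 0%E.
Proof.
move=> a0 mE HE.
apply: (@null_of_small E (280 * kap R ^+ 2 / (kap R ^+ 2 * expR (- (25 / 2))))).
- exact: mE.
- apply: divr_ge0; last by apply: mulr_ge0; [exact: sqr_ge0|exact: expR_ge0].
  by apply: mulr_ge0; [exact: ler0n|exact: sqr_ge0].
move=> K K0 eta eta0.
have mB := bm_measurable hB.
(* This is the starting gap [S_{n-q} - S_0], as [(n - q) v = 7/8]; its tail is discarded so that
   finitely many levels suffice. *)
have mG : measurable_fun setT (fun om => B om (a + 7 / 8) - B om a).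
  by apply: measurable_funB; apply: mB => //; lra.
have eta20 : 0 < eta / 2 by lra.
have [A HA] := pr_tail_small mG eta20.
pose r : R := Num.sqrt ((2 ^+ (K + 3))^-1) / 3.
have r0 : 0 < r := scale_r_gt0 3 K.
have kr0 : 0 < kap R * (r / 18) by rewrite mulr_gt0 ?kap_gt0//; lra.
(* Rounding [t] to the grid moves each end by at most [o], hence the increment by at most
   [2 o <= r]. *)
pose o := r / 4; have o0 : 0 < o by rewrite /o; lra.
have eta'0 : 0 < Num.min (eta / 2) (kap R * (r / 18)) by rewrite lt_min eta20.
have [N0 HN0] := pr_wobble_small mB P (a + 3) o0 eta'0.
pose M := maxn K N0.
have KM : (K <= M)%N by exact: leq_maxl.
pose q := (2 ^ M)%N; pose n := (2 ^ 3 * q)%N; pose m0 := (2 ^ (M - K))%N.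
pose v : R := n%:R^-1.
have q0 : (0 < q)%N by rewrite expn_gt0.
have nE : n = (8 * q)%N by [].
have n0 : 0 < n%:R :> R by rewrite ltr0n nE muln_gt0.
have v0 : 0 < v by rewrite invr_gt0.
pose S i om := B om (a + i%:R * v).
have gS : gaussian_walk P (n + 2 * q)%N S v by exact: brownian_walk.
have qv : q%:R * v = 8^-1.
  rewrite /v nE natrM invfM mulrCA mulfV ?mulr1//.
  by rewrite pnatr_eq0 -lt0n.
have nv : n%:R * v = 1 by rewrite mulfV// gt_eqF.
pose w := wobble B (a + 3) o (2 ^+ N0)^-1.
have vd : v < (2 ^+ N0)^-1.
  rewrite /v (scale_inv 3 M) ltf_pV2 ?posrE ?exprn_gt0//.
  rewrite ltr_eXn2l//; last by lra.
  by rewrite /M; nlia.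
have mw : measurable w by exact: measurable_wobble.
have := HN0 N0 (leqnn _); rewrite -/w le_min => /andP[w1 w2].
have Nv : a + (n + 2 * q)%:R * v <= a + 3.
  by rewrite natrD natrM mulrDl -mulrA qv nv; lra.
have jumpw : jump (n + 2 * q) S o `<=` w by exact: jump_wobble.
have J : pr P (jump (n + 2 * q) S r) <= kap R * (r / 18).
  apply: le_trans w2; apply: pr_le => //; first exact: (measurable_jump (gw_measurable gS)).
  apply: subset_trans jumpw => om [i iN /= h]; exists i => //=.
  by apply: lt_trans h; rewrite /o; lra.
have m00 : (0 < m0)%N by rewrite expn_gt0.
have main := pr_bridge_minimum_le nE q0 (scale_harmonic KM) gS m00 r0 (scale_r_small 3 KM) J lambda A.
set Hit := (X in _ * pr P X) in main.
have mHit : measurable Hit.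
  apply: measurableI.
    apply: measurable_set_ler => //; apply: measurableT_comp => //.
    by apply: measurable_funB; apply: mB; rewrite addr_ge0// mulr_ge0 ?ler0n// ltW.
  apply: bigcup_ord_measurable => j jq; apply: measurableI.
    by apply: (measurable_near_past_min gS); nlia.
  apply: measurable_set_ler => //; apply: measurableT_comp => //.
  apply: measurable_funB => //.
  by apply: measurable_funB; apply: mB; rewrite addr_ge0// mulr_ge0 ?ler0n// ltW.
have mT : measurable [set om | A < `|B om (a + 7 / 8) - B om a|].
  by apply: measurable_set_ltr => //; exact: measurableT_comp.
have sub : E `<=` (w `|` [set om | A < `|B om (a + 7 / 8) - B om a|]) `|` Hit.
  move=> om Eom; have [wom|nw] := pselect (w om); first by left; left.
  have [tA|tA] := ltP A `|B om (a + 7 / 8) - B om a|; first by left; right.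
  right; have [t [/andP[at_ ta] tl tmin]] := HE om Eom.
  have Sn i : S (n + i)%N om = B om (a + 1 + i%:R * v).
    by rewrite /S natrD mulrDl nv; congr (B om _); ring.
  split => /=.
    rewrite /S mul0r addr0 natrB ?mulrBl ?nv ?qv; last by nlia.
    by rewrite (_ : 1 - 8^-1 = 7 / 8 :> R)//; lra.
  pose j := next_index a v t.
  have /andP[tj1 tj2] := next_index_itv v0 at_.
  have jq : (j <= q)%N by apply: (next_index_le v0); rewrite at_ qv.
  have jv : 0 <= j%:R * v <= 8^-1.
    by rewrite mulr_ge0 ?ler0n ?(ltW v0)//= -qv ler_pM2r// ler_nat.
  have d1 : `|B om (a + j%:R * v) - B om t| <= o.
    apply: (not_wobble nw); [lra|lra|].
    by apply: le_lt_trans vd; rewrite ler_norml -/j in tj1 tj2 *; lra.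
  have d2 : `|S (n + j)%N om - B om (t + 1)| <= o.
    rewrite Sn; apply: (not_wobble nw); [lra|lra|].
    by apply: le_lt_trans vd; rewrite ler_norml -/j in tj1 tj2 *; lra.
  move: d1 d2; rewrite !ler_norml => /andP[d1 d1'] /andP[d2 d2'].
  have r4 : o = r / 4 by [].
  exists j => /=; first by rewrite ltnS.
  split; last by rewrite /= ler_norml /S in d2 d2' *; rewrite /S; lra.
  (* The grid time of [n + j] lies beyond [t + 1], where nothing is known, but is only compared with
     itself; the smaller ones lie in [[t, t + 1]]. *)
  move=> l /andP[nl ln]; have [->|lj] := eqVneq l (n + j)%N; first by lra.
  have lt_ : S l om - B om t >= lambda.
    have [ln'|ln'] := leqP n l.
      have lE : l = (n + (l - n))%N by nlia.
      have : a + (l - n)%:R * v <= t.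
        by apply: (lt_next_index v0 at_); rewrite -/j; nlia.
      move=> h; rewrite lE Sn.
      have x0 : 0 <= (l - n)%:R * v by rewrite mulr_ge0 ?ler0n// ltW.
      rewrite (_ : a + 1 + (l - n)%:R * v = t + (a + 1 + (l - n)%:R * v - t)); last by ring.
      by apply: tmin; lra.
    rewrite /S (_ : a + l%:R * v = t + (a + l%:R * v - t)); last by ring.
    have l1 : 7 / 8 <= l%:R * v.
      rewrite (_ : 7 / 8 = (n - q)%:R * v :> R); last first.
        rewrite natrB ?mulrBl ?nv ?qv; last by nlia.
        by lra.
      by rewrite ler_pM2r// ler_nat.
    have l2 : l%:R * v <= 1 by rewrite -[leRHS]nv ler_pM2r// ler_nat ltnW.
    by apply: tmin; lra.
  by lra.
apply: le_trans (pr_le P mE _ sub) _.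
  by apply: measurableU => //; exact: measurableU.
apply: (@le_trans _ _ (pr P w + pr P [set om | A < `|B om (a + 7 / 8) - B om a|] + pr P Hit)).
  apply: le_trans (prU_le _ _ _) _ => //; first exact: measurableU.
  by rewrite lerD2r; exact: prU_le.
have K0' : 0 < K%:R :> R by rewrite ltr0n.
apply: lerD; first by lra.
by rewrite ler_pdivlMr// mulrC.
Qed.

End null_events.

Section two_sided_null_event.
Context (R : realType) d (Om : measurableType d) (P : probability Om R).
Variables (B : Om -> cpath R) (hB : brownian_motion P B).

(* Where [x] is too close to the grid [r Z], its translate by [r / 2] is used. *)
Lemma middle_of_cell (r x : R) : 0 < r -> exists (b : bool) (z : int),
  (b%:R * (r / 2) + r * z%:~R) + r / 4 <= x < (b%:R * (r / 2) + r * z%:~R) + 3 / 4 * r.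
Proof.
move=> r0; pose f := Num.floor (x / r).
have l : f%:~R * r <= x by rewrite -ler_pdivlMr//; exact: floor_le.
have u : x < f%:~R * r + r.
  have : x / r < (f + 1)%:~R by exact: floorD1_gt.
  by rewrite ltr_pdivrMr// intrD mulrDl mul1r.
have [c1|c1] := ltP x (f%:~R * r + r / 4).
  by exists true, (f - 1)%R; rewrite intrB /= mulrBr mulr1 mul1r mulrC; lra.
have [c2|c2] := ltP x (f%:~R * r + 3 / 4 * r).
  by exists false, f; rewrite mul0r add0r mulrC; lra.
by exists true, f; rewrite /= mul1r mulrC; lra.
Qed.

(** With [h = q v = 2^-e], the indices from [j] to [3 q] reach at most [3 h] beyond [t], and those
    from [n - q] on reach back less than [2 h] before [t + 1], so windows of length [4 h] suffice.
    Each of the two shifted grids of levels contributes [7840]. *)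
Lemma two_sided_minimum_null e a E : (2 <= e)%N -> 0 <= a -> measurable E ->
  (forall om, E om -> exists t, a <= t < a + (2 ^+ e)^-1 /\
     forall u, 0 <= u <= 4 * (2 ^+ e)^-1 ->
       B om t <= B om (t + u) /\ B om (t + 1) <= B om (t + 1 - u)) ->
  P E = 0%E.
Proof.
move=> e2 a0 mE HE.
apply: (null_of_small (C := 7840 + 7840) mE); first by apply: addr_ge0; exact: ler0n.
move=> K K0 eta eta0.
have mB := bm_measurable hB.
pose r : R := Num.sqrt ((2 ^+ (K + e))^-1) / 3.
have r0 : 0 < r := scale_r_gt0 R e K.
have kr0 : 0 < kap R * r by rewrite mulr_gt0 ?kap_gt0.
(* [middle_of_cell] leaves [r / 4] on both sides of the value at [t]; a displacement by [r / 8]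
   keeps it in the cell and leaves the margin [r / 8] required of a hit. *)
pose o := r / 8; have o0 : 0 < o by rewrite /o; lra.
have eta'0 : 0 < Num.min eta (kap R * r) by rewrite lt_min eta0.
have [N0 HN0] := pr_wobble_small mB P (a + 3) o0 eta'0.
pose M := maxn K N0.
have KM : (K <= M)%N by exact: leq_maxl.
pose q := (2 ^ M)%N; pose n := (2 ^ e * q)%N; pose m0 := (2 ^ (M - K))%N.
pose v : R := n%:R^-1.
have q0 : (0 < q)%N by rewrite expn_gt0.
have nE : (4 * q <= n)%N.
  by apply: leq_mul => //; rewrite -[4%N]/(2 ^ 2)%N leq_exp2l.
have m0q : (m0 <= q)%N by rewrite leq_exp2l// leq_subr.
have n0 : 0 < n%:R :> R by rewrite ltr0n muln_gt0 expn_gt0 q0.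
have v0 : 0 < v by rewrite invr_gt0.
pose S i om := B om (a + i%:R * v).
have gS : gaussian_walk P (n + 2 * q)%N S v by exact: brownian_walk.
pose h : R := (2 ^+ e)^-1.
have h0 : 0 < h by rewrite invr_gt0 exprn_gt0.
have qv : q%:R * v = h.
  rewrite /v /h natrM natrX invfM mulrCA mulfV ?mulr1//.
  by rewrite pnatr_eq0 -lt0n.
have nv : n%:R * v = 1 by rewrite mulfV// gt_eqF.
have h4 : 4 * h <= 1.
  by rewrite -qv -[leRHS]nv mulrA -natrM ler_pM2r// ler_nat.
pose w := wobble B (a + 3) o (2 ^+ N0)^-1.
have vd : v < (2 ^+ N0)^-1.
  rewrite /v (scale_inv R e M) ltf_pV2 ?posrE ?exprn_gt0//.
  rewrite ltr_eXn2l//; last by lra.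
  by rewrite /M; nlia.
have mw : measurable w by exact: measurable_wobble.
have := HN0 N0 (leqnn _); rewrite -/w le_min => /andP[w1 w2].
have Nv : a + (n + 2 * q)%:R * v <= a + 3.
  by rewrite natrD natrM mulrDl -mulrA qv nv; lra.
have jumpw : jump (n + 2 * q) S o `<=` w by exact: jump_wobble.
have J : pr P (jump (n + 2 * q) S r) <= kap R * r.
  apply: le_trans w2; apply: pr_le => //; first exact: (measurable_jump (gw_measurable gS)).
  apply: subset_trans jumpw => om [i iN /= hi]; exists i => //=.
  by apply: lt_trans hi; rewrite /o; lra.
have m00 : (0 < m0)%N by rewrite expn_gt0.
have main b := pr_two_sided_minimum_le nE q0 (scale_harmonic R KM) gS m00 m0q r0
  (scale_r_small R e KM) J b.
pose Hit b := (\bigcup_(j in `I_q.+1)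
   (near_past_min S r (n - q) (n + j) `&`
   ([set om | b + r * (Num.floor ((S j om - S 0%N om - b) / r))%:~R + r / 8 <=
              S j om - S 0%N om] `&`
    [set om | forall l, (j <= l <= 3 * q)%N ->
       b + r * (Num.floor ((S j om - S 0%N om - b) / r))%:~R <= S l om - S 0%N om]))).
have S0 om : S 0%N om = B om a by rewrite /S mul0r addr0.
have mS i : measurable_fun setT (S i).
  by apply: mB; rewrite addr_ge0// mulr_ge0 ?ler0n// ltW.
have mlev b j : measurable_fun setT
    (fun om => b + r * (Num.floor ((S j om - S 0%N om - b) / r))%:~R).
  apply: measurable_funD => //; apply: measurable_funM => //.
  apply: (measurableT_comp (f := fun x : R => (Num.floor x)%:~R : R)).
    by apply: nondecreasing_measurable => // x y xy; rewrite ler_int; exact: le_floor.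
  by apply: measurable_funM => //; apply: measurable_funB => //; exact: measurable_funB.
have mHit b : measurable (Hit b).
  apply: bigcup_ord_measurable => j jq; apply: measurableI.
    by apply: (measurable_near_past_min gS); nlia.
  apply: measurableI.
    apply: measurable_set_ler; last exact: measurable_funB.
    by apply: measurable_funD => //; exact: mlev.
  rewrite (_ : [set om | forall l, _] = \bigcap_(l in [set l | (j <= l <= 3 * q)%N])
     [set om | b + r * (Num.floor ((S j om - S 0%N om - b) / r))%:~R <= S l om - S 0%N om]).
    apply: bigcap_measurableType => l _; apply: measurable_set_ler; first exact: mlev.
    exact: measurable_funB.
  by apply/seteqP; split.
have sub : E `<=` (w `|` Hit (false%:R * (r / 2))) `|` Hit (true%:R * (r / 2)).
  clear main J w1 w2 kr0 eta0 eta'0.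
  move=> om Eom; have [wom|nw] := pselect (w om); first by left; left.
  have [t [/andP[at_ ta] tmin]] := HE om Eom.
  have Sn i : S (n + i)%N om = B om (a + 1 + i%:R * v).
    by rewrite /S natrD mulrDl nv; congr (B om _); ring.
  suff [b Hb] : exists b : bool, Hit (b%:R * (r / 2)) om.
    by case: b Hb => Hb; [right|left; right].
  have [b [z Hz]] := middle_of_cell (B om t - B om a) r0.
  exists b.
  pose j := next_index a v t.
  have /andP[tj1 tj2] := next_index_itv v0 at_.
  have jq : (j <= q)%N by apply: (next_index_le v0); rewrite at_ qv.
  have jv : 0 <= j%:R * v <= h.
    by rewrite mulr_ge0 ?ler0n ?(ltW v0)//= -qv ler_pM2r// ler_nat.
  have th : t < a + h by [].
  have d1 : `|B om (a + j%:R * v) - B om t| <= o.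
    apply: (not_wobble nw); [clear Hz; lra|clear Hz; lra|].
    by apply: le_lt_trans vd; rewrite ler_norml -/j in tj1 tj2 *; lra.
  have d2 : `|S (n + j)%N om - B om (t + 1)| <= o.
    rewrite Sn; apply: (not_wobble nw); [clear Hz; lra|clear Hz; lra|].
    by apply: le_lt_trans vd; rewrite ler_norml -/j in tj1 tj2 *; lra.
  move: d1 d2; rewrite !ler_norml => /andP[d1 d1'] /andP[d2 d2'].
  have r8 : o = r / 8 by [].
  set bb := b%:R * (r / 2) in Hz *.
  have Sj : S j om = B om (a + j%:R * v) by [].
  have lev : Num.floor ((S j om - S 0%N om - bb) / r) = z.
    apply: floor_def; rewrite ler_pdivlMr// ltr_pdivrMr// intrD mulrDl mul1r.
    by rewrite S0 Sj [z%:~R * r]mulrC; lra.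
  exists j => /=; first by rewrite ltnS.
  split; last first.
    split => /=; first by rewrite lev S0 Sj; lra.
    move=> l /andP[jl lq]; rewrite lev S0.
    suff : B om t <= S l om by move=> hl; lra.
    rewrite /S (_ : a + l%:R * v = t + (a + l%:R * v - t)); last by ring.
    have l1 : l%:R * v <= 3 * h.
      by rewrite -qv mulrA -natrM ler_pM2r// ler_nat.
    have l2 : j%:R * v <= l%:R * v by rewrite ler_pM2r// ler_nat.
    have := tmin (a + l%:R * v - t); rewrite -/h => /(_ _)[]//.
    by apply/andP; split; [clear Hz; lra|clear Hz; lra].
  move=> l /andP[nl ln]; have [->|lj] := eqVneq l (n + j)%N; first by clear Hz; lra.
  have lt_ : B om (t + 1) <= S l om.
    have l1 : 1 - h <= l%:R * v.
      rewrite -[X in X - _]nv -qv -mulrBl -natrB; last by nlia.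
      by rewrite ler_pM2r// ler_nat.
    have l2 : a + l%:R * v <= t + 1.
      have [ln'|ln'] := leqP n l.
        have h' : a + (l - n)%:R * v <= t.
          by apply: (lt_next_index v0 at_); rewrite -/j; nlia.
        by move: h'; rewrite natrB// mulrBl nv; clear Hz; lra.
      have : l%:R * v <= n%:R * v by rewrite ler_pM2r// ler_nat ltnW.
      by rewrite nv; clear Hz; lra.
    rewrite /S (_ : a + l%:R * v = t + 1 - (t + 1 - (a + l%:R * v))); last by ring.
    have := tmin (t + 1 - (a + l%:R * v)); rewrite -/h => /(_ _)[]//.
    by apply/andP; split; [clear Hz; lra|clear Hz; lra].
  by clear Hz; lra.
apply: le_trans (pr_le P mE _ sub) _.
  by apply: measurableU => //; exact: measurableU.
apply: (@le_trans _ _ (pr P w + pr P (Hit (false%:R * (r / 2))) +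
    pr P (Hit (true%:R * (r / 2))))).
  apply: le_trans (prU_le _ _ _) _ => //; first exact: measurableU.
  by rewrite lerD2r; exact: prU_le.
have K0' : 0 < K%:R :> R by rewrite ltr0n.
rewrite mulrDl addrA; apply: lerD; first apply: lerD => //.
  by rewrite ler_pdivlMr// mulrC; exact: main.
by rewrite ler_pdivlMr// mulrC; exact: main.
Qed.

End two_sided_null_event.

(** * Events in the path space *)

Section C01_topology.
Context (R : realType).

Lemma C01_ball (f g : C01 R) (e : R) : 0 < e -> ball f e g ->
  forall u : R, `|f u - g u| < e.
Proof.
move=> e0 fg u; pose x_ : option (@itv01 R) := 'oinv_set_val u.
have E (h : C01 R) : h u = oapp (set_val h) 0 x_ by [].
rewrite !E; case: x_ {E} => [x|] /=.
  have H : fct_ball (set_val f) e (set_val g) := fg.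
  exact: (H x).
by rewrite subrr normr0.
Qed.

(** The factor [2] leaves room for differences of two evaluations. *)
Lemma C01_lipschitz_continuous (psi : C01 R -> R) :
  (forall (f g : C01 R) (e : R), 0 < e -> (forall u : R, `|f u - g u| < e) ->
     `|psi f - psi g| <= 2 * e) -> continuous psi.
Proof.
move=> H f; have FF : Filter (nbhs f) := nbhs_filter f.
apply/cvgrPdist_lt => e e0.
have e40 : 0 < e / 4 by lra.
apply: filterS (nbhsx_ballx f (e / 4) e40) => g fg /=.
apply: (@le_lt_trans _ _ (2 * (e / 4))); last by lra.
by apply: H => //; exact: C01_ball.
Qed.

Lemma C01_eval_continuous (u : R) : continuous (fun f : C01 R => f u).
Proof.
apply: C01_lipschitz_continuous => f g e e0 /(_ u) fg.
by apply: ltW (lt_trans fg _); lra.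
Qed.

Lemma C01_closed_measurable (A : set (C01 R)) : closed A -> measurable A.
Proof.
move=> cA; rewrite -[A]setCK; apply: measurableC.
by apply: sub_sigma_algebra; exact: closed_openC.
Qed.

Lemma C01_closed_ge (u c : R) : closed [set f : C01 R | c <= f u].
Proof.
have -> : [set f : C01 R | c <= f u] = (fun f : C01 R => f u) @^-1` [set x | c <= x] by [].
apply: preimage_closed; last exact: closed_ge.
by move=> f _; exact: C01_eval_continuous.
Qed.

Lemma C01_closed_ge_eval (u u' : R) : closed [set f : C01 R | f u' <= f u].
Proof.
have -> : [set f : C01 R | f u' <= f u] =
    (fun f : C01 R => f u - f u') @^-1` [set x | 0 <= x].
  by apply/seteqP; split => f /=; rewrite subr_ge0.
apply: preimage_closed; last exact: closed_ge.
move=> f _; move: f; apply: C01_lipschitz_continuous => f g e e0 fg.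
have := fg u; have := fg u'.
by rewrite !ltr_norml ler_norml => /andP[? ?] /andP[? ?]; lra.
Qed.

Lemma C01_closed_eq (u c : R) : closed [set f : C01 R | f u = c].
Proof.
have -> : [set f : C01 R | f u = c] = (fun f : C01 R => f u) @^-1` [set c] by [].
apply: preimage_closed; last exact: closed_eq.
by move=> f _; exact: C01_eval_continuous.
Qed.

Definition ends_at_min (lambda : R) : set (C01 R) :=
  [set f | f 1 = lambda /\ forall u : R, 0 <= u <= 1 -> lambda <= f u].

Lemma measurable_ends_at_min lambda : measurable (ends_at_min lambda).
Proof.
apply: C01_closed_measurable.
have -> : ends_at_min lambda = [set f : C01 R | f 1 = lambda] `&`
    \bigcap_(u in [set u : R | 0 <= u <= 1]) [set f : C01 R | lambda <= f u].
  by [].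
apply: closedI; first exact: C01_closed_eq.
by apply: closed_bigI => u _; exact: C01_closed_ge.
Qed.

Definition min_at_both_ends (eps : R) : set (C01 R) :=
  [set f | forall u : R, 0 <= u <= eps -> 0 <= f u /\ f 1 <= f (1 - u)].

Lemma measurable_min_at_both_ends eps : measurable (min_at_both_ends eps).
Proof.
apply: C01_closed_measurable.
have -> : min_at_both_ends eps = \bigcap_(u in [set u : R | 0 <= u <= eps])
    ([set f : C01 R | 0 <= f u] `&` [set f : C01 R | f 1 <= f (1 - u)]).
  by [].
apply: closed_bigI => u _; apply: closedI; first exact: C01_closed_ge.
exact: C01_closed_ge_eval.
Qed.

Lemma le_of_dyadic (F G : R -> R) (L : R) : continuous F -> continuous G ->
  (forall k i, dyadic R k i <= L -> F (dyadic R k i) <= G (dyadic R k i)) ->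
  forall u : R, 0 <= u <= L -> F u <= G u.
Proof.
move=> cF cG H u /andP[u0 uL].
have cFu : F (dyadic_floor k u) @[k --> \oo] --> F u.
  by apply: (cvg_comp _ _ (cvg_dyadic_floor u0)); exact: cF.
have cGu : G (dyadic_floor k u) @[k --> \oo] --> G u.
  by apply: (cvg_comp _ _ (cvg_dyadic_floor u0)); exact: cG.
apply: (ler_cvg_to cFu cGu); apply: nearW => k; apply: H.
by apply: le_trans uL; have /andP[] := dyadic_floor_itv k u0.
Qed.

End C01_topology.

Section measurable_path_events.
Context (R : realType) d (Om : measurableType d) (X : Om -> C01 R).
Hypothesis mX : forall u : R, 0 <= u <= 1 -> measurable_fun setT (fun om => X om u).

Let cX (om : Om) : continuous (X om \o @clamp R).
Proof. exact: C01_clamp_continuous. Qed.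

Let measurable_forall (Q : R -> set Om) (L : R) :
  (forall u : R, 0 <= u <= L -> measurable (Q u)) ->
  measurable [set om | forall k i, dyadic R k i <= L -> Q (dyadic R k i) om].
Proof.
move=> mQ.
have -> : [set om | forall k i, dyadic R k i <= L -> Q (dyadic R k i) om] =
    \bigcap_k \bigcap_(i in [set i | dyadic R k i <= L]) Q (dyadic R k i).
  apply/seteqP; split => om H k; first by move=> _ i; exact: H.
  by move=> i; exact: (H k Logic.I).
apply: bigcapT_measurable => k; apply: bigcap_measurableType => i /= iL.
by apply: mQ; rewrite dyadic_ge0.
Qed.

(** The hypothesis on [X] concerns evaluations only, so the event is rewritten with dyadic times, by
    continuity of the paths. *)
Lemma measurable_preimage_ends_at_min lambda :
  measurable (X @^-1` ends_at_min lambda).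
Proof.
have -> : X @^-1` ends_at_min lambda = [set om | X om 1 = lambda] `&`
    [set om | forall k i, dyadic R k i <= 1 -> lambda <= X om (dyadic R k i)].
  apply/seteqP; split => om [H1 H]; split => //.
    by move=> k i ki; apply: H; rewrite dyadic_ge0.
  move=> u u01.
  have := @le_of_dyadic R (cst lambda) (X om \o @clamp R) 1 (@cst_continuous _ _ _) (@cX om).
  move=> /(_ _ u u01) /=; rewrite clamp_id//; apply => k i ki.
  by rewrite /= clamp_id ?H ?dyadic_ge0.
apply: measurableI.
  rewrite (_ : [set om | X om 1 = lambda] = (fun om => X om 1) @^-1` [set lambda])//.
  by rewrite -[X in measurable X]setTI; apply: mX => //; rewrite ler01 lexx.
apply: (@measurable_forall (fun u => [set om | lambda <= X om u])) => u u01.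
by apply: measurable_set_ler => //; exact: mX.
Qed.

Lemma measurable_preimage_min_at_both_ends eps : 0 <= eps <= 1 ->
  measurable (X @^-1` min_at_both_ends eps).
Proof.
move=> /andP[eps0 eps1].
have -> : X @^-1` min_at_both_ends eps =
    [set om | forall k i, dyadic R k i <= eps ->
       0 <= X om (dyadic R k i) /\ X om 1 <= X om (1 - dyadic R k i)].
  apply/seteqP; split => om H.
    by move=> k i ki; apply: H; rewrite dyadic_ge0.
  move=> u ue; have u01 : 0 <= u <= 1 by lra.
  have v01 : 0 <= 1 - u <= 1 by lra.
  have d01 k i : dyadic R k i <= eps -> 0 <= dyadic R k i <= 1.
    by move=> h; rewrite dyadic_ge0/=; lra.
  have d01' k i : dyadic R k i <= eps -> 0 <= 1 - dyadic R k i <= 1.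
    by move=> /d01; lra.
  have cr : continuous ((X om \o @clamp R) \o (fun u => 1 - u)).
    move=> x; apply: continuous_comp; last exact: (@cX om).
    by apply: cvgB; [exact: cvg_cst|exact: cvg_id].
  split.
    have := @le_of_dyadic R (cst 0) (X om \o @clamp R) eps (@cst_continuous _ _ _) (@cX om).
    move=> /(_ _ u ue) /=; rewrite clamp_id//; apply => k i ki.
    by rewrite /= clamp_id ?d01//; have [] := H k i ki.
  have := @le_of_dyadic R (cst (X om 1)) _ eps (@cst_continuous _ _ _) cr.
  move=> /(_ _ u ue) /=; rewrite clamp_id//; apply => k i ki.
  by rewrite /= clamp_id ?d01'//; have [] := H k i ki.
apply: (@measurable_forall (fun u => [set om | 0 <= X om u /\ X om 1 <= X om (1 - u)])) => u ue.
have u01 : 0 <= u <= 1 by lra.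
have v01 : 0 <= 1 - u <= 1 by lra.
have m1 : measurable_fun setT (fun om => X om 1) by apply: mX; rewrite ler01 lexx.
apply: (measurableI [set om | 0 <= X om u] [set om | X om 1 <= X om (1 - u)]).
  by apply: measurable_set_ler => //; exact: mX.
by apply: measurable_set_ler => //; exact: mX.
Qed.

End measurable_path_events.

(** * Brownian motion seen from a random time *)

Section shifted_path.
Context (R : realType) d (Om : measurableType d) (P : probability Om R).
Variables (B : Om -> cpath R) (hB : brownian_motion P B).
Variables (T : Om -> {nonneg R}) (mT : random_time T).
Local Notation X := (fun om => shift01 (B om) (T om)).

Lemma shift01E (w : cpath R) (t : {nonneg R}) u : 0 <= u <= 1 ->
  shift01 w t u = w (t%:num + u) - w t%:num.
Proof. by move=> u01; rewrite mkC01E// inE /itv01/= in_itv. Qed.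

Lemma measurable_shift01 u : 0 <= u <= 1 -> measurable_fun setT (fun om => X om u).
Proof.
move=> u01; under eq_fun do rewrite shift01E//.
have mB := bm_measurable hB.
apply: measurable_funB.
  apply: (measurable_at_random_time mB (T := fun om => (T om)%:num + u)).
    by apply: measurable_funD => //; exact: mT.
  by move=> om; rewrite addr_ge0//; case/andP: u01.
by apply: (measurable_at_random_time mB (T := fun om => (T om)%:num)).
Qed.

(** Countably many intervals of length [h] carry all values of [T], so estimates uniform over all
    times of one interval suffice, whatever the dependence of [T] on the path. *)
Lemma null_by_localization (E : set Om) (h : R) : 0 < h -> measurable E ->
  (forall i : nat, P (E `&` [set om | i%:R * h <= (T om)%:num < i%:R * h + h]) = 0%E) ->
  P E = 0%E.
Proof.
move=> h0 mE H.
have mI i : measurable [set om | i%:R * h <= (T om)%:num < i%:R * h + h].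
  rewrite (_ : [set _ | _] = [set om | i%:R * h <= (T om)%:num] `&`
      [set om | (T om)%:num < i%:R * h + h]).
    by apply: measurableI; [exact: measurable_set_ler|exact: measurable_set_ltr].
  by apply/seteqP; split => om /= => [/andP|] [->].
apply/eqP; rewrite eq_le measure_ge0 andbT.
have -> : E = \bigcup_i (E `&` [set om | i%:R * h <= (T om)%:num < i%:R * h + h]).
  apply/seteqP; split => om; last by move=> [i _ []].
  move=> Eom; exists (Num.truncn ((T om)%:num / h)) => //; split => //=.
  have x0 : 0 <= (T om)%:num / h by rewrite divr_ge0// ltW.
  have /andP[l u] := truncn_itv x0.
  rewrite ler_pdivlMr// in l; rewrite ltr_pdivrMr// -natr1 mulrDl mul1r in u.
  by rewrite l.
have mEI i : measurable (E `&` [set om | i%:R * h <= (T om)%:num < i%:R * h + h]).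
  exact: measurableI.
apply: le_trans (measure_sigma_subadditive _ mEI (bigcupT_measurable _ mEI) _) _ => //.
rewrite le_eqVlt; apply/orP; left; apply/eqP.
by apply: eseries0 => i _ _; exact: H.
Qed.

End shifted_path.

Section shifted_path_null_events.
Context (R : realType) d (Om : measurableType d) (P : probability Om R).
Variables (B : Om -> cpath R) (hB : brownian_motion P B).
Variables (T : Om -> {nonneg R}) (mT : random_time T).
Local Notation X := (fun om => shift01 (B om) (T om)).

Lemma shift01_ends_at_min_null lambda : P (X @^-1` ends_at_min lambda) = 0%E.
Proof.
have mE : measurable (X @^-1` ends_at_min lambda).
  by apply: measurable_preimage_ends_at_min; exact: (measurable_shift01 hB mT).
apply: (@null_by_localization _ _ _ P T mT _ 8^-1) => // i.
have i8 : 0 <= i%:R * 8^-1 :> R by rewrite mulr_ge0.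
apply: (bridge_minimum_null hB (lambda := lambda) i8).
  apply: measurableI => //.
  rewrite (_ : [set _ | _] = [set om | i%:R * 8^-1 <= (T om)%:num] `&`
      [set om | (T om)%:num < i%:R * 8^-1 + 8^-1]).
    by apply: measurableI; [exact: measurable_set_ler|exact: measurable_set_ltr].
  by apply/seteqP; split => om /= => [/andP|] [->].
move=> om [[/= X1 Xmin] iT]; exists (T om)%:num; split => //.
  by move: X1; rewrite shift01E// ler01 lexx.
by move=> u u01; have := Xmin u u01; rewrite shift01E.
Qed.

Lemma shift01_min_at_both_ends_null e :
  P (X @^-1` min_at_both_ends ((2 ^+ e)^-1)) = 0%E.
Proof.
have e01 : 0 <= ((2 : R) ^+ e)^-1 <= 1.
  by rewrite invr_ge0 exprn_ge0//= invf_le1 ?exprn_gt0// exprn_ege1//; lra.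
have mE : measurable (X @^-1` min_at_both_ends ((2 ^+ e)^-1)).
  by apply: measurable_preimage_min_at_both_ends => //; exact: (measurable_shift01 hB mT).
have h0 : 0 < (2 ^+ e.+2)^-1 :> R by rewrite invr_gt0 exprn_gt0.
(* Intervals of length [h = 2^-(e+2)] make [4 h = 2^-e], the range on which both minima are known,
   and give an exponent of at least [2]. *)
apply: (@null_by_localization _ _ _ P T mT _ _ h0) => // i.
have i8 : 0 <= i%:R * (2 ^+ e.+2)^-1 :> R by rewrite mulr_ge0// ltW.
apply: (@two_sided_minimum_null _ _ _ _ _ hB e.+2 _ _ _ i8) => //.
  apply: measurableI => //.
  rewrite (_ : [set _ | _] = [set om | i%:R * (2 ^+ e.+2)^-1 <= (T om)%:num] `&`
      [set om | (T om)%:num < i%:R * (2 ^+ e.+2)^-1 + (2 ^+ e.+2)^-1]).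
    by apply: measurableI; [exact: measurable_set_ler|exact: measurable_set_ltr].
  by apply/seteqP; split => om /= => [/andP|] [->].
move=> om [/= Xmin iT]; exists (T om)%:num; split => // u.
have -> : 4 * (2 ^+ e.+2)^-1 = (2 ^+ e)^-1 :> R.
  have p0 : (2 ^+ e : R) != 0 by rewrite expf_neq0.
  by rewrite !exprS; field.
move=> ue; have [h1 h2] := Xmin u ue.
have u01 : 0 <= u <= 1 by lra.
have v01 : 0 <= 1 - u <= 1 by lra.
rewrite !shift01E ?ler01 ?lexx// in h1 h2.
by split; [|rewrite -addrA]; lra.
Qed.

End shifted_path_null_events.

(** * Excursion, bridge and Vervaat paths *)

Section path_transforms.
Context (R : realType).
Implicit Types (w : cpath R) (f : C01 R).

Lemma reflected_bridge_ends_at_min w : ends_at_min 0 (reflected_bridge w).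
Proof.
have E u : 0 <= u <= 1 -> reflected_bridge w u = `|brownian_bridge0_fun w u|.
  by move=> u01; rewrite mkC01E// inE /itv01/= in_itv.
split => [|u u01]; last by rewrite E.
by rewrite E ?ler01 ?lexx// /brownian_bridge0_fun mul1r cpath_g1 mulr0 normr0.
Qed.

(** The infimum of the empty set is [0 <= g1 w], so the hypothesis guarantees a zero after time
    [1]. *)
Lemma cpath_d1 w : g1 w < d1 w -> w (d1 w) = 0.
Proof.
move=> gd; set D := [set t | 1 < t /\ w t = 0].
have [D0|/set0P D0] := eqVneq D set0.
  by move: gd; rewrite /d1 -/D D0 inf0 ltNge g1_ge0.
have hD : has_inf D by split => //; exists 1 => t [/ltW].
have d1_ge : 1 <= d1 w by apply: lb_le_inf => // t [/ltW].
have d10 : 0 <= d1 w by lra.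
apply/eqP/negPn/negP => wd0.
have : (w \o Num.max 0) x @[x --> d1 w] --> (w \o Num.max 0) (d1 w).
  exact: cpath_max0_continuous.
rewrite /= (max_r d10) => /cvgrPdist_lt /(_ `|w (d1 w)|).
rewrite normr_gt0 => /(_ wd0) /nbhs_ballP[e /= e0 He].
have [t [t1 wt0] gt] := inf_adherent e0 hD.
have tg : d1 w <= t by apply: (ge_inf hD.2); split.
have t0 : 0 <= t by lra.
suff tge : ball (d1 w) e t.
  by have := He t tge; rewrite /= (max_r t0) wt0 subr0 ltxx.
by rewrite /ball /= ltr_norml; move: gt; rewrite -/(d1 w); lra.
Qed.

Lemma excursion_ends_at_min w : ends_at_min 0 (excursion w).
Proof.
have E u : 0 <= u <= 1 -> excursion w u = excursion_fun w u.
  by move=> u01; rewrite mkC01E// inE /itv01/= in_itv.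
split => [|u u01]; last by rewrite E// mulr_ge0 ?invr_ge0.
rewrite E ?ler01 ?lexx// /excursion_fun mul1r.
(* In the degenerate case the square root and its inverse are [0], and the path is zero. *)
have [dg|gd] := leP (d1 w) (g1 w); first by rewrite ler0_sqrtr ?subr_le0// invr0 mul0r.
by rewrite (addrC (g1 w)) subrK cpath_d1// normr0 mulr0.
Qed.

Let argmin_set f : set R :=
  [set t | 0 <= t <= 1 /\ forall s, 0 <= s <= 1 -> f t <= f s].

Let argmin_set0 f : argmin_set f !=set0.
Proof.
have [] := @EVT_min R f 0 1 ler01; first exact: C01_cont.
by move=> c; rewrite in_itv => c01 H; exists c; split => // s s01; apply: H; rewrite in_itv.
Qed.

Let argmin_set_inf f : has_inf (argmin_set f).
Proof. by split; [exact: argmin_set0|exists 0 => t [/andP[]]]. Qed.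

Lemma argmin_min f s : 0 <= s <= 1 -> f (argmin f) <= f s.
Proof.
move=> s01; have /andP[a0 a1] := argmin_in01 f.
rewrite leNgt; apply/negP => fsa.
have : (f \o @clamp R) x @[x --> argmin f] --> (f \o @clamp R) (argmin f).
  exact: C01_clamp_continuous.
rewrite /= clamp_id ?a0// => /cvgrPdist_lt /(_ (f (argmin f) - f s)).
rewrite subr_gt0 => /(_ fsa) /nbhs_ballP[e /= e0 He].
have [t [t01 tmin] te] := inf_adherent e0 (argmin_set_inf f).
have at_ : argmin f <= t by apply: (ge_inf (argmin_set_inf f).2); split.
have tge : ball (argmin f) e t.
  by rewrite /ball /= ltr_norml; move: te; rewrite -/(argmin f); lra.
have := He t tge; rewrite /= clamp_id// ltr_norml => /andP[_].
by have := tmin s s01; lra.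
Qed.

(** The event no longer mentions the leftmost minimizer: it compares the minimum over [[0, s]] with
    all values, which is accessible to countably many evaluations. *)
Lemma argmin_leP f s : 0 <= s <= 1 ->
  argmin f <= s <-> exists2 t, 0 <= t <= s & forall u, 0 <= u <= 1 -> f t <= f u.
Proof.
move=> s01; have /andP[a0 a1] := argmin_in01 f; split.
  move=> as_; exists (argmin f); first by rewrite a0.
  by move=> u; exact: argmin_min.
move=> [t t0s tmin]; have /andP[_ ts] := t0s; apply: le_trans (ts).
by apply: (ge_inf (argmin_set_inf f).2); split => //; lra.
Qed.

(** One formula for both branches: the clamped term that is out of range equals [f 0 = 0] or
    [f 1]. *)
Lemma vervaatE f u : 0 <= u <= 1 ->
  vervaat f u = f (clamp (argmin f + u)) + f (clamp (argmin f - 1 + u)) - f (argmin f).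
Proof.
move=> u01; have /andP[t0 t1] := argmin_in01 f.
rewrite mkC01E; last by rewrite inE /itv01/= in_itv.
rewrite /vervaat_fun; case: ifPn => [ut|]; last rewrite -ltNge => ut.
  rewrite clamp_id; last by lra.
  have -> : clamp (argmin f - 1 + u) = 0.
    by rewrite /clamp max_l// ge_min; apply/orP; right; lra.
  by rewrite C01_0 addr0.
have -> : clamp (argmin f + u) = 1.
  by rewrite /clamp min_l; [rewrite max_r|lra].
by rewrite clamp_id; [rewrite [f 1 + _]addrC|lra].
Qed.

Lemma vervaat1 f : vervaat f 1 = f 1.
Proof.
have /andP[t0 t1] := argmin_in01 f.
rewrite vervaatE ?ler01 ?lexx// subrK (clamp_id (t := argmin f)) ?t0//.
have -> : clamp (argmin f + 1) = 1.
  by rewrite /clamp min_l; [rewrite max_r|lra].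
by rewrite addrK.
Qed.

(** The first piece is nonnegative, hence above [f 1]; the second is [f 1] plus a nonnegative excess
    over the minimum. *)
Lemma vervaat_ends_at_min f : f 1 <= 0 -> ends_at_min (f 1) (vervaat f).
Proof.
move=> f1; split; first exact: vervaat1.
move=> u u01; have /andP[t0 t1] := argmin_in01 f.
have am v : 0 <= v <= 1 -> f (argmin f) <= f v by exact: argmin_min.
have am' v : f (argmin f) <= f (clamp v).
  by apply: am; have := @clamp_in R v; rewrite /itv01/= in_itv.
rewrite vervaatE//; have [h|h] := leP (argmin f + u) 1.
  have -> : clamp (argmin f - 1 + u) = 0.
    by rewrite /clamp max_l// ge_min; apply/orP; right; lra.
  by rewrite C01_0; have := am' (argmin f + u); lra.
have -> : clamp (argmin f + u) = 1.
  by rewrite /clamp min_l; [rewrite max_r|lra].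
by have := am' (argmin f - 1 + u); lra.
Qed.

Lemma brownian_bridge1 w lambda : brownian_bridge w lambda 1 = lambda.
Proof.
rewrite mkC01E; last by rewrite inE /itv01/= in_itv/= ler01 lexx.
by rewrite /brownian_bridge_fun mul1r subrr add0r mulr1.
Qed.

Lemma vervaat_min_at_both_ends f eps : eps <= argmin f -> eps <= 1 - argmin f ->
  min_at_both_ends eps (vervaat f).
Proof.
move=> e1 e2 u ue; have /andP[t0 t1] := argmin_in01 f.
have am v : 0 <= v <= 1 -> f (argmin f) <= f v by exact: argmin_min.
split.
  rewrite vervaatE; last by lra.
  rewrite clamp_id; last by lra.
  have -> : clamp (argmin f - 1 + u) = 0.
    by rewrite /clamp max_l// ge_min; apply/orP; right; lra.
  by rewrite C01_0; have := am (argmin f + u) ltac:(lra); lra.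
rewrite vervaat1 vervaatE; last by lra.
have -> : clamp (argmin f + (1 - u)) = 1.
  by rewrite /clamp min_l; [rewrite max_r|lra].
rewrite clamp_id; last by lra.
by have := am (argmin f - 1 + (1 - u)) ltac:(lra); lra.
Qed.

Lemma restrict01E w u : 0 <= u <= 1 -> restrict01 w u = w u.
Proof. by move=> u01; rewrite mkC01E// inE /itv01/= in_itv. Qed.

End path_transforms.

Section measurability_from_sublevels.
Context (R : realType) d (T : measurableType d) (f : T -> R).

Lemma measurable_fun_of_le : (forall a, measurable [set x | f x <= a]) ->
  measurable_fun setT f.
Proof.
move=> H; apply: (measurability _ (RGenOInfty.measurableE R)) => //.
move=> /= _ [_ [a ->] <-]; rewrite setTI.
rewrite (_ : f @^-1` _ = ~` [set x | f x <= a]); first exact: measurableC.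
by apply/seteqP; split => x /=; rewrite in_itv/= andbT ltNge => /negP.
Qed.

Lemma measurable_fun_of_lt : (forall a, measurable [set x | f x < a]) ->
  measurable_fun setT f.
Proof.
move=> H; apply: (measurability _ (RGenCInfty.measurableE R)) => //.
move=> /= _ [_ [a ->] <-]; rewrite setTI.
rewrite (_ : f @^-1` _ = ~` [set x | f x < a]); first exact: measurableC.
by apply/seteqP; split => x /=; rewrite in_itv/= andbT leNgt => /negP.
Qed.

End measurability_from_sublevels.

Section measurable_argmin.
Context (R : realType) d (Om : measurableType d) (X : Om -> C01 R).
Hypothesis mX : forall u : R, 0 <= u <= 1 -> measurable_fun setT (fun om => X om u).

(** The minimum over [[0, s]] need not be attained at a dyadic time, hence the slack [1 / (n + 1)];
    compactness recovers a minimizer. *)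
Let argmin_leE s : 0 <= s <= 1 -> [set om | argmin (X om) <= s] =
  \bigcap_k \bigcap_(i in [set i | dyadic R k i <= 1]) \bigcap_n
  \bigcup_k' \bigcup_(i' in [set i' | dyadic R k' i' <= s])
    [set om | X om (dyadic R k' i') <= X om (dyadic R k i) + n.+1%:R^-1].
Proof.
move=> s01; apply/seteqP; split => om /=.
  move=> /(argmin_leP (X om) s01) [t /andP[t0 ts] tmin] k _ i /= i1 n _.
  have c : (X om \o @clamp R) (dyadic_floor k t) @[k --> \oo] --> (X om \o @clamp R) t.
    apply: (cvg_comp _ _ (cvg_dyadic_floor t0)).
    exact: C01_clamp_continuous.
  move/cvgrPdist_lt : c => /(_ n.+1%:R^-1); rewrite invr_gt0 ltr0n => /(_ isT).
  move=> [k0 _ /(_ k0 (leqnn _))] /=.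
  have /andP[dt _] := dyadic_floor_itv k0 t0.
  have d0 : 0 <= dyadic_floor k0 t by exact: dyadic_ge0.
  rewrite !clamp_id; [|lra|lra].
  rewrite ltr_norml => /andP[h _].
  exists k0 => //; exists (Num.truncn (t * 2 ^+ k0)) => /=; first exact: le_trans ts.
  have := tmin (dyadic R k i); rewrite dyadic_ge0 i1 => /(_ isT).
  move=> tm; have h' : X om (dyadic_floor k0 t) <= X om t + n.+1%:R^-1.
    by move: h; set y := n.+1%:R^-1 : R => h; lra.
  by apply: le_trans h' _; rewrite lerD2r.
move=> H; apply/(argmin_leP (X om) s01).
have cX : {within `[0, s], continuous (X om \o @clamp R)}.
  exact/continuous_subspaceT/C01_clamp_continuous.
have /andP[s0 s1] := s01.
have [c] := EVT_min s0 cX; rewrite in_itv/= => /andP[c0 cs] cmin.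
exists c; first by rewrite c0.
move=> u u01.
have cu := @C01_clamp_continuous R (X om).
have := @le_of_dyadic R (cst (X om c)) _ 1 (@cst_continuous _ _ _) cu.
move=> /(_ _ u u01); rewrite /= (clamp_id u01); apply => k i i1.
rewrite clamp_id ?dyadic_ge0//; apply/ler_addgt0Pr => eps eps0.
have [n neps] : exists n : nat, n.+1%:R^-1 < eps.
  exists (Num.truncn eps^-1); rewrite -[ltRHS]invrK ltf_pV2 ?posrE ?invr_gt0//.
  by have /andP[] := truncn_itv (ltW (ltac:(by rewrite invr_gt0) : 0 < eps^-1)).
have [k' _ [i' /= i's h]] := H k Logic.I i i1 n Logic.I.
have := cmin (dyadic R k' i'); rewrite in_itv/= dyadic_ge0 i's => /(_ isT).
rewrite !clamp_id; [|by rewrite dyadic_ge0/=; lra|lra].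
move=> cm; apply: (le_trans cm); apply: (le_trans h).
by rewrite lerD2l ltW.
Qed.

Lemma measurable_argmin : measurable_fun setT (fun om => argmin (X om)).
Proof.
apply: measurable_fun_of_le => s.
have [s0|s0] := ltP s 0.
  rewrite (_ : [set _ | _] = set0)//; apply/seteqP; split => // om /= h.
  by have /andP[a0 _] := argmin_in01 (X om); lra.
have [s1|s1] := leP 1 s.
  rewrite (_ : [set _ | _] = setT)//; apply/seteqP; split => // om _ /=.
  by have /andP[_ a1] := argmin_in01 (X om); lra.
rewrite argmin_leE; last by lra.
apply: bigcapT_measurable => k; apply: bigcap_measurableType => i /= i1.
apply: bigcapT_measurable => n; apply: bigcupT_measurable => k'.
apply: bigcup_measurable => i' /= i's; apply: measurable_set_ler.
  by apply: mX; rewrite dyadic_ge0/=; lra.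
by apply: measurable_funD => //; apply: mX; rewrite dyadic_ge0.
Qed.

End measurable_argmin.

Section vervaat_of_brownian_motion.
Context (R : realType) d (Om : measurableType d) (P : probability Om R).
Variables (W : Om -> cpath R) (hW : brownian_motion P W).
Local Notation V := (fun om => vervaat (restrict01 (W om))).
Local Notation mW := (bm_measurable hW).

Let mrestrict u : 0 <= u <= 1 -> measurable_fun setT (fun om => restrict01 (W om) u).
Proof.
move=> u01; under eq_fun do rewrite restrict01E//.
by apply: mW; case/andP: u01.
Qed.

Lemma measurable_vervaat u : 0 <= u <= 1 -> measurable_fun setT (fun om => V om u).
Proof.
move=> u01; have mt := measurable_argmin mrestrict.
pose t om := argmin (restrict01 (W om)).
have c01 x : 0 <= @clamp R x <= 1 by have := @clamp_in R x; rewrite /itv01/= in_itv.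
have E om : V om u = W om (clamp (t om + u)) + W om (clamp (t om - 1 + u)) - W om (t om).
  by rewrite vervaatE// !restrict01E// argmin_in01.
under eq_fun do rewrite E.
have mc : measurable_fun setT (@clamp R).
  by apply: continuous_measurable_fun; exact: clamp_continuous.
have c0 x : 0 <= @clamp R x by have /andP[] := c01 x.
apply: measurable_funB.
  apply: measurable_funD.
    apply: (measurable_at_random_time mW (T := fun om => clamp (t om + u))) => //.
    by apply: (measurableT_comp mc); exact: measurable_funD.
  apply: (measurable_at_random_time mW (T := fun om => clamp (t om - 1 + u))) => //.
  by apply: (measurableT_comp mc); apply: measurable_funD => //; exact: measurable_funB.
apply: (measurable_at_random_time mW (T := t)) => // om.
by have /andP[] := argmin_in01 (restrict01 (W om)).
Qed.

Lemma gauss_itv_gt0 (t a b : R) : 0 < t -> a < b -> 0 < gauss t `[a, b]%classic.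
Proof.
move=> t0 ab; pose M := `|a| + `|b|.
have Ma : - M <= a by have := ler_norm (- a); rewrite normrN /M; have := normr_ge0 b; lra.
have bM : b <= M by have := ler_norm b; rewrite /M; have := normr_ge0 a; lra.
apply: lt_le_trans (gauss_itv_lb t0 (ltW ab) Ma bM).
rewrite mulr_gt0 ?expR_gt0// mulr_gt0 ?subr_gt0//.
by rewrite divr_gt0 ?sqrtr_gt0// kap_gt0.
Qed.

(** The path descends by at least [1] over the first half and rises by at least [1] over the second,
    so neither endpoint is a minimizer. *)
Lemma argmin_interior_gt0 : exists D : set Om, [/\ measurable D, 0 < pr P D &
  forall om, D om -> 0 < argmin (restrict01 (W om)) < 1].
Proof.
have h0 : 0 < 2^-1 :> R by rewrite invr_gt0.
have gS := brownian_walk hW 2 (lexx 0) h0.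
set S := fun i om => _ in gS.
have Sadd i om : S i om = W om (0 + i%:R * 2^-1) by [].
have mS i j : (i <= j <= 2)%N -> past_fun 2 (fun i om => S i.+1 om - S i om)
     (fun l => (i <= l < j)%N) (fun om => S j om - S i om).
  by move=> ij; apply: past_fun_increment.
pose D1 := [set om | -2 <= S 1%N om - S 0%N om <= -1].
pose D2 := [set om | 1 <= S 2%N om - S 1%N om <= 2].
have itvE i j (a b : R) : [set om | a <= S j om - S i om <= b] =
    [set om | a <= S j om - S i om] `&` [set om | S j om - S i om <= b].
  by apply/seteqP; split => om /= => [/andP|] [->].
have pD i j (a b : R) : (i <= j <= 2)%N -> past 2 (fun i om => S i.+1 om - S i om)
     (fun l => (i <= l < j)%N) [set om | a <= S j om - S i om <= b].
  move=> ij; rewrite itvE; apply: pastI; apply: past_le; try exact: past_fun_cst.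
    exact: mS.
  exact: mS.
have p1 : past 2 _ (fun l => (0 <= l < 1)%N) D1 := pD 0%N 1%N _ _ isT.
have p2 : past 2 _ (fun l => (1 <= l < 2)%N) D2 := pD 1%N 2%N _ _ isT.
exists (D1 `&` D2); split.
- by apply: measurableI; apply: (past_measurable (gw_measurable gS)); [exact: p1|exact: p2].
- rewrite (past_indep (gw_measurable gS) (gw_indep gS) _ p1 p2); last by move=> i; lia.
  rewrite /D1 /D2 !(pr_increment_itv gS)//.
  by rewrite mulr_gt0// gauss_itv_gt0 ?mulr_gt0// ?ltr0n//; lra.
move=> om [/= /andP[_ d1] /andP[d2 _]].
have /andP[a0 a1] := argmin_in01 (restrict01 (W om)).
set f := restrict01 (W om) in a0 a1 *.
have f0 : f 0 = S 0%N om by rewrite restrict01E ?ler01 ?lexx// Sadd mul0r addr0.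
have f1 : f 1 = S 2%N om.
  by rewrite restrict01E ?ler01 ?lexx// Sadd add0r mulfV.
have fh : f 2^-1 = S 1%N om by rewrite restrict01E ?Sadd ?add0r ?mul1r//; lra.
have := @argmin_min R f 2^-1 ltac:(lra) => fm.
apply/andP; split; rewrite lt_neqAle ?a0 ?a1 andbT; apply/eqP => e.
  by move: fm; rewrite -e; lra.
by move: fm; rewrite e; lra.
Qed.

Lemma vervaat_min_at_both_ends_pos :
  ~ (forall e : nat, P (V @^-1` min_at_both_ends ((2 ^+ e)^-1)) = 0%E).
Proof.
move=> H; have [D [mD D0 HD]] := argmin_interior_gt0.
have mV e : measurable (V @^-1` min_at_both_ends ((2 ^+ e)^-1)).
  apply: measurable_preimage_min_at_both_ends; first exact: measurable_vervaat.
  by rewrite invr_ge0 exprn_ge0//= invf_le1 ?exprn_gt0// exprn_ege1//; lra.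
have sub : D `<=` \bigcup_e (V @^-1` min_at_both_ends ((2 ^+ e)^-1)).
  move=> om /HD /andP[a0 a1].
  have m0 : 0 < Num.min (argmin (restrict01 (W om))) (1 - argmin (restrict01 (W om))).
    by rewrite lt_min a0 subr_gt0.
  have [e /(_ e (leqnn _)) /ltW] := expV2_lt m0.
  rewrite le_min => /andP[e1 e2]; exists e => //.
  exact: vervaat_min_at_both_ends.
have h : (P D <= 0)%E.
  apply: le_trans (measure_sigma_subadditive P mV mD sub) _.
  by rewrite (eseries0 (fun e _ _ => H e)).
by move: h; rewrite (prE P mD) lee_fin leNgt D0.
Qed.

End vervaat_of_brownian_motion.

(** * First passage bridges *)

Section null_integrals.
Context (R : realType) d (T : measurableType d) (mu : {measure set T -> \bar R}).
Local Open Scope ereal_scope.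

Lemma null_of_integral_eq0 (D : set T) (f : T -> \bar R) : measurable D ->
  measurable_fun D f -> (forall x, D x -> 0 < f x) -> \int[mu]_(x in D) f x = 0 ->
  mu D = 0.
Proof.
move=> mD mf f0 If; have : \int[mu]_(x in D) `|f x| = 0.
  rewrite -[RHS]If; apply: eq_integral => x; rewrite inE => Dx.
  by rewrite gee0_abs// ltW// f0.
move=> /(ae_eq_integral_abs mu mD mf) [N [mN N0 HN]].
apply/eqP; rewrite eq_le measure_ge0 andbT -N0; apply: le_measure; rewrite ?inE//.
move=> x Dx; apply: HN => /= /(_ Dx) fx.
by have := f0 x Dx; rewrite fx ltxx.
Qed.

Lemma integral_eq0_of_null (f : T -> \bar R) (N : set T) : measurable_fun setT f ->
  (forall x, 0 <= f x) -> measurable N -> mu N = 0 -> (forall x, ~ N x -> f x = 0) ->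
  \int[mu]_x f x = 0.
Proof.
move=> mf f0 mN N0 HN.
have : \int[mu]_x `|f x| = 0.
  apply/(ae_eq_integral_abs mu measurableT mf); exists N; split => // x /= H.
  by apply: contrapT => /HN fx; apply: H.
by move=> <-; apply: eq_integral => x _; rewrite gee0_abs.
Qed.

End null_integrals.

Section clipping.
Context (R : realType).

(** Turns a strict inequality between continuous functionals into the positivity of a bounded
    continuous one, to which weak continuity applies. *)
Definition clip (x : R) : R := Num.min 1 (Num.max 0 x).

Lemma clip_itv x : 0 <= clip x <= 1.
Proof. by rewrite /clip le_min ler01 le_max lexx/= ge_min lexx. Qed.

Lemma clip_eq0 x : clip x = 0 <-> x <= 0.
Proof.
rewrite /clip; have [h|h] := leP x 0.
  by rewrite min_r ?ler01//; split.
split => //; rewrite /Num.min; case: ifP => _; first by move/eqP; rewrite oner_eq0.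
by move=> e; move: h; rewrite e ltxx.
Qed.

Lemma clip_lipschitz x y : `|clip x - clip y| <= `|x - y|.
Proof.
have mono a b : a <= b -> 0 <= clip b - clip a <= b - a.
  move=> ab; rewrite /clip.
  have E (z : R) : [\/ z <= 0 /\ Num.min 1 (Num.max 0 z) = 0,
      0 <= z <= 1 /\ Num.min 1 (Num.max 0 z) = z |
      1 <= z /\ Num.min 1 (Num.max 0 z) = 1].
    have [z0|z0] := leP z 0; first by apply: Or31; rewrite min_r ?ler01.
    have [z1|z1] := leP z 1; first by apply: Or32; split=> //; lra.
    by apply: Or33; split=> //; lra.
  by case: (E a) => -[ha ->]; case: (E b) => -[hb ->]; lra.
have [/mono h|/ltW /mono h] := leP x y.
  by rewrite distrC [leRHS]distrC !ger0_norm//; lra.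
by rewrite !ger0_norm//; lra.
Qed.

End clipping.

Section passage_times.
Context (R : realType) (lambda : R).
Local Notation tau := (passage_time lambda).
Implicit Type w : cpath R.

Let hits w := [set t : R | 0 <= t /\ w t < lambda].

Lemma passage_time_le w t : 0 <= t -> w t < lambda -> tau w <= t.
Proof. by move=> t0 wt; apply: ge_inf; [exists 0 => x []|split]. Qed.

Lemma passage_time_gt w t : 0 <= t < tau w -> lambda <= w t.
Proof.
move=> /andP[t0 tt]; rewrite leNgt; apply/negP => wt.
by have := passage_time_le t0 wt; rewrite leNgt tt.
Qed.

Lemma passage_time_adherent w e : 0 < tau w -> 0 < e ->
  exists2 t, tau w <= t < tau w + e & w t < lambda.
Proof.
move=> t0 e0; have [h0|/set0P h0] := eqVneq (hits w) set0.
  by move: t0; rewrite /passage_time -/(hits w) h0 inf0 ltxx.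
have hi : has_inf (hits w) by split => //; exists 0 => x [].
have [t [t_ge wt] te] := inf_adherent e0 hi.
by exists t => //; rewrite te andbT; exact: passage_time_le.
Qed.

(** The existence of a passage rules out the default value [0] of the infimum. *)
Lemma passage_time_ge w s : (exists2 t, 0 <= t & w t < lambda) ->
  (forall t, 0 <= t < s -> lambda <= w t) -> s <= tau w.
Proof.
move=> [t t0 wt] H; apply: lb_le_inf; first by exists t.
move=> x [x0 wx]; rewrite leNgt; apply/negP => xs.
by have := H x; rewrite x0 xs leNgt wx => /(_ isT).
Qed.

Lemma cpath_lt_dyadic w t : 0 <= t -> w t < lambda ->
  exists k, w (dyadic_floor k t) < lambda.
Proof.
move=> t0 wt; have := @cpath_cvg_dyadic R w t t0.
move/cvgrPdist_lt => /(_ (lambda - w t)); rewrite subr_gt0 => /(_ wt).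
move=> [k _ /(_ k (leqnn _))] /=; rewrite ltr_norml => /andP[h _].
by exists k; lra.
Qed.

Lemma measurable_passage_time d (Om : measurableType d) (W : Om -> cpath R) :
  (forall t : R, 0 <= t -> measurable_fun setT (fun om => W om t)) ->
  measurable_fun setT (fun om => tau (W om)).
Proof.
move=> mW; apply: measurable_fun_of_lt => a.
have tau_ge0 w : 0 <= tau w.
  have [h0|/set0P h0] := eqVneq (hits w) set0.
    by rewrite /passage_time -/(hits w) h0 inf0.
  by apply: lb_le_inf => // x [].
have [a0|a0] := leP a 0.
  rewrite (_ : [set _ | _] = set0)//; apply/seteqP; split => // om /= h.
  by have := tau_ge0 (W om); lra.
(* The second set consists of the paths that never pass below [lambda]: their passage time is the
   default [0], and [0 < a]. *)
have -> : [set om | tau (W om) < a] =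
   (\bigcup_k \bigcup_(i in [set i | dyadic R k i < a])
     [set om | W om (dyadic R k i) < lambda]) `|`
   (\bigcap_k \bigcap_i [set om | lambda <= W om (dyadic R k i)]).
  apply/seteqP; split => om /=.
    move=> ta; have [h0|/set0P h0] := eqVneq (hits (W om)) set0.
      right => k _ i _ /=; rewrite leNgt; apply/negP => wl.
      have : hits (W om) (dyadic R k i) by split => //; exact: dyadic_ge0.
      by rewrite h0.
    have hi : has_inf (hits (W om)) by split => //; exists 0 => x [].
    have e0 : 0 < a - tau (W om) by lra.
    have [t [t_ge wt] te] := inf_adherent e0 hi.
    have [k wk] := cpath_lt_dyadic t_ge wt.
    left; exists k => //; exists (Num.truncn (t * 2 ^+ k)) => //=.
    have /andP[h _] := dyadic_floor_itv k t_ge.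
    apply: le_lt_trans h _; move: te; rewrite -/(tau (W om)); lra.
  move=> [[k _ [i /= ia wl]]|H].
    by apply: le_lt_trans ia; apply: passage_time_le => //; exact: dyadic_ge0.
  suff h0 : hits (W om) = set0 by rewrite /passage_time -/(hits (W om)) h0 inf0.
  apply/seteqP; split => // t [t0 wt].
  have [k] := cpath_lt_dyadic t0 wt.
  by rewrite ltNge (H k Logic.I _ Logic.I).
apply: measurableU.
  apply: bigcupT_measurable => k; apply: bigcup_measurable => i _.
  by apply: measurable_set_ltr => //; apply: mW; exact: dyadic_ge0.
apply: bigcapT_measurable => k; apply: bigcapT_measurable => i.
by apply: measurable_set_ler => //; apply: mW; exact: dyadic_ge0.
Qed.

End passage_times.

Section passage_time_support.
Context (R : realType) d (Om : measurableType d) (P : probability Om R).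
Variables (W : Om -> cpath R) (hW : brownian_motion P W).
Variables (lambda : R) (lambda0 : lambda < 0).
Local Notation tau om := (passage_time lambda (W om)).

(** The path stays above [lambda] up to [s = 1 - 2 h], then has fallen below it at [1 - h]. On the
    grid of mesh [2^-N] the reflection bound is uniform in [N]; the grids are nested, so the events
    decrease and the bound passes to their intersection. *)
Lemma passage_time_support e : (2 <= e)%N ->
  0 < pr P [set om | 1 - 2 * (2 ^+ e)^-1 <= tau om <= 1 - (2 ^+ e)^-1].
Proof.
move=> e2; pose h : R := (2 ^+ e)^-1.
have mW := bm_measurable hW.
have h0 : 0 < h by rewrite invr_gt0 exprn_gt0.
have h4 : h <= 4^-1.
  rewrite /h lef_pV2 ?posrE ?exprn_gt0// (_ : 4 = 2 ^+ 2 :> R); last by ring.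
  by rewrite ler_weXn2l//; lra.
pose s := 1 - 2 * h; have s0 : 0 < s by rewrite /s; lra.
have ss0 : 0 < Num.sqrt s by rewrite sqrtr_gt0.
(* Staying above [- rho] is then staying above [lambda], and [rho <= sqrt s] is the range of the
   reflection bound. *)
pose rho := Num.min (- lambda) (Num.sqrt s).
have rho0 : 0 < rho by rewrite lt_min ss0 andbT oppr_gt0.
have rho_l : rho <= - lambda by rewrite ge_min lexx.
have rho_s : rho <= Num.sqrt s by rewrite ge_min lexx orbT.
pose c := kap R / Num.sqrt s * rho.
have c0 : 0 < c by rewrite mulr_gt0// divr_gt0// kap_gt0.
have mWs : measurable_fun setT (fun om => W om s) by apply: mW; exact: ltW.
have c20 : 0 < c / 2 by lra.
have [A HA] := pr_tail_small P mWs c20.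
(* From any value at most [A] at time [s], a displacement at most [b] leads below [lambda]. *)
pose a := - (`|A| - lambda + 2); pose b := - (`|A| - lambda + 1).
have ab : a < b by rewrite /a /b; lra.
pose g := gauss h `[a, b]%classic.
have g0 : 0 < g by exact: gauss_itv_gt0.
pose fall := [set om | `|W om s| <= A] `&` [set om | a <= W om (1 - h) - W om s <= b].
have itvE (X : Om -> R) : [set om | a <= X om <= b] =
    [set om | a <= X om] `&` [set om | X om <= b].
  by apply/seteqP; split => om /= => [/andP|] [->].
have mtail : measurable [set om | `|W om s| <= A].
  by apply: measurable_set_ler => //; exact: measurableT_comp.
have mfall : measurable fall.
  apply: measurableI => //; rewrite itvE.
  have m1h : measurable_fun setT (fun om => W om (1 - h)) by apply: mW; lra.
  by apply: measurableI; apply: measurable_set_ler => //; exact: measurable_funB.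
pose E N := [set om | forall i, dyadic R N i <= s -> - rho <= W om (dyadic R N i)] `&` fall.
have mE N : measurable (E N).
  apply: measurableI => //.
  rewrite (_ : [set om | _] = \bigcap_(i in [set i | dyadic R N i <= s])
     [set om | - rho <= W om (dyadic R N i)]); last by apply/seteqP; split.
  apply: bigcap_measurableType => i _; apply: measurable_set_ler => //.
  by apply: mW; exact: dyadic_ge0.
have EN N : (e <= N)%N -> c / 2 * g <= pr P (E N).
  move=> eN; pose n := (2 ^ N)%N; pose v : R := (2 ^+ N)^-1.
  pose p := (2 ^ (N - e))%N; pose m := (n - 2 * p)%N; pose m' := (n - p)%N.
  have v0 : 0 < v by rewrite invr_gt0 exprn_gt0.
  have nv : n%:R * v = 1 by rewrite /n natrX mulfV// expf_neq0.
  have pv : p%:R * v = h.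
    have h2 k : (2 ^+ k : R) != 0 by rewrite expf_neq0.
    have eN2 : (2 ^+ N : R) = 2 ^+ (N - e) * 2 ^+ e by rewrite -exprD subnK.
    by rewrite /p /v /h natrX eN2 invfM mulrA mulfV// mul1r.
  have np : n = (2 ^ e * p)%N by rewrite /n /p -expnD subnKC.
  have p4 : (4 * p <= n)%N.
    by rewrite np leq_mul// -[4%N]/(2 ^ 2)%N leq_exp2l.
  have p0 : (0 < p)%N by rewrite expn_gt0.
  have [p2n pn] : (2 * p <= n)%N /\ (p <= n)%N.
    by split; apply: leq_trans p4; [rewrite leq_mul2r orbT|rewrite leq_pmull].
  have mv : m%:R * v = s.
    by rewrite /m natrB ?mulrBl ?nv ?natrM -?mulrA ?pv// p2n.
  have mv' : m'%:R * v = 1 - h by rewrite /m' natrB ?mulrBl ?nv ?pv// pn.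
  pose S i om := W om (0 + i%:R * v).
  have gS : gaussian_walk P n S v by exact: brownian_walk.
  have S0 om : S 0%N om = 0 by rewrite /S mul0r addr0 cpath0.
  have Sm om : S m om = W om s by rewrite /S add0r mv.
  have Sm' om : S m' om = W om (1 - h) by rewrite /S add0r mv'.
  pose A1 := near_future_min S rho 0 m `&` [set om | `|S m om - S 0%N om| <= A].
  pose A2 := [set om | a <= S m' om - S m om <= b].
  have m0n : (0 < m <= n)%N by rewrite /m; nlia.
  have p1 : past n (fun i om => S i.+1 om - S i om) (fun i => (0 <= i < m)%N) A1.
    apply: pastI; first by apply: past_near_future_min => //; nlia.
    apply: past_le; last exact: past_fun_cst.
    apply: (past_fun_comp (g := fun x => `|x|)); first exact: normr_measurable.
    by apply: past_fun_increment => //; nlia.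
  have p2 : past n (fun i om => S i.+1 om - S i om) (fun i => (m <= i < m')%N) A2.
    rewrite /A2 itvE; apply: pastI; apply: past_le; try exact: past_fun_cst.
      by apply: past_fun_increment => //; rewrite /m /m'; nlia.
    by apply: past_fun_increment => //; rewrite /m /m'; nlia.
  have b1 : c <= pr P (near_future_min S rho 0 m).
    have := pr_near_future_min_lb gS v0 m0n (ltW rho0).
    by rewrite subn0 mv; apply.
  have b2 : c / 2 <= pr P A1.
    have mnf : measurable (near_future_min S rho 0 m).
      by apply: (measurable_near_future_min gS); nlia.
    have mSm : measurable [set om | `|S m om - S 0%N om| <= A].
      rewrite (_ : [set om | _] = [set om | `|W om s| <= A])//.
      by apply/seteqP; split => om /=; rewrite Sm S0 subr0.
    have := pr_setID P mnf mSm.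
    have : pr P (near_future_min S rho 0 m `&` ~` [set om | `|S m om - S 0%N om| <= A])
        <= pr P [set om | A < `|W om s|].
      apply: pr_le.
      - by apply: measurableI => //; exact: measurableC.
      - by apply: measurable_set_ltr => //; exact: measurableT_comp.
      - by move=> om [_ /= /negP]; rewrite Sm S0 subr0 -ltNge.
    by rewrite -/A1; lra.
  have b3 : pr P A2 = g.
    rewrite /A2 (pr_increment_itv gS); last by rewrite /m /m'; nlia.
    by rewrite (_ : (m' - m)%N = p) ?pv//; rewrite /m /m'; nlia.
  apply: (@le_trans _ _ (pr P (A1 `&` A2))).
    rewrite (past_indep (gw_measurable gS) (gw_indep gS) _ p1 p2); last by move=> i; nlia.
    by rewrite b3 ler_pM2r.
  apply: pr_le => //.
    apply: measurableI.
      exact: (past_measurable (gw_measurable gS) p1).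
    exact: (past_measurable (gw_measurable gS) p2).
  move=> om [[nf /= tl] /= fl]; rewrite /A2/= Sm Sm' in fl; rewrite Sm S0 subr0 in tl.
  split => // i; rewrite /dyadic -/v => iv.
  have im : (0 <= i <= m)%N.
    by rewrite leq0n -(ler_nat R) -(ler_pM2r v0) mv.
  have := nf i im; rewrite S0 /S add0r; lra.
have Edec : nonincreasing_seq (fun N => E (N + e)%N).
  apply/nonincreasing_seqP => N; apply/subsetPset => om [H fl]; split => // i.
  have -> : dyadic R (N + e) i = dyadic R (N.+1 + e) (2 * i).
    rewrite /dyadic addSn exprS natrM invfM mulrACA mulfV ?mul1r//.
  exact: H.
have lim : c / 2 * g <= pr P (\bigcap_N E (N + e)%N).
  have mI : measurable (\bigcap_N E (N + e)%N) by apply: bigcapT_measurable => N.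
  have cv : P (E (N + e)%N) @[N --> \oo] --> P (\bigcap_N E (N + e)%N).
    apply: (@nonincreasing_cvg_mu _ _ _ P (fun N => E (N + e)%N)) => //.
    by rewrite ltey_eq fin_num_measure.
  rewrite -lee_fin -prE//; apply: (cvge_to_ge cv).
  by apply: nearW => N /=; rewrite prE// lee_fin; apply: EN; exact: leq_addl.
apply: lt_le_trans (_ : 0 < c / 2 * g) _; first by rewrite mulr_gt0.
apply: le_trans lim _; apply: pr_le.
- by apply: bigcapT_measurable => N.
- have mt := @measurable_passage_time R lambda _ _ W mW.
  rewrite (_ : [set _ | _] = [set om | 1 - 2 * h <= tau om] `&` [set om | tau om <= 1 - h]).
    by apply: measurableI; apply: measurable_set_ler.
  by apply/seteqP; split => om /= => [/andP|] [->].
move=> om H; have [_ [/= Ws /andP[_ fl]]] := H 0%N Logic.I.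
have W1 : W om (1 - h) < lambda.
  by move: Ws fl; rewrite /b ler_norml => /andP[_ w1]; have := ler_norm A; lra.
have h10 : 0 <= 1 - h by lra.
rewrite (passage_time_le h10 W1) andbT.
apply: passage_time_ge; first by exists (1 - h).
move=> t /andP[t0 ts]; rewrite leNgt; apply/negP => wt.
have : - rho <= W om t.
  have := @cpath_cvg_dyadic R (W om) t t0 => cw.
  apply: (cvgr_to_ge cw); exists e => // k /= ek.
  have [Hk _] := H (k - e)%N Logic.I; rewrite subnK// in Hk; apply: Hk.
  have /andP[h1 _] := dyadic_floor_itv k t0.
  by apply: le_trans h1 _; exact: ltW.
lra.
Qed.

End passage_time_support.

Section minimum_near_one.
Context (R : realType).
Implicit Types f g : C01 R.

Lemma expV2_le1 k : (2 ^+ k)^-1 <= 1 :> R.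
Proof. by rewrite invf_le1 ?exprn_gt0// exprn_ege1//; lra. Qed.

Lemma C01_near1 f (e : R) : 0 < e ->
  exists j, forall u : R, 1 - (2 ^+ j)^-1 <= u <= 1 -> `|f 1 - f u| < e.
Proof.
move=> e0; have : (f \o @clamp R) x @[x --> (1 : R)] --> (f \o @clamp R) 1.
  exact: C01_clamp_continuous.
rewrite /= clamp_id ?ler01 ?lexx// => /cvgrPdist_lt /(_ e e0).
move=> /nbhs_ballP[a /= a0 Ha]; have [j0 /(_ j0 (leqnn _)) hj] := expV2_lt a0.
have p0 : 0 < (2 ^+ j0)^-1 :> R by rewrite invr_gt0 exprn_gt0.
have p1 := expV2_le1 j0.
exists j0 => u u1; have b : ball (1 : R) a u.
  by rewrite /ball /= ger0_norm; lra.
by have := Ha u b; rewrite /= clamp_id//; lra.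
Qed.

Variables (a : R) (a01 : 0 <= a <= 1).

(** A path that passes at [t < 1] is unconstrained afterwards, so its value at [1] carries no
    information; the infimum over a final window does, and is Lipschitz for the uniform distance. *)
Definition last_inf f : R := inf [set f u | u in [set u : R | a <= u <= 1]].

Let has_last_inf f : has_inf [set f u | u in [set u : R | a <= u <= 1]].
Proof.
split; first by exists (f 1), 1 => //=; rewrite lexx andbT; case/andP: a01.
exists (f (argmin f)) => _ [u /= ua <-]; apply: argmin_min.
by have /andP[a0 _] := a01; have /andP[au ->] := ua; rewrite (le_trans a0 au).
Qed.

Lemma last_inf_le f u : a <= u <= 1 -> last_inf f <= f u.
Proof. by move=> ua; apply: (ge_inf (has_last_inf f).2); exists u. Qed.

Lemma last_inf_ge f c : (forall u, a <= u <= 1 -> c <= f u) -> c <= last_inf f.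
Proof.
move=> H; apply: lb_le_inf; first exact: (has_last_inf f).1.
by move=> _ [u ua <-]; exact: H.
Qed.

Lemma last_inf_lipschitz f g e : (forall u : R, `|f u - g u| < e) ->
  `|last_inf f - last_inf g| <= e.
Proof.
move=> fg; rewrite ler_distl; apply/andP; split.
  apply: last_inf_ge => u ua; have := last_inf_le g ua.
  by have := fg u; rewrite ltr_norml => /andP[? ?] ?; lra.
rewrite -lerBlDr; apply: last_inf_ge => u ua; have := last_inf_le f ua.
by have := fg u; rewrite ltr_norml => /andP[? ?] ?; lra.
Qed.

End minimum_near_one.

Section first_passage_bridges.
Context (R : realType) d (Om : measurableType d) (P : probability Om R).
Variables (W : Om -> cpath R) (hW : brownian_motion P W).
Variables (lambda : R) (lambda0 : lambda < 0).
Variable kappa : R.-pker R ~> C01 R.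
Local Notation tau om := (passage_time lambda (W om)).
Hypothesis kappa_law : regular_conditional_law P
  (fun om => restrict01 (W om)) (fun om => tau om) kappa.
Hypothesis kappa_cont : weakly_continuous_at kappa 1.

(** The disintegration identity determines [kappa t] only almost everywhere. Since the passage time
    charges the interval, positivity of [kappa t A] throughout it would give the empty event
    positive probability. *)
Lemma kernel_null_before1 e (A : set (C01 R)) : (2 <= e)%N -> measurable A ->
  (forall om, 1 - 2 * (2 ^+ e)^-1 <= tau om <= 1 - (2 ^+ e)^-1 ->
     ~ A (restrict01 (W om))) ->
  exists2 t, 1 - 2 * (2 ^+ e)^-1 <= t <= 1 - (2 ^+ e)^-1 & kappa t A = 0%E.
Proof.
move=> e2 mA HA; apply: contrapT => Ht.
pose D : set R := [set t | 1 - 2 * (2 ^+ e)^-1 <= t <= 1 - (2 ^+ e)^-1].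
have mD : measurable D.
  by rewrite (_ : D = `[1 - 2 * (2 ^+ e)^-1, 1 - (2 ^+ e)^-1]%classic)//
     ; apply/seteqP; split => t; rewrite /D /= in_itv.
have mtau := @measurable_passage_time R lambda _ _ W (bm_measurable hW).
pose tD := (fun om => tau om) @^-1` D.
have mtD : measurable tD by rewrite -[tD]setTI; exact: mtau.
have mk : measurable_fun setT (fun om => kappa (tau om) A).
  exact: (measurableT_comp (measurable_kernel kappa A mA) mtau).
have := kappa_law mA mD.
rewrite (_ : _ `&` _ = set0); last first.
  by apply/seteqP; split => // om [/= Aom /HA].
rewrite measure0 => /esym I0.
have : P tD = 0%E.
  apply: (@null_of_integral_eq0 _ _ _ P tD (fun om => kappa (tau om) A)) => //.
    exact: measurable_funTS.
  move=> om tom; rewrite lt0e measure_ge0 andbT; apply/eqP => k0.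
  by apply: Ht; exists (tau om).
rewrite prE// => -[P0]; have := passage_time_support hW lambda0 e2.
by rewrite -[X in 0 < pr P X]/tD P0 ltxx.
Qed.

(** The integral of [psi] vanishes at points [t e] that tend to [1], hence at [1] by weak
    continuity. *)
Lemma kernel_null_at1 (psi : C01 R -> R) : continuous psi ->
  (forall f, 0 <= psi f <= 1) ->
  (exists e0, forall e om, (e0 <= e)%N ->
     1 - 2 * (2 ^+ e)^-1 <= tau om <= 1 - (2 ^+ e)^-1 ->
     psi (restrict01 (W om)) = 0) ->
  (kappa 1).-negligible [set f | 0 < psi f].
Proof.
move=> cpsi psi01 [e0 He].
have mpsi : measurable_fun setT psi.
  apply: measurable_fun_of_lt => a; apply: sub_sigma_algebra.
  rewrite (_ : [set f | _] = psi @^-1` [set x | x < a])//.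
  by apply: open_comp; [move=> f _; exact: cpsi|exact: open_lt].
have mpos : measurable [set f | 0 < psi f] by apply: measurable_set_ltr.
have mEpsi : measurable_fun setT (fun f => (psi f)%:E).
  exact/measurable_EFinP.
have /choice[t Ht] (e : nat) : exists t : R,
    1 - 2 * (2 ^+ (e + (e0 + 2)))^-1 <= t <= 1 /\ kappa t [set f | 0 < psi f] = 0%E.
  have e2 : (2 <= e + (e0 + 2))%N by rewrite addnA leq_addl.
  have [|t /andP[t1 t2] kt] := kernel_null_before1 e2 mpos.
    move=> om tom /=; rewrite (He (e + (e0 + 2))%N) ?ltxx//.
    by rewrite addnCA leq_addr.
  have p0 : 0 < (2 ^+ (e + (e0 + 2)))^-1 :> R by rewrite invr_gt0 exprn_gt0.
  by exists t; split => //; lra.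
have ct : t e @[e --> \oo] --> (1 : R).
  apply/cvgrPdist_lt => a a0; have a20 : 0 < a / 2 by lra.
  have [k0 Hk] := expV2_lt a20; exists k0 => // k /= kk.
  have [/andP[t1 t2] _] := Ht k; rewrite ger0_norm; last by lra.
  have := Hk (k + (e0 + 2))%N (leq_trans kk (leq_addr _ _)).
  by lra.
have cI := cvg_comp _ _ ct (kappa_cont cpsi _).
have I0 : (\int[kappa 1%R]_f (psi f)%:E = 0)%E.
  have bpsi : exists M : R, forall f, `|psi f| <= M.
    by exists 1 => f; have /andP[p0 p1] := psi01 f; rewrite ger0_norm.
  apply: (cvg_unique _ (cI bpsi)) => //.
  rewrite (_ : _ \o _ = cst 0%E); first exact: cvg_cst.
  apply/funext => e /=; have [_ k0] := Ht e.
  apply: (integral_eq0_of_null mEpsi _ mpos k0).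
    by move=> f; rewrite lee_fin; case/andP: (psi01 f).
  move=> f /negP; rewrite -leNgt => p0; congr EFin; apply/eqP.
  by rewrite eq_le p0; case/andP: (psi01 f).
apply/negligibleP => //.
have I0' : (\int[kappa 1%R]_(f in [set f | (0 < psi f)%R]) (psi f)%:E = 0)%E.
  apply/eqP; rewrite eq_le integral_ge0 ?andbT//; last by move=> f /=; rewrite lee_fin => /ltW.
  rewrite -I0; apply: ge0_subset_integral => // f _.
  by rewrite lee_fin; case/andP: (psi01 f).
by apply: null_of_integral_eq0 I0' => //; exact: measurable_funTS.
Qed.

Lemma first_passage_bridge_lb (u : R) : 0 <= u < 1 ->
  (kappa 1).-negligible [set f : C01 R | f u < lambda].
Proof.
move=> /andP[u0 u1].
have -> : [set f : C01 R | f u < lambda] = [set f : C01 R | 0 < clip (lambda - f u)].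
  apply/seteqP; split => f /= H.
    rewrite lt_def; have /andP[-> _] := clip_itv (lambda - f u); rewrite andbT.
    by apply/eqP => /clip_eq0; lra.
  rewrite ltNge; apply/negP => h.
  have /clip_eq0 c0 : lambda - f u <= 0 by lra.
  by move: H; rewrite c0 ltxx.
apply: kernel_null_at1 => [|f|]; last 1 first.
- have v0 : 0 < (1 - u) / 2 by lra.
  have [k0 Hk] := expV2_lt v0; exists k0 => e om ek /andP[t1 _].
  apply/clip_eq0; rewrite restrict01E ?u0 ?(ltW u1)// subr_le0.
  by apply: passage_time_gt; rewrite u0/=; have := Hk e ek; lra.
- apply: C01_lipschitz_continuous => f g e e0 /(_ u) fg.
  apply: le_trans (clip_lipschitz _ _) _.
  rewrite (_ : lambda - f u - (lambda - g u) = - (f u - g u)); last by ring.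
  by rewrite normrN; apply: (le_trans (ltW fg)); lra.
- exact: clip_itv.
Qed.

Lemma first_passage_bridge_ub j :
  (kappa 1).-negligible [set f : C01 R | lambda < last_inf (1 - (2 ^+ j)^-1) f].
Proof.
have j0 : 0 < (2 ^+ j)^-1 :> R by rewrite invr_gt0 exprn_gt0.
have a01 : 0 <= 1 - ((2 : R) ^+ j)^-1 <= 1.
  by have := expV2_le1 R j; lra.
set a := 1 - (2 ^+ j)^-1 in a01 *.
have -> : [set f : C01 R | lambda < last_inf a f] =
    [set f : C01 R | 0 < clip (last_inf a f - lambda)].
  apply/seteqP; split => f /= H.
    rewrite lt_def; have /andP[-> _] := clip_itv (last_inf a f - lambda).
    by rewrite andbT; apply/eqP => /clip_eq0; lra.
  rewrite ltNge; apply/negP => h.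
  have /clip_eq0 c0 : last_inf a f - lambda <= 0 by lra.
  by move: H; rewrite c0 ltxx.
apply: kernel_null_at1 => [|f|]; last 1 first.
(* [4 * 2^-e <= 2^-j] makes the passage time positive and places a time in [[tau, tau + 2^-e)] with
   value below [lambda] inside the window [[a, 1]]. *)
- exists j.+2 => e om ej /andP[t1 t2].
  have h0 : 0 < (2 ^+ e)^-1 :> R by rewrite invr_gt0 exprn_gt0.
  have h4 : 4 * (2 ^+ e)^-1 <= (2 ^+ j)^-1 :> R.
    have -> : (2 ^+ e : R) = 4 * (2 ^+ (e - j.+2) * 2 ^+ j).
      by rewrite -[in LHS](subnK ej) exprD !exprS; ring.
    rewrite invfM mulVKf// invfM; apply: ler_piMl; first exact: ltW.
    exact: expV2_le1.
  have t0 : 0 < tau om by rewrite /a in a01; lra.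
  have [t /andP[tt1 tt2] wt] := passage_time_adherent t0 h0.
  apply/clip_eq0; rewrite subr_le0.
  have ta : a <= t <= 1 by rewrite /a; lra.
  apply: le_trans (last_inf_le a01 _ ta) _.
  by rewrite restrict01E; [exact: ltW|lra].
- apply: C01_lipschitz_continuous => f g e e0 fg.
  apply: le_trans (clip_lipschitz _ _) _.
  rewrite (_ : _ - lambda - _ = last_inf a f - last_inf a g); last by ring.
  by apply: le_trans (last_inf_lipschitz a01 fg) _; lra.
- exact: clip_itv.
Qed.

Lemma first_passage_bridge_ends_at_min :
  (kappa 1).-negligible (~` ends_at_min lambda).
Proof.
pose N1 k i := if dyadic R k i < 1 then [set f : C01 R | f (dyadic R k i) < lambda] else set0.
pose N2 j := [set f : C01 R | lambda < last_inf (1 - (2 ^+ j)^-1) f].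
apply: (@negligibleS _ _ _ _ ((\bigcup_k \bigcup_i N1 k i) `|` \bigcup_j N2 j)); last first.
  apply: negligibleU; apply: negligible_bigcup => k; last exact: first_passage_bridge_ub.
  apply: negligible_bigcup => i; rewrite /N1; case: ifPn => [i1|_].
    by apply: first_passage_bridge_lb; rewrite dyadic_ge0.
  exact: negligible_set0.
suff key (f : C01 R) : ~ ((\bigcup_k \bigcup_i N1 k i) `|` \bigcup_j N2 j) f ->
    ends_at_min lambda f by move=> f; exact: contra_notP (key f).
move=> /not_orP[H1 H2].
have lb u : 0 <= u < 1 -> lambda <= f u.
  move=> /andP[u0 u1].
  have := @le_of_dyadic R (cst lambda) (f \o @clamp R) u (@cst_continuous _ _ _).
  move=> /(_ (@C01_clamp_continuous R f) _ u); rewrite /= clamp_id ?u0 ?(ltW u1)//.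
  rewrite lexx; apply => // k i ku; have i1 := le_lt_trans ku u1.
  rewrite /= clamp_id ?dyadic_ge0 ?(ltW i1)// leNgt; apply/negP => fl.
  by apply: H1; exists k => //; exists i => //; rewrite /N1 i1.
have f1_ge : lambda <= f 1.
  rewrite leNgt; apply/negP => f1.
  have e0 : 0 < lambda - f 1 by lra.
  have [j Hj] := C01_near1 f e0.
  have p0 : 0 < (2 ^+ j)^-1 :> R by rewrite invr_gt0 exprn_gt0.
  have p1 := expV2_le1 R j.
  have := Hj (1 - (2 ^+ j)^-1); rewrite lexx gerBl (ltW p0) => /(_ isT).
  have := lb (1 - (2 ^+ j)^-1); rewrite ltr_norml => h /andP[h1 h2].
  have : lambda <= f (1 - (2 ^+ j)^-1) by apply: h; lra.
  by lra.
have f1_le : f 1 <= lambda.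
  rewrite leNgt; apply/negP => f1.
  (* Half the excess, so that the infimum over the window still exceeds [lambda] strictly. *)
  have e0 : 0 < (f 1 - lambda) / 2 by lra.
  have [j Hj] := C01_near1 f e0.
  have p0 : 0 < (2 ^+ j)^-1 :> R by rewrite invr_gt0 exprn_gt0.
  have p1 := expV2_le1 R j.
  apply: H2; exists j => //; rewrite /N2 /=.
  apply: (@lt_le_trans _ _ ((f 1 + lambda) / 2)); first by lra.
  apply: last_inf_ge => [|u /Hj]; first by lra.
  by rewrite ltr_norml => /andP[_]; lra.
split; first by apply/eqP; rewrite eq_le f1_le.
move=> u /andP[u0]; rewrite le_eqVlt => /orP[/eqP-> //|u1].
by apply: lb; rewrite u0.
Qed.

End first_passage_bridges.

(** * Nonexistence of the random times *)

Lemma no_shift_ends_at_min (R : realType) (lambda : R)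
  (d : measure_display) (Om : measurableType d) (P : probability Om R)
  (B : Om -> cpath R) (hB : brownian_motion P B)
  (d' : measure_display) (Om' : measurableType d') (Q : probability Om' R)
  (Y : Om' -> C01 R) : (forall om, ends_at_min lambda (Y om)) ->
  ~ (exists T : Om -> {nonneg R}, random_time T /\
       same_law P Q (fun om => shift01 (B om) (T om)) Y).
Proof.
move=> HY [T [mT /(_ _ (measurable_ends_at_min lambda))]].
rewrite shift01_ends_at_min_null// (_ : Y @^-1` _ = setT) ?probability_setT.
  by move/eqP; rewrite eq_sym onee_eq0.
by apply/seteqP; split => // om _; exact: HY.
Qed.

Theorem theorem1p2 (R : realType)
  (d : measure_display) (Om : measurableType d) (P : probability Om R)
  (B : Om -> cpath R) (hB : brownian_motion P B)
  (d' : measure_display) (Om' : measurableType d') (Q : probability Om' R)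
  (W : Om' -> cpath R) (hW : brownian_motion Q W) :
  [/\ ~ (exists T : Om -> {nonneg R}, random_time T /\
        same_law P Q (fun om => shift01 (B om) (T om))
                     (fun om => excursion (W om))),
      ~ (exists T : Om -> {nonneg R}, random_time T /\
        same_law P Q (fun om => shift01 (B om) (T om))
                     (fun om => reflected_bridge (W om))),
      ~ (exists T : Om -> {nonneg R}, random_time T /\
        same_law P Q (fun om => shift01 (B om) (T om))
                     (fun om => vervaat (restrict01 (W om)))),
      forall lambda : R, lambda < 0 ->
        forall (d'' : measure_display) (Om'' : measurableType d'')
          (Q'' : probability Om'' R) (F : {RV Q'' >-> C01 R}),
        first_passage_bridge Q W lambda F ->
        ~ (exists T : Om -> {nonneg R}, random_time T /\
          same_law P Q'' (fun om => shift01 (B om) (T om)) F) &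
      forall lambda : R, lambda < 0 ->
        ~ (exists T : Om -> {nonneg R}, random_time T /\
          same_law P Q (fun om => shift01 (B om) (T om))
                       (fun om => vervaat (brownian_bridge (W om) lambda)))].
Proof.
split.
- by apply: no_shift_ends_at_min => // om; exact: excursion_ends_at_min.
- by apply: no_shift_ends_at_min => // om; exact: reflected_bridge_ends_at_min.
- move=> [T [mT XV]]; apply: (vervaat_min_at_both_ends_pos hW) => e.
  by rewrite -XV ?shift01_min_at_both_ends_null//; exact: measurable_min_at_both_ends.
- move=> lambda lambda0 d'' Om'' Q'' F [kappa [klaw kcont Fk]] [T [mT XF]].
  have mE := measurable_ends_at_min lambda.
  have E0 : kappa 1 (ends_at_min lambda) = 0%E.
    by rewrite -Fk// -XF// shift01_ends_at_min_null.
  have nC := first_passage_bridge_ends_at_min hW lambda0 klaw kcont.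
  (* Both the event and its complement are negligible for [kappa 1], a probability. *)
  have nE : (kappa 1).-negligible (ends_at_min lambda) by exact/negligibleP.
  have := negligibleU nE nC; rewrite setUv => /(measure_negligible measurableT) k0.
  by have /eqP := etrans (esym k0) (prob_kernel (s := kappa) 1); rewrite eq_sym onee_eq0.
- move=> lambda lambda0; apply: no_shift_ends_at_min => // om.
  have := @vervaat_ends_at_min R (brownian_bridge (W om) lambda).
  by rewrite brownian_bridge1; apply; exact: ltW.
Qed.
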